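(* Let $\lambda\in\mathbb C$ and $\lambda'=\bar\lambda-2i(m-1)$. With the operators described in the context, for all $\tilde U_j\in C^\infty([b_{j1},b_{j,R_j+1}])$ and $\tilde V_{jt}\in C^\infty([b_{jt},b_{j,t+1}])$ ($j=1,\dots,N$; $t=1,\dots,R_j$) the following Green formula with parameter $\lambda$ is valid: $$\sum_j\Big\{\sum_t(\tilde{\mathcal P}_j(\varphi,D_\varphi,\lambda)\tilde U_j,\tilde V_{jt})_{(b_{jt},b_{j,t+1})}+\sum_{\sigma,\mu}(\tilde{\mathcal B}_{j\sigma\mu}(\varphi,D_\varphi,\lambda)\tilde U,\ \tilde F_{j\sigma\mu}(\varphi,D_\varphi,\lambda')\tilde V_j|_{\varphi=b_{j\sigma}})_{\mathbb C}+\sum_{q,\mu}(\tilde B_{jq\mu}(\varphi,D_\varphi,\lambda)\tilde U_j|_{\varphi=b_{jq}},\ \tilde{\mathcal T}_{jq\mu}(\varphi,D_\varphi,\lambda')\tilde V)_{\mathbb C}\Big\}$$ $$=\sum_j\Big\{\sum_t(\tilde U_j,\tilde{\mathcal Q}_j(\varphi,D_\varphi,\lambda')\tilde V_{jt})_{(b_{jt},b_{j,t+1})}+\sum_{\sigma,\mu}(\tilde B'_{j\sigma\mu}(\varphi,D_\varphi,\lambda)\tilde U_j|_{\varphi=b_{j\sigma}},\ \tilde C_{j\sigma\mu}(\varphi,D_\varphi,\lambda')\tilde V_j|_{\varphi=b_{j\sigma}})_{\mathbb C}+\sum_{q,\mu}(\tilde B'_{jq\mu}(\varphi,D_\varphi,\lambda)\tilde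 U_j|_{\varphi=b_{jq}},\ \tilde{\mathcal T}_{jq,m+\mu}(\varphi,D_\varphi,\lambda')\tilde V)_{\mathbb C}\Big\}.$$ Here the sums are over $j=1,\dots,N$; $t=1,\dots,R_j$; $\sigma\in\{1,R_j+1\}$; $q=2,\dots,R_j$; $\mu=1,\dots,m$; $$\tilde{\mathcal B}_{j\sigma\mu}(\varphi,D_\varphi,\lambda)\tilde U=\tilde B_{j\sigma\mu}(\varphi,D_\varphi,\lambda)\tilde U_j|_{\varphi=b_{j\sigma}}+\sum_{k,q,s}e^{(i\lambda-m_{j\sigma\mu})\ln\chi_{j\sigma kqs}}\tilde B_{j\sigma\mu kqs}(\varphi,D_\varphi,\lambda)\tilde U_k(\varphi+\varphi_{j\sigma kq})|_{\varphi=b_{j\sigma}},$$ and for $\nu=1,\dots,2m$ $$\tilde{\mathcal T}_{jq\nu}(\varphi,D_\varphi,\lambda')\tilde V=\tilde T_{jq\nu}(\varphi,D_\varphi,\lambda')\tilde V_{j,q-1}|_{\varphi=b_{jq}}-\tilde T_{jq\nu}(\varphi,D_\varphi,\lambda')\tilde V_{jq}|_{\varphi=b_{jq}}+\sum_{k,\sigma,s}e^{(i\lambda'-(\nu-1))\ln\chi'_{jqk\sigma s}}\tilde T_{jq\nu k\sigma s}(\varphi,D_\varphi,\lambda')\tilde V_k(\varphi+\varphi'_{jqk\sigma})|_{\varphi=b_{jq}}.$$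
   Context: **Geometry.** Integers $n\ge 2$, $N\ge1$, $m\ge1$, $R_j\ge1$ and angles $0<b_{j1}<\dots<b_{j,R_j+1}<2\pi$ ($j=1,\dots,N$) are fixed. Points of $\mathbb R^n$ are $x=(y,z)$, $y\in\mathbb R^2$, $z\in\mathbb R^{n-2}$; $(r,\varphi)$ are the polar coordinates of $y$; $M=\{x:y=0\}$. $\Omega_j=\{r>0,\ b_{j1}<\varphi<b_{j,R_j+1}\}$, $\Omega_{jt}=\{r>0,\ b_{jt}<\varphi<b_{j,t+1}\}$ ($t=1,\dots,R_j$), $\Gamma_{jq}=\{r>0,\varphi=b_{jq}\}$ ($q=1,\dots,R_j+1$), subsets of $\mathbb R^n$. $D=-i\partial$. **Boundary operators.** Indices: $j,k=1,\dots,N$; $\sigma\in\{1,R_j+1\}$; $\mu=1,\dots,m$; $q=2,\dots,R_k$; $s=1,\dots,S_{j\sigma kq}$. $\mathcal P_j(D_y,D_z)$, $B_{j\sigma\mu}(D_y,D_z)$, $B_{j\sigma\mu kqs}(D_y,D_z)$ are homogeneous differential operators with constant complex coefficients of orders $2m$, $m_{j\sigma\mu}\le 2m-1$, $m_{j\sigma\mu}$. Each $\mathcal P_j$ is properly elliptic; $\{B_{j\sigma\mu}\}_{\mu=1}^m$ is normal on $\Gamma_{j\sigma}$ and covers $\mathcal P_j$ there (Lions–Magenes sense). $\mathcal G_{j\sigma kqs}$ is the rotation of the $y$-plane by $\varphi_{j\sigma kq}$ composed with dilation by $\chi_{j\sigma kqs}>0$, where $b_{j\sigma}+\varphi_{j\sigma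 kq}=b_{kq}$. $\mathcal B_{j\sigma\mu}U=B_{j\sigma\mu}U_j|_{\Gamma_{j\sigma}}+\sum_{k,q,s}(B_{j\sigma\mu kqs}U_k)(\mathcal G_{j\sigma kqs}y,z)|_{\Gamma_{j\sigma}}$. $\mathcal Q_j$ is the formal adjoint of $\mathcal P_j$. $\mathcal G'_{jqk\sigma s}$ is the rotation by $\varphi'_{jqk\sigma}=-\varphi_{k\sigma jq}$ composed with dilation by $\chi'_{jqk\sigma s}=1/\chi_{k\sigma jqs}$. **Operators of the Green formula in the dihedral angles.** $B'_{j\sigma\mu}$ ($\sigma\in\{1,R_j+1\}$), $B_{jq\mu},B'_{jq\mu}$ ($q=2,\dots,R_j$), $C_{j\sigma\mu},F_{j\sigma\mu}$, $T_{jq\nu}$ and $T_{jq\nu k\sigma s}$ ($q=2,\dots,R_j$; $\nu=1,\dots,2m$; $\sigma\in\{1,R_k+1\}$; $s=1,\dots,S'_{jqk\sigma}=S_{k\sigma jq}$) are fixed homogeneous differential operators in $(D_y,D_z)$ with constant coefficients, of orders $2m-1-m'_{j\sigma\mu}$; $2m-\mu$, $m-\mu$; $m'_{j\sigma\mu}$, $2m-1-m_{j\sigma\mu}$; $\nu-1$; $\nu-1$ (the last ones possibly zero), such that $\{B_{j\sigma\mu},B'_{j\sigma\mu}\}_{\mu}$ and $\{C_{j\sigma\mu},F_{j\sigma\mu}\}_\mu$ are Dirichlet systems of order $2m$ on $\Gamma_{j\sigma}$, $\{C_{j\sigma\mu}\}_\mu$ covers $\mathcal Q_j$ on $\Gamma_{j\sigma}$,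 $\{B_{jq\mu},B'_{jq\mu}\}_\mu$ and $\{T_{jq\nu}\}_\nu$ are Dirichlet systems of order $2m$ on $\Gamma_{jq}$ ($q=2,\dots,R_j$), and, for all $U_j\in C_0^\infty(\overline\Omega_j\setminus M)$, $V_{jt}\in C^\infty(\overline\Omega_{jt}\setminus M)$ (or $U_j\in C^\infty$, $V_{jt}\in C_0^\infty$), $$\sum_j\Big\{\sum_t(\mathcal P_jU_j,V_{jt})_{\Omega_{jt}}+\sum_{\sigma,\mu}(\mathcal B_{j\sigma\mu}U,F_{j\sigma\mu}V_j)_{\Gamma_{j\sigma}}+\sum_{q,\mu}(B_{jq\mu}U_j,\mathcal T_{jq\mu}V)_{\Gamma_{jq}}\Big\}=\sum_j\Big\{\sum_t(U_j,\mathcal Q_jV_{jt})_{\Omega_{jt}}+\sum_{\sigma,\mu}(B'_{j\sigma\mu}U_j,C_{j\sigma\mu}V_j)_{\Gamma_{j\sigma}}+\sum_{q,\mu}(B'_{jq\mu}U_j,\mathcal T_{jq,m+\mu}V)_{\Gamma_{jq}}\Big\},$$ with $\mathcal T_{jq\nu}V=T_{jq\nu}V_{j,q-1}|_{\Gamma_{jq}}-T_{jq\nu}V_{jq}|_{\Gamma_{jq}}+\sum_{k,\sigma,s}(T_{jq\nu k\sigma s}V_k)(\mathcal G'_{jqk\sigma s}y,z)|_{\Gamma_{jq}}$ (sum over $k=1,\dots,N$; $\sigma\in\{1,R_k+1\}$; $s=1,\dots,S'_{jqk\sigma}$), $(u,v)_X=\int_Xu\bar v$, $V_j=V_{jt}$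 on $\Omega_{jt}$. Such operators exist. (A Dirichlet system of order $2m$ is a normal system — pairwise distinct orders, noncharacteristic surface — of $2m$ operators whose orders run through $0,\dots,2m-1$; $C_0^\infty(\overline\Omega_j\setminus M)$ means compact support in $\overline\Omega_j\setminus M$.) **Tilde notation.** For each of these operators $A(D_y,D_z)$, of order $\kappa$, put $D_z=0$ and write in polar coordinates $A(D_y,0)=r^{-\kappa}\tilde A(\varphi,D_\varphi,rD_r)$; $\tilde A(\varphi,D_\varphi,\lambda)$ is obtained by substituting $\lambda$ for $rD_r$. **Pairings.** $(\tilde U,\tilde V)_{(b_{jt},b_{j,t+1})}=\int_{b_{jt}}^{b_{j,t+1}}\tilde U\overline{\tilde V}\,d\varphi$; $(d,e)_{\mathbb C}=d\bar e$. $\tilde V_j$ is the function equal to $\tilde V_{jt}$ on $(b_{jt},b_{j,t+1})$; $\tilde U=(\tilde U_1,\dots,\tilde U_N)$, $\tilde V=(\tilde V_1,\dots,\tilde V_N)$. *)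

(* Defs.v *)
From HB Require Import structures.
From mathcomp Require Import all_boot all_order all_algebra complex.
From mathcomp Require Import all_classical all_reals all_analysis ring.
(* The notations of mpoly clash with those of MathComp-Analysis. *)
From mathcomp.multinomials Require mpoly.
Import -(notations) mpoly.
Import numFieldNormedType.Exports.
Import Order.TTheory GRing.Theory Num.Theory.

Set Implicit Arguments.
Unset Strict Implicit.
Unset Printing Implicit Defensive.

Local Open Scope classical_set_scope.
Local Open Scope ring_scope.

Section Calculus.
Variable R : realType.
Local Notation C := R[i].

Definition cderive (V : normedModType R) (v : V) (u : V -> C) : V -> C :=
  fun x => ('D_v (fun y => complex.Re (u y)) x +i*
            'D_v (fun y => complex.Im (u y)) x)%C.

(* D = -i d, in the direction v *)
Definition Dop (V : normedModType R) (v : V) (u : V -> C) : V -> C :=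
  fun x => - 'i * cderive v u x.

Definition cdifferentiable (V : normedModType R) (u : V -> C) (x : V) : Prop :=
  differentiable (fun y => complex.Re (u y)) x /\
  differentiable (fun y => complex.Im (u y)) x.

(* C^infinity on the set O: every iterated derivative is differentiable. *)
Definition csmooth (V : normedModType R) (O : set V) (u : V -> C) : Prop :=
  forall (s : seq V) x, O x -> cdifferentiable (foldr (@Dop V) u s) x.

(* C^infinity up to the boundary: u is the restriction to K of a function
   which is C^infinity on an open neighbourhood of K; the functions of the
   theorem are total, and only their values near K are constrained. *)
Definition csmooth_upto (V : normedModType R) (K : set V) (u : V -> C) : Prop :=
  exists O : set V, [/\ open O, K `<=` O & csmooth O u].

Definition csupport_in (V : normedModType R) (K : set V) (u : V -> C) : Prop :=
  exists L : set V,
    [/\ compact L, L `<=` K & forall x, K x -> ~ L x -> u x = 0].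

Definition cexp (z : C) : C :=
  ((expR (complex.Re z) * cos (complex.Im z)) +i*
   (expR (complex.Re z) * sin (complex.Im z)))%C.

Definition cintegral (X : Type) (I : (X -> R) -> R) (f : X -> C) : C :=
  (I (fun x => complex.Re (f x)) +i* I (fun x => complex.Im (f x)))%C.

(* Integral over R^n, as an iterated Lebesgue integral (Fubini): MathComp-Analysis
   has Lebesgue measure on the line only. *)
Fixpoint integral_rV (n : nat) : ('rV[R]_n -> R) -> R :=
  match n with
  | 0%N => fun f => f 0
  | n'.+1 => fun f =>
      Rintegral (@lebesgue_measure R) setT
        (fun t : R => integral_rV
          (fun v : 'rV[R]_n' => f (row_mx (const_mx t : 'rV[R]_1) v)))
  end.

Definition integral_arc (a b : R) (f : R -> C) : C :=
  cintegral (fun g => Rintegral (@lebesgue_measure R) `]a, b[%classic g) f.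

End Calculus.

(* A homogeneous operator A(D) with constant coefficients is given by its
   symbol, a polynomial in the n variables dual to x. *)
Notation symbol R n := (mpoly n R[i]).

Section Operators.
Variables (R : realType) (n : nat).
Local Notation C := R[i].

(* kappa.-homog in the notation of mpoly *)
Definition homogeneous (kappa : nat) (A : symbol R n) : Prop :=
  A \is ishomog1 kappa mdeg.

(* D_0^(a 0) D_1^(a 1) ... *)
Definition Dmon (a : multinom n) (u : 'rV[R]_n -> C) : 'rV[R]_n -> C :=
  foldr (fun (i : 'I_n) f => iter (a i) (Dop (delta_mx 0 i : 'rV[R]_n)) f)
        u (enum 'I_n).

Definition opD (A : symbol R n) (u : 'rV[R]_n -> C) : 'rV[R]_n -> C :=
  fun x => \sum_(a <- msupp A) mcoeff a A * Dmon a u x.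

(* D is formally selfadjoint for (u, v) = \int u v^* *)
Definition formal_adjoint (A : symbol R n) : symbol R n :=
  map_mpoly (Num.conj : C -> C) A.

Definition symb_eval (A : symbol R n) (xi : 'rV[R]_n) : C :=
  meval (fun i => (xi 0 i)%:C%C) A.

(* tau |-> A(xi + tau eta) *)
Definition line_poly (A : symbol R n) (xi eta : 'rV[R]_n) : {poly C} :=
  mmap (@polyC C) (fun i => ((xi 0 i)%:C%C)%:P + (eta 0 i)%:C%C *: 'X) A.

(* the roots with positive imaginary part, repeated according to multiplicity *)
Definition upper_roots (p : {poly C}) : seq C :=
  [seq z <- sval (closed_field_poly_normal p) | 0 < complex.Im z].

Definition properly_elliptic (m : nat) (A : symbol R n) : Prop :=
  [/\ homogeneous m.*2 A,
      forall xi, xi != 0 -> symb_eval A xi != 0 &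
      forall xi eta : 'rV[R]_n, row_free (col_mx xi eta) ->
        size (upper_roots (line_poly A xi eta)) = m].

(* Systems of boundary operators on a hyperplane with normal vector nu; in
   [ops], each operator is paired with its order. *)
Definition normal_system (nu : 'rV[R]_n) (ops : seq (nat * symbol R n)) : Prop :=
  uniq (map fst ops) /\
  forall p, p \in ops ->
    homogeneous p.1 p.2 /\
    forall t : R, t != 0 -> symb_eval p.2 (t *: nu) != 0.

Definition dirichlet_system (nu : 'rV[R]_n) (M : nat)
    (ops : seq (nat * symbol R n)) : Prop :=
  normal_system nu ops /\ perm_eq (map fst ops) (iota 0 M).

Definition covers (nu : 'rV[R]_n) (A : symbol R n) (ops : seq (symbol R n)) : Prop :=
  forall (xi : 'rV[R]_n) (t : R),
    xi != 0 -> xi *m nu^T = 0 -> t != 0 ->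
  forall c : nat -> C,
    \prod_(z <- upper_roots (line_poly A xi (t *: nu))) ('X - z%:P) %|
      \sum_(l < size ops) c l *: line_poly (nth 0 ops l) xi (t *: nu) ->
    forall l : 'I_(size ops), c l = 0.

End Operators.

(* Points of R^n, n = 2 + d, are the row vectors x = (y, z) with y = lsubmx x
   and z = rsubmx x. *)
Section DihedralAngles.
Variables (R : realType) (d : nat).
Local Notation C := R[i].
Local Notation pt := ('rV[R]_(2 + d)).

Definition cyl (r phi : R) (z : 'rV[R]_d) : pt :=
  row_mx (\row_(i < 2) [:: r * cos phi; r * sin phi]`_i) z.

Definition edge : set pt := [set x | lsubmx x = 0].

Definition wedge (a b : R) : set pt :=
  [set x | exists r phi z, [/\ 0 < r, a < phi < b & x = cyl r phi z]].

Definition closed_wedge (a b : R) : set pt := closure (wedge a b) `\` edge.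

(* unit normal to the half-hyperplane {phi = b} *)
Definition face_normal (b : R) : pt :=
  row_mx (\row_(i < 2) [:: - sin b; cos b]`_i) 0.

Definition integral_wedge (a b : R) (f : pt -> C) : C :=
  cintegral (@integral_rV R (2 + d)) (patch (fun=> 0) (wedge a b) f).

(* Integral over the half-hyperplane {phi = b}, parametrized isometrically by
   w = (r, z), r > 0. *)
Definition integral_face (b : R) (f : pt -> C) : C :=
  cintegral (@integral_rV R (1 + d))
    (patch (fun=> 0) [set w : 'rV[R]_(1 + d) | 0 < w 0 0]
       (fun w : 'rV[R]_(1 + d) => f (cyl (w 0 0) b (rsubmx w)))).

(* (y, z) |-> (chi * rotation of y by the angle omega, z) *)
Definition rotdil (omega chi : R) (x : pt) : pt :=
  let y1 := x 0 (lshift d 0) in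
  let y2 := x 0 (lshift d 1) in
  row_mx (\row_(i < 2) [:: chi * (cos omega * y1 - sin omega * y2);
                           chi * (sin omega * y1 + cos omega * y2)]`_i)
         (rsubmx x).

End DihedralAngles.

(* Polar form of an operator. For a function w of (r, phi),
     D_{y1} (r^-k w) = r^-(k+1) (cos phi (r D_r + i k) w - sin phi D_phi w),
     D_{y2} (r^-k w) = r^-(k+1) (sin phi (r D_r + i k) w + cos phi D_phi w),
   whence A(D_y, 0) = r^-kappa tilde A(phi, D_phi, r D_r) by recursion (lemma
   [polar_formE] below). The operators standing for r D_r and D_phi are
   parameters, so that r D_r can be replaced by a number. *)
Section PolarForm.
Variables (R : realType) (d : nat).
Local Notation C := R[i].
Variables (X : Type) (ang : X -> R) (rDr Dphi : (X -> C) -> X -> C).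

Definition polar1 (k : nat) (w : X -> C) : X -> C := fun p =>
  (cos (ang p))%:C%C * (rDr w p + 'i * k%:R * w p) - (sin (ang p))%:C%C * Dphi w p.

Definition polar2 (k : nat) (w : X -> C) : X -> C := fun p =>
  (sin (ang p))%:C%C * (rDr w p + 'i * k%:R * w p) + (cos (ang p))%:C%C * Dphi w p.

Fixpoint polar_mon2 (a2 : nat) (w : X -> C) : X -> C :=
  if a2 is k.+1 then polar2 k (polar_mon2 k w) else w.

(* D_{y1}^a1 D_{y2}^a2 in polar form, times r^(a1 + a2) *)
Fixpoint polar_mon (a1 a2 : nat) (w : X -> C) : X -> C :=
  if a1 is k.+1 then polar1 (k + a2) (polar_mon k a2 w) else polar_mon2 a2 w.

(* Setting D_z = 0 retains the monomials without z-variables. *)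
Definition polar_form (A : symbol R (2 + d)) (w : X -> C) : X -> C := fun p =>
  \sum_(a <- msupp A | [forall i : 'I_d, a (rshift 2 i) == 0%N])
    mcoeff a A * polar_mon (a (lshift d 0)) (a (lshift d 1)) w p.

End PolarForm.

Lemma cplx_id1 (R : realType) (x y A B A' B' : R) :
  - 'i * ((x * A + y * A') +i* (x * B + y * B'))%C =
  x%:C%C * (- 'i * (A +i* B)%C) + y%:C%C * (- 'i * (A' +i* B')%C).
Proof.
by rewrite -complexiE; simpc.
Qed.
Lemma cplx_id2 (R : realType) (h dh a b A B : R) :
  - 'i * ((h * A + a * dh) +i* (h * B + b * dh))%C =
  h%:C%C * (- 'i * (A +i* B)%C) - 'i * dh%:C%C * (a +i* b)%C.
Proof.
by rewrite -complexiE; simpc => /=; rewrite ![dh * _]mulrC.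
Qed.

Lemma polar_id1 (F : comPzRingType) (c s r rk rk' K i A B u : F) :
  c * c + s * s = 1 -> K * r * rk' = K * rk ->
  c * (r * (rk * (c * A + s * B) - i * (K * rk') * u) + i * K * (rk * u))
   - s * (rk * (- (r * s) * A + r * c * B)) = r * rk * A.
Proof.
move=> h1 h2.
transitivity (r * rk * A * (c * c + s * s) - c * i * u * (K * r * rk' - K * rk)); first by ring.
by rewrite h1 h2; ring.
Qed.

Lemma polar_id2 (F : comPzRingType) (c s r rk rk' K i A B u : F) :
  c * c + s * s = 1 -> K * r * rk' = K * rk ->
  s * (r * (rk * (c * A + s * B) - i * (K * rk') * u) + i * K * (rk * u))
   + c * (rk * (- (r * s) * A + r * c * B)) = r * rk * B.
Proof.
move=> h1 h2.
transitivity (r * rk * B * (c * c + s * s) - s * i * u * (K * r * rk' - K * rk)); first by ring.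
by rewrite h1 h2; ring.
Qed.

Section PolarFormE.
Variables (R : realType) (d : nat).
Local Notation C := R[i].
Local Notation pt := ('rV[R]_(2 + d)).
Variable z : 'rV[R]_d.

Let e0 : pt := delta_mx 0 (lshift d 0).
Let e1 : pt := delta_mx 0 (lshift d 1).
Let c (p : R * R) : pt := cyl p.1 p.2 z.

Let cE : c = (fun p => (p.1 * cos p.2) *: e0 + (p.1 * sin p.2) *: e1
           + row_mx 0 z).
Proof.
apply/funext => -[r phi]; apply/rowP => i; rewrite /c /cyl /= !mxE.
case: splitP => j ij. 
  have -> : i = lshift d j by apply/val_inj.
  rewrite !mxE !eq_lshift !eqxx !addr0 /=.
  case: j ij => -[|[|//]] ? _ /=; by rewrite ?mulr1 ?mulr0 ?addr0 ?add0r.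
have -> : i = rshift 2 j by apply/val_inj.
by rewrite !eq_rlshift !mulr0 !add0r.
Qed.

Let diff1 (f : R -> R) (df x : R) : is_derive x 1 f df -> is_diff x f ( *%R^~ df).
Proof.
move=> H; have D : differentiable f x by apply/derivable1_diffP; exact: ex_derive.
by apply: DiffDef => //; rewrite diff1E // derive1E derive_val.
Qed.

Let difffst (p : R * R) : is_diff p (fst : R * R -> R) fst.
Proof.
have cf : continuous (@fst R R : {linear (R * R)%type -> R^o}) by move=> x; exact: cvg_fst.
by apply: DiffDef; [exact: (linear_differentiable _ cf) | exact: (diff_lin _ cf)].
Qed.
Let diffsnd (p : R * R) : is_diff p (snd : R * R -> R) snd.
Proof.
have cf : continuous (@snd R R : {linear (R * R)%type -> R^o}) by move=> x; exact: cvg_snd.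
by apply: DiffDef; [exact: (linear_differentiable _ cf) | exact: (diff_lin _ cf)].
Qed.

Let diffcos (p : R * R) : is_diff p (fun p : R * R => p.1 * cos p.2)
  (fun v => v.1 * cos p.2 - p.1 * sin p.2 * v.2).
Proof.
have H := diff1 (is_derive_cos p.2).
have H2 := is_diffM (difffst p) (is_diff_comp (diffsnd p) H).
apply: is_diff_eq H2 _; apply/funext => v; rewrite !fctE /=.
rewrite ?fctE /= /GRing.scale /=. by rewrite !mulrN [v.2 * _]mulrC mulrA [cos _ * _]mulrC addrC.
Qed.
Let diffsin (p : R * R) : is_diff p (fun p : R * R => p.1 * sin p.2)
  (fun v => v.1 * sin p.2 + p.1 * cos p.2 * v.2).
Proof.
have H := diff1 (is_derive_sin p.2).
have H2 := is_diffM (difffst p) (is_diff_comp (diffsnd p) H).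
apply: is_diff_eq H2 _; apply/funext => v; rewrite !fctE /=.
rewrite ?fctE /= /GRing.scale /=. by rewrite [v.2 * _]mulrC mulrA [sin _ * _]mulrC addrC.
Qed.

Let diffc p : is_diff p c (fun v =>
  (v.1 * cos p.2 - p.1 * sin p.2 * v.2) *: e0 + (v.1 * sin p.2 + p.1 * cos p.2 * v.2) *: e1).
Proof.
rewrite cE.
have Z (f df : R * R -> R) (e : pt) : is_diff p f df -> is_diff p (fun q : R * R => f q *: e) (fun v => df v *: e).
  move=> [D E]; apply: DiffDef; first exact: differentiableZl.
  by rewrite diffZl // E.
have H := is_diffD (is_diffD (Z _ _ e0 (diffcos p)) (Z _ _ e1 (diffsin p)))
   (is_diff_cst (row_mx 0 z : pt) p).
apply: is_diff_eq H _; apply/funext => v; exact: addr0.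
Qed.

Let real_chain (f : pt -> R) p v : differentiable f (c p) ->
  derivable (f \o c) p v /\
  'D_v (f \o c) p = (v.1 * cos p.2 - p.1 * sin p.2 * v.2) * 'D_e0 f (c p)
     + (v.1 * sin p.2 + p.1 * cos p.2 * v.2) * 'D_e1 f (c p).
Proof.
move=> df; have [dc Ec] := diffc p.
have dfc := differentiable_comp dc df.
split; first exact: diff_derivable.
rewrite deriveE // diff_comp //= Ec /=.
by rewrite linearD !linearZ /= -!deriveE.
Qed.


Let cchain (u : pt -> C) (p v : R * R) : cdifferentiable u (c p) ->
  cdifferentiable (u \o c) p /\
  Dop v (u \o c) p =
    (v.1 * cos p.2 - p.1 * sin p.2 * v.2)%:C%C * Dop e0 u (c p)
  + (v.1 * sin p.2 + p.1 * cos p.2 * v.2)%:C%C * Dop e1 u (c p).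
Proof.
move=> [dr di]; have [dc _] := diffc p; split.
  by split; [exact: (differentiable_comp dc dr) | exact: (differentiable_comp dc di)].
have [_ Er] := real_chain v dr; have [_ Ei] := real_chain v di.
have -> : Dop v (u \o c) p = - 'i *
  ('D_v ((fun y => complex.Re (u y)) \o c) p +i*
   'D_v ((fun y => complex.Im (u y)) \o c) p)%C by [].
by rewrite Er Ei; exact: cplx_id1.
Qed.

Let DopM (h : R * R -> R) (g : R * R -> C) (p v : R * R) :
  derivable h p v -> cdifferentiable g p ->
  Dop v (fun q => (h q)%:C%C * g q) p =
    (h p)%:C%C * Dop v g p - 'i * ('D_v h p)%:C%C * g p.
Proof.
move=> dh [dr di]; rewrite /Dop /cderive.
have -> : (fun y => complex.Re ((h y)%:C%C * g y)) = h * (fun y => complex.Re (g y)).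
  by apply/funext => q; rewrite fctE; case: (g q) => a b; simpc.
have -> : (fun y => complex.Im ((h y)%:C%C * g y)) = h * (fun y => complex.Im (g y)).
  by apply/funext => q; rewrite fctE; case: (g q) => a b; simpc.
rewrite !deriveM //; [|exact: diff_derivable..].
rewrite [X in _ = _ - _ * X](_ : _ = (complex.Re (g p) +i* complex.Im (g p))%C); last by case: (g p).
exact: cplx_id2.
Qed.

Let D_near (u w : R * R -> C) p v : (\forall q \near p, u q = w q) -> Dop v u p = Dop v w p.
Proof.
move=> H; rewrite /Dop /cderive; congr (- 'i * (_ +i* _)%C);
  by apply: near_eq_derive; near=> q; rewrite (near H q).
Unshelve. all: by end_near. Qed.

Let Dpow k (p v : R * R) : derivable (fun q : R * R => q.1 ^+ k) p v /\
  'D_v (fun q : R * R => q.1 ^+ k) p = k%:R * p.1 ^+ k.-1 * v.1.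
Proof.
have [df Ef] := difffst p.
have d1 : derivable (fst : R * R -> R) p v by exact: diff_derivable.
case: k => [|k].
  by split; [exact: derivable_cst | rewrite derive_cst !mul0r].
have -> : (fun q : R * R => q.1 ^+ k.+1) = (fst : R * R -> R) ^+ k.+1.
  by apply/funext => q; rewrite exprfctE.
by split; [exact: derivableX | rewrite deriveX // deriveE // Ef].
Qed.

Let pstep (u : pt -> C) (w : R * R -> C) k :
  (forall p, 0 < p.1 -> cdifferentiable u (c p)) ->
  (forall p, 0 < p.1 -> w p = (p.1 ^+ k)%:C%C * u (c p)) ->
  forall p, 0 < p.1 ->
  polar1 snd (fun w p => p.1%:C%C * Dop ((1, 0) : R * R) w p) (Dop ((0, 1) : R * R)) k w p = (p.1 ^+ k.+1)%:C%C * Dop e0 u (c p) /\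
  polar2 snd (fun w p => p.1%:C%C * Dop ((1, 0) : R * R) w p) (Dop ((0, 1) : R * R)) k w p = (p.1 ^+ k.+1)%:C%C * Dop e1 u (c p).
Proof.
move=> du hw p p0.
have nw : \forall q \near p, w q = (q.1 ^+ k)%:C%C * (u \o c) q.
  have gt : \forall q \near p, 0 < q.1.
    have [df _] := difffst p.
    exact: (cvgr_gt _ (differentiable_continuous df) _ p0).
  apply: filterS gt => q q0; by rewrite hw.
have E v : Dop v w p = (p.1 ^+ k)%:C%C * Dop v (u \o c) p
   - 'i * (k%:R * p.1 ^+ k.-1 * v.1)%:C%C * (u \o c) p.
  rewrite (D_near _ nw) DopM; first by rewrite (Dpow k p v).2.
    exact: (Dpow k p v).1.
  exact: (cchain 0 (du _ p0)).1.
rewrite /polar1 /polar2 !E !(cchain _ (du _ p0)).2 hw //=.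
rewrite !(mul1r, mul0r, mulr0, mulr1, subr0, addr0, sub0r, add0r, rmorph0, oppr0).
rewrite !exprS !rmorphN !rmorphM /= !rmorph_nat.
have h1 : (cos p.2)%:C%C * (cos p.2)%:C%C + (sin p.2)%:C%C * (sin p.2)%:C%C = 1 :> C.
  by rewrite -!rmorphM -rmorphD /= -!expr2 cos2Dsin2.
have h2 : k%:R * p.1%:C%C * (p.1 ^+ k.-1)%:C%C = k%:R * (p.1 ^+ k)%:C%C :> C.
  by case: k {nw E hw} => [|k]; rewrite ?mul0r // exprS rmorphM /= mulrA.
by split; [exact: polar_id1 | exact: polar_id2].
Qed.

Let csmooth_Dop (O : set pt) (u : pt -> C) v k : csmooth O u -> csmooth O (iter k (@Dop R pt v) u).
Proof.
move=> su; elim: k => //= k IH s x Ox.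
by have := IH (rcons s v) x Ox; rewrite foldr_rcons.
Qed.

Let zfree_Dmon (a : multinom (2 + d)) (u : pt -> C) :
  [forall i : 'I_d, a (rshift 2 i) == 0%N] ->
  Dmon a u = iter (a (lshift d 0)) (@Dop R pt e0) (iter (a (lshift d 1)) (@Dop R pt e1) u).
Proof.
move=> /forallP a0; rewrite /Dmon (@enum_ordSl (1 + d)) /= (@enum_ordSl d) /=.
have -> : ord0 = lshift d 0 :> 'I_(2 + d) by exact/val_inj.
have -> : lift (lshift d 0 : 'I_(2 + d)) (ord0 : 'I_(1 + d)) = lshift d 1 :> 'I_(2 + d) by exact/val_inj.
congr (iter _ _ (iter _ _ _)).
rewrite -map_comp foldr_map; elim: (enum _) => //= i s ->.
have -> : lift (lshift d 0 : 'I_(2 + d)) (lift (ord0 : 'I_(1 + d)) i) = rshift 2 i by exact/val_inj.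
by rewrite (eqP (a0 i)).
Qed.

Let cedge p : 0 < p.1 -> (~` @edge R d) (c p).
Proof.
move=> p0; rewrite /edge /c /cyl /= row_mxKl => /rowP E.
have := E 0; have := E 1; rewrite !mxE /= => /eqP; rewrite mulf_eq0 (gt_eqF p0) /= => /eqP s0.
move=> /eqP; rewrite mulf_eq0 (gt_eqF p0) /= => /eqP c0.
by have := cos2Dsin2 p.2; rewrite s0 c0 !expr0n /= addr0 => /eqP; rewrite eq_sym oner_eq0.
Qed.

Let rD := fun (w : R * R -> C) (p : R * R) => p.1%:C%C * Dop ((1, 0) : R * R) w p.

Let polar_monE a1 a2 (u : pt -> C) (p : R * R) : csmooth (~` @edge R d) u -> 0 < p.1 ->
  polar_mon snd rD (Dop ((0, 1) : R * R)) a1 a2 (u \o c) p =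
  (p.1 ^+ (a1 + a2))%:C%C * iter a1 (@Dop R pt e0) (iter a2 (@Dop R pt e1) u) (c p).
Proof.
move=> su; have E2 k : forall p : R * R, 0 < p.1 -> polar_mon2 snd rD (Dop ((0, 1) : R * R)) k (u \o c) p =
    (p.1 ^+ k)%:C%C * iter k (@Dop R pt e1) u (c p).
  elim: k => [|k IH] q q0 /=; first by rewrite expr0 mul1r.
  apply: (pstep _ IH q0).2 => q' q'0.
  exact: (csmooth_Dop e1 k su  [::] (cedge q'0)).
elim: a1 p => [|k IH] p p0 /=; first exact: E2.
apply: (pstep _ IH p0).1 => q' q'0.
exact: (csmooth_Dop e0 k (csmooth_Dop e1 a2 su)  [::] (cedge q'0)).
Qed.

(* The left-hand side is A(D_y, 0) u at the point with cylindrical coordinates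
   (r, phi, z). *)
Lemma polar_formE (kappa : nat) (A : symbol R (2 + d)) (u : pt -> C) (r phi : R) :
  homogeneous kappa A -> csmooth (~` @edge R d) u -> 0 < r ->
  \sum_(a <- msupp A | [forall i : 'I_d, a (rshift 2 i) == 0%N])
    mcoeff a A * Dmon a u (cyl r phi z) =
  (r ^- kappa)%:C%C *
  polar_form snd
    (fun w (p : R * R) => p.1%:C%C * Dop ((1, 0) : R * R) w p)
    (Dop ((0, 1) : R * R)) A (fun p => u (cyl p.1 p.2 z)) (r, phi).
Proof.
move=> /dhomogP hA su r0; rewrite /polar_form big_distrr /= big_seq_cond [RHS]big_seq_cond.
apply: eq_bigr => a /andP[aA az].
rewrite -/rD (@polar_monE _ _ u (r, phi)) //= zfree_Dmon //.
have -> : (a (lshift d 0%R) + a (lshift d 1%R))%N = kappa.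
  have /= <- := hA _ aA; rewrite mdegE big_split_ord /=.
  rewrite (big1 _ (fun i : 'I_d => true)) ?addn0.
    by rewrite big_ord_recl big_ord1; congr (_ + a _)%N; exact/val_inj.
  by move=> i _; apply/eqP/(forallP az).
rewrite mulrCA; congr (_ * _); rewrite mulrA -rmorphM /= mulVf ?rmorph1 ?mul1r //.
by rewrite expf_neq0 // gt_eqF.
Qed.

End PolarFormE.

Section Tilde.
Variables (R : realType) (d : nat).
Local Notation C := R[i].

(* tilde A(phi, D_phi, lambda): the number lambda in place of r D_r *)
Definition tilde (A : symbol R (2 + d)) (lambda : C) (u : R -> C) : R -> C :=
  polar_form id (fun w p => lambda * w p) (Dop (1 : R)) A u.

End Tilde.

Section Setting.
Variable R : realType.
Local Notation C := R[i].

(* Families indexed by t, q, mu, nu, s are indexed by nat, from 1 on; only the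
   values in the stated ranges matter. *)
Record geometry (N : nat) := Geometry {
  nR : 'I_N -> nat;
  ang : 'I_N -> nat -> R;
  nR_gt0 : forall j, (0 < nR j)%N;
  ang_gt0 : forall j, 0 < ang j 1%N;
  ang_lt : forall j t, (1 <= t <= nR j)%N -> ang j t < ang j t.+1;
  ang_lt2pi : forall j, ang j (nR j).+1 < 2 * pi }.

Section Geometry.
Variables (N : nat) (g : geometry N).

(* sigma ranges over {1, R_j + 1}: false stands for 1, true for R_j + 1. *)
Definition side (j : 'I_N) (sigma : bool) : nat :=
  if sigma then (nR g j).+1 else 1%N.

(* index t of the sector Omega_{jt} adjacent to Gamma_{j sigma} *)
Definition side_sector (j : 'I_N) (sigma : bool) : nat :=
  if sigma then nR g j else 1%N.

Definition ang_side (j : 'I_N) (sigma : bool) : R := ang g j (side j sigma).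

(* phi_{j sigma k q} and phi'_{j q k sigma} *)
Definition rot (j : 'I_N) (sigma : bool) (k : 'I_N) (q : nat) : R :=
  ang g k q - ang_side j sigma.
Definition rot' (j : 'I_N) (q : nat) (k : 'I_N) (sigma : bool) : R :=
  - rot k sigma j q.

End Geometry.

Record nonlocal_problem (N : nat) (g : geometry N) (d m : nat) := NonlocalProblem {
  opP : 'I_N -> symbol R (2 + d);
  ordB : 'I_N -> bool -> nat -> nat;
  opB : 'I_N -> bool -> nat -> symbol R (2 + d);
  nS : 'I_N -> bool -> 'I_N -> nat -> nat;
  opBnl : 'I_N -> bool -> nat -> 'I_N -> nat -> nat -> symbol R (2 + d);
  chi : 'I_N -> bool -> 'I_N -> nat -> nat -> R;

  opP_elliptic : forall j, properly_elliptic m (opP j);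
  ordB_le : forall j sigma mu, (1 <= mu <= m)%N ->
    (ordB j sigma mu <= m.*2.-1)%N;
  opB_normal : forall j sigma,
    normal_system (face_normal d (ang_side g j sigma))
      [seq (ordB j sigma mu, opB j sigma mu) | mu <- iota 1 m];
  opB_covers : forall j sigma,
    covers (face_normal d (ang_side g j sigma)) (opP j)
      [seq opB j sigma mu | mu <- iota 1 m];
  opBnl_homog : forall j sigma mu k q s, (1 <= mu <= m)%N ->
    (2 <= q <= nR g k)%N -> (1 <= s <= nS j sigma k q)%N ->
    homogeneous (ordB j sigma mu) (opBnl j sigma mu k q s);
  chi_gt0 : forall j sigma k q s,
    (2 <= q <= nR g k)%N -> (1 <= s <= nS j sigma k q)%N ->
    0 < chi j sigma k q s }.

Section Problem.
Variables (N : nat) (g : geometry N) (d m : nat) (pb : nonlocal_problem g d m).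
Local Notation pt := ('rV[R]_(2 + d)).

(* chi'_{j q k sigma s} *)
Definition chi' (j : 'I_N) (q : nat) (k : 'I_N) (sigma : bool) (s : nat) : R :=
  (chi pb k sigma j q s)^-1.

Definition opQ (j : 'I_N) : symbol R (2 + d) := formal_adjoint (opP pb j).

Definition calB (j : 'I_N) (sigma : bool) (mu : nat) (U : 'I_N -> pt -> C) : pt -> C :=
  fun x =>
  opD (opB pb j sigma mu) (U j) x +
  \sum_(k < N) \sum_(2 <= q < (nR g k).+1) \sum_(1 <= s < (nS pb j sigma k q).+1)
    opD (opBnl pb j sigma mu k q s) (U k)
        (rotdil (rot g j sigma k q) (chi pb j sigma k q s) x).

Definition calT (T : 'I_N -> nat -> nat -> symbol R (2 + d))
    (Tnl : 'I_N -> nat -> nat -> 'I_N -> bool -> nat -> symbol R (2 + d))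
    (j : 'I_N) (q nu : nat) (V : 'I_N -> nat -> pt -> C) : pt -> C :=
  fun x =>
  opD (T j q nu) (V j q.-1) x - opD (T j q nu) (V j q) x +
  \sum_(k < N) \sum_(sigma : bool) \sum_(1 <= s < (nS pb k sigma j q).+1)
    opD (Tnl j q nu k sigma s) (V k (side_sector g k sigma))
        (rotdil (rot' g j q k sigma) (chi' j q k sigma s) x).

(* The primes of the mathematical notation are kept: opB' is B'_{j sigma mu},
   opBi and opBi' are B_{jq mu} and B'_{jq mu} for 2 <= q <= R_j. *)
Record green_operators := GreenOperators {
  ordC : 'I_N -> bool -> nat -> nat;
  opB' : 'I_N -> bool -> nat -> symbol R (2 + d);
  opC : 'I_N -> bool -> nat -> symbol R (2 + d);
  opF : 'I_N -> bool -> nat -> symbol R (2 + d);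
  opBi : 'I_N -> nat -> nat -> symbol R (2 + d);
  opBi' : 'I_N -> nat -> nat -> symbol R (2 + d);
  opT : 'I_N -> nat -> nat -> symbol R (2 + d);
  opTnl : 'I_N -> nat -> nat -> 'I_N -> bool -> nat -> symbol R (2 + d);

  ordC_le : forall j sigma mu, (1 <= mu <= m)%N ->
    (ordC j sigma mu <= m.*2.-1)%N;
  BB'_dirichlet : forall j sigma,
    dirichlet_system (face_normal d (ang_side g j sigma)) m.*2
      ([seq (ordB pb j sigma mu, opB pb j sigma mu) | mu <- iota 1 m] ++
       [seq (m.*2.-1 - ordC j sigma mu, opB' j sigma mu)%N | mu <- iota 1 m]);
  CF_dirichlet : forall j sigma,
    dirichlet_system (face_normal d (ang_side g j sigma)) m.*2
      ([seq (ordC j sigma mu, opC j sigma mu) | mu <- iota 1 m] ++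
       [seq (m.*2.-1 - ordB pb j sigma mu, opF j sigma mu)%N | mu <- iota 1 m]);
  opC_covers : forall j sigma,
    covers (face_normal d (ang_side g j sigma)) (opQ j)
      [seq opC j sigma mu | mu <- iota 1 m];
  Bi_dirichlet : forall j q, (2 <= q <= nR g j)%N ->
    dirichlet_system (face_normal d (ang g j q)) m.*2
      ([seq (m.*2 - mu, opBi j q mu)%N | mu <- iota 1 m] ++
       [seq (m - mu, opBi' j q mu)%N | mu <- iota 1 m]);
  T_dirichlet : forall j q, (2 <= q <= nR g j)%N ->
    dirichlet_system (face_normal d (ang g j q)) m.*2
      [seq (nu.-1, opT j q nu) | nu <- iota 1 m.*2];
  opTnl_homog : forall j q nu k sigma s, (2 <= q <= nR g j)%N ->
    (1 <= nu <= m.*2)%N -> (1 <= s <= nS pb k sigma j q)%N ->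
    homogeneous nu.-1 (opTnl j q nu k sigma s);

  green : forall (U : 'I_N -> pt -> C) (V : 'I_N -> nat -> pt -> C),
    let KU (j : 'I_N) : set pt := closed_wedge (ang g j 1) (ang g j (nR g j).+1) in
    let KV (j : 'I_N) (t : nat) : set pt := closed_wedge (ang g j t) (ang g j t.+1) in
    (forall j, csmooth_upto (KU j) (U j)) ->
    (forall j t, (1 <= t <= nR g j)%N -> csmooth_upto (KV j t) (V j t)) ->
    (forall j, csupport_in (KU j) (U j)) \/
    (forall j t, (1 <= t <= nR g j)%N -> csupport_in (KV j t) (V j t)) ->
    \sum_(j < N) (
      \sum_(1 <= t < (nR g j).+1)
        integral_wedge (ang g j t) (ang g j t.+1)
          (fun x => opD (opP pb j) (U j) x * (V j t x)^*) +
      \sum_(sigma : bool) \sum_(1 <= mu < m.+1)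
        integral_face (ang_side g j sigma)
          (fun x => calB j sigma mu U x *
            (opD (opF j sigma mu) (V j (side_sector g j sigma)) x)^*) +
      \sum_(2 <= q < (nR g j).+1) \sum_(1 <= mu < m.+1)
        integral_face (ang g j q)
          (fun x => opD (opBi j q mu) (U j) x *
            (calT opT opTnl j q mu V x)^*))
    = \sum_(j < N) (
      \sum_(1 <= t < (nR g j).+1)
        integral_wedge (ang g j t) (ang g j t.+1)
          (fun x => U j x * (opD (opQ j) (V j t) x)^*) +
      \sum_(sigma : bool) \sum_(1 <= mu < m.+1)
        integral_face (ang_side g j sigma)
          (fun x => opD (opB' j sigma mu) (U j) x *
            (opD (opC j sigma mu) (V j (side_sector g j sigma)) x)^*) +
      \sum_(2 <= q < (nR g j).+1) \sum_(1 <= mu < m.+1)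
        integral_face (ang g j q)
          (fun x => opD (opBi' j q mu) (U j) x *
            (calT opT opTnl j q (m + mu) V x)^*)) }.

Variable G : green_operators.

(* The shift phi + phi_{j sigma k q} acts on the function tilde B tilde U_k:
   that function is evaluated at b_{j sigma} + phi_{j sigma k q}. *)
Definition tilde_calB (j : 'I_N) (sigma : bool) (mu : nat) (lambda : C)
    (U : 'I_N -> R -> C) : C :=
  tilde (opB pb j sigma mu) lambda (U j) (ang_side g j sigma) +
  \sum_(k < N) \sum_(2 <= q < (nR g k).+1) \sum_(1 <= s < (nS pb j sigma k q).+1)
    cexp (('i * lambda - (ordB pb j sigma mu)%:R) * (ln (chi pb j sigma k q s))%:C%C) *
    tilde (opBnl pb j sigma mu k q s) lambda (U k)
          (ang_side g j sigma + rot g j sigma k q).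

Definition tilde_calT (j : 'I_N) (q nu : nat) (lambda : C)
    (V : 'I_N -> nat -> R -> C) : C :=
  tilde (opT G j q nu) lambda (V j q.-1) (ang g j q) -
  tilde (opT G j q nu) lambda (V j q) (ang g j q) +
  \sum_(k < N) \sum_(sigma : bool) \sum_(1 <= s < (nS pb k sigma j q).+1)
    cexp (('i * lambda - (nu.-1)%:R) * (ln (chi' j q k sigma s))%:C%C) *
    tilde (opTnl G j q nu k sigma s) lambda (V k (side_sector g k sigma))
          (ang g j q + rot' g j q k sigma).

End Problem.
End Setting.

(* Main.v *)
Require Import Defs.
From HB Require Import structures.
From mathcomp Require Import all_boot all_order all_algebra complex.
From mathcomp Require Import all_classical all_reals all_analysis.
From mathcomp Require Import measurable_realfun ring lra.
From mathcomp.multinomials Require mpoly.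
Import -(notations) mpoly.
Import Order.TTheory GRing.Theory Num.Theory.
Import numFieldNormedType.Exports.
Local Open Scope classical_set_scope.
Local Open Scope ring_scope.
Set Implicit Arguments.
Unset Strict Implicit.
Unset Printing Implicit Defensive.

(** A homogeneous operator of order kappa maps r^(i lambda) U(phi) to
    r^(i lambda - kappa) times [tilde A lambda U] (phi), plus terms which contain
    derivatives of the cut-offs once the function is multiplied by cut-offs in
    ln r and in the components of z. Insert r^(i lambda) U_j times such cut-offs,
    of integral 1, and r^(i lambda') V_jt(phi) into the Green formula of the
    dihedral angles. In every integral over a wedge or a face the total power of r
    is r^-2, resp. r^-1, because lambda' = lambda^* - 2i(m - 1) and the orders of
    the two factors add up to 2m, resp. 2m - 1; this is the weight which turns
    r dr, resp. dr, into d(ln r). Hence each integral factorizes, the derivatives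
    of the cut-offs integrate to 0, and the formula on (b_j1, b_j,R+1) remains. *)

(** * Polar coordinates in the plane *)

(** The integrals over the wedges are iterated integrals in Cartesian variables, so polar
    coordinates have to be introduced one variable at a time: y2 = y1 tan phi for fixed y1, an
    exchange of the two integrals, then y1 = e^rho cos phi for fixed phi. This needs cos phi bounded
    away from 0; other directions are reached by quarter turns, under which an iterated integral is
    invariant by Fubini and a reflection.

    No limit is taken anywhere. The cut-offs have integral exactly 1, and since the powers of r
    cancel exactly, the terms with a differentiated cut-off integrate to exactly 0. Only U carries
    cut-offs, because compact support of one of the two families is enough; V stays homogeneous, so
    no products of two remainders appear.

    The exponential factors of the nonlocal terms come from dilations: r -> chi r translates ln r by
    ln chi, the integral of the cut-off does not see the translation, and the power of r leaves
    chi^(i lambda - kappa).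

    All angles lie strictly between 0 and 2 pi, so the half-plane phi = 0, where the argument jumps,
    never meets a closed wedge off the edge. *)

Section PlaneIntegral.
Variable R : realType.
Local Notation mu := (@lebesgue_measure R).
Implicit Types (f g : R -> R) (F : R * R -> R).

(** A single [M] bounds both the values and the support. Functions of this kind are integrable, and
    so are all their sections, which makes Fubini applicable without side conditions. *)
Definition bddsupp1 f := measurable_fun setT f /\
  exists M, forall t, `|f t| <= M /\ (M < `|t| -> f t = 0).

Definition bddsupp2 F := measurable_fun setT F /\
  exists M, forall p, `|F p| <= M /\ (M < `|p.1| \/ M < `|p.2| -> F p = 0).

Lemma bddsupp1_integrable f : bddsupp1 f -> mu.-integrable setT (EFin \o f).
Proof.
move=> [mf [M hM]].
have -> : EFin \o f = (EFin \o f) \_ `[-M, M].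
  apply/funext => t; rewrite patchE; case: ifPn => //=.
  rewrite notin_setE /= in_itv /= -ler_norml => /negP; rewrite -ltNge => h.
  by rewrite (hM t).2.
have mI : measurable (`[- M, M] : set R) by exact: measurable_itv.
apply/(integrable_mkcond (mu := mu) _ mI); apply: (measurable_bounded_integrable (mu := mu)) => //.
- rewrite /= lebesgue_measure_itv; by case: ifP => _; rewrite /= ?ltry // -EFinB ltry.
- exact: measurable_funTS.
- by exists M; split; [exact: num_real | move=> x Mx t _; exact: le_trans (hM t).1 (ltW Mx)].
Qed.

Lemma bddsupp2_integrable F : bddsupp2 F -> (mu \x mu)%E.-integrable setT (EFin \o F).
Proof.
move=> [mF [M hM]].
pose I : set R := `[-M, M]%classic.
have mI : measurable I by exact: measurable_itv.
have -> : EFin \o F = (EFin \o F) \_ (I `*` I).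
  apply/funext => p; rewrite patchE; case: ifPn => //=.
  rewrite notin_setE /= /I /= !in_itv /= -!ler_norml => /not_andP h.
  by rewrite (hM p).2 //; case: h => /negP; rewrite -ltNge; [left|right].
have mII := measurableX mI mI.
apply/(integrable_mkcond (mu := (mu \x mu)%E) _ mII).
apply: (measurable_bounded_integrable (mu := (mu \x mu)%E)) => //.
- rewrite /= product_measure1E //= /I lebesgue_measure_itv.
  by case: ifP => _; rewrite ?mule0 ?ltry // -EFinB -EFinM ltry.
- exact: measurable_funTS.
- by exists M; split; [exact: num_real | move=> x Mx t _; exact: le_trans (hM t).1 (ltW Mx)].
Qed.

Lemma bddsupp2_swap F : bddsupp2 F -> bddsupp2 (fun p => F (p.2, p.1)).
Proof.
move=> [mF [M hM]]; split.
  exact: (measurableT_comp mF (measurable_fun_pair measurable_snd measurable_fst)).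
by exists M => -[a b]; split; [exact: (hM (b, a)).1 | move=> h; apply: (hM (b, a)).2 => /=; case: h; [right|left]].
Qed.

Lemma bddsupp2_section F x : bddsupp2 F -> bddsupp1 (fun y => F (x, y)).
Proof.
move=> [mF [M hM]]; split; first exact: (measurableT_comp mF (pair1_measurable x)).
by exists M => y; split; [exact: (hM (x, y)).1 | move=> h; apply: (hM (x, y)).2; right].
Qed.

(** Every section, and not just almost every one, is integrable, so nothing is lost in taking the
    finite part of the inner integral. This links the iterated real integral to the product
    measure. *)
Lemma bddsupp2_integral_fst F : bddsupp2 F -> 
  mu.-integrable setT (EFin \o (fun x => Rintegral mu setT (fun y => F (x, y)))) /\
  (\int[mu \x mu]_p (F p)%:E)%E =
  (Rintegral mu setT (fun x => Rintegral mu setT (fun y => F (x, y))))%:E.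
Proof.
move=> bF; have iF := bddsupp2_integrable bF.
have E : EFin \o (fun x => Rintegral mu setT (fun y => F (x, y))) = fubini_F mu (EFin \o F).
  apply/funext => x; rewrite /= /fubini_F /Rintegral fineK //.
  exact: (integrable_fin_num _ (bddsupp1_integrable (bddsupp2_section x bF))).
have i1 : mu.-integrable setT (EFin \o (fun x => Rintegral mu setT (fun y => F (x, y)))).
  by rewrite E; exact: integrable_fubini_F.
split => //.
transitivity (\int[mu]_x (EFin \o (fun x => Rintegral mu setT (fun y => F (x, y)))) x)%E.
  by rewrite E; exact: esym (integral12_prod_meas1 iF).
rewrite [RHS]fineK //; exact: (integrable_fin_num _ i1).
Qed.

Lemma bddsupp2_fubini F : bddsupp2 F ->
  Rintegral mu setT (fun x => Rintegral mu setT (fun y => F (x, y))) =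
  Rintegral mu setT (fun y => Rintegral mu setT (fun x => F (x, y))).
Proof.
move=> bF; have iF := bddsupp2_integrable bF.
have i1 := (bddsupp2_integral_fst bF).2.
have bS := bddsupp2_swap bF.
have E : EFin \o (fun y => Rintegral mu setT (fun x => F (x, y))) = fubini_G mu (EFin \o F).
  apply/funext => x; rewrite /= /fubini_G /Rintegral fineK //.
  exact: (integrable_fin_num _ (bddsupp1_integrable (bddsupp2_section x bS))).
apply/EFin_inj; rewrite -i1.
transitivity (\int[mu]_y (EFin \o (fun y => Rintegral mu setT (fun x => F (x, y)))) y)%E.
  by rewrite E; exact: esym (integral21_prod_meas1 iF).
rewrite [RHS]fineK //; exact: (integrable_fin_num _ (bddsupp2_integral_fst bS).1).
Qed.

Definition plane_integral F := Rintegral mu setT (fun x => Rintegral mu setT (fun y => F (x, y))).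

Lemma bddsupp2D F G : bddsupp2 F -> bddsupp2 G -> bddsupp2 (F \+ G) /\ plane_integral (F \+ G) = plane_integral F + plane_integral G.
Proof.
move=> bF bG; have bFG : bddsupp2 (F \+ G).
  case: bF bG => mF [M hM] [mG [L hL]]; split; first exact: measurable_funD.
  (* With nonnegative summands the sum dominates each of the two radii. *)
  exists (Num.max 0 M + Num.max 0 L) => p; split.
    rewrite (le_trans (ler_normD _ _)) // lerD // le_max; apply/orP; right;
    [exact: (hM p).1|exact: (hL p).1].
  have M0 : 0 <= Num.max 0 M by rewrite le_max lexx.
  have L0 : 0 <= Num.max 0 L by rewrite le_max lexx.
  have MM : M <= Num.max 0 M by rewrite le_max lexx orbT.
  have LL : L <= Num.max 0 L by rewrite le_max lexx orbT.
  move=> h /=; rewrite (hM p).2 ?(hL p).2 ?addr0 //.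
    by case: h => h; [left|right]; apply: le_lt_trans h; lra.
  by case: h => h; [left|right]; apply: le_lt_trans h; lra.
split => //; have i1 := bddsupp2_integrable bF; have i2 := bddsupp2_integrable bG.
apply/EFin_inj; rewrite /plane_integral EFinD -!(bddsupp2_integral_fst _).2 //.
by rewrite -integralD_EFin.
Qed.

Lemma Rintegral_oppr f : bddsupp1 f ->
  Rintegral mu setT (fun x => f (- x)) = Rintegral mu setT f.
Proof.
move=> bf; congr fine; have [mf _] := bf.
pose N : measurableTypeR R -> measurableTypeR R := -%R.
have mN : measurable_fun setT N by exact: oppr_measurable.
have bf' : bddsupp1 (f \o N).
  case: bf => _ [M hM]; split; first exact: measurableT_comp.
  by exists M => t; split; [exact: (hM _).1 | move=> h; apply: (hM _).2; rewrite normrN].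
rewrite -(integral_pushforward mN (mu := mu) (D := setT) (f := EFin \o f)) //.
- by apply: eq_measure_integral => A mA _; exact: lebesgue_measureN.
- exact/measurable_EFinP.
- by rewrite preimage_setT; exact: (bddsupp1_integrable bf').
Qed.

(** A quarter turn is an exchange of the axes followed by a reflection of one of them: Fubini
    handles the first, the symmetry of Lebesgue measure the second. *)
Lemma bddsupp2_rot90 F : bddsupp2 F ->
  bddsupp2 (fun p => F (- p.2, p.1)) /\ plane_integral (fun p => F (- p.2, p.1)) = plane_integral F.
Proof.
move=> bF; split.
  case: bF => mF [M hM]; split.
    apply: (measurableT_comp mF); apply: measurable_fun_pair => //=.
    exact: measurableT_comp.
  exists M => -[a b]; split; first exact: (hM (_, _)).1.
  move=> h; apply: (hM (_, _)).2 => /=; rewrite normrN; case: h; [right|left] => //.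
have bS := bddsupp2_swap bF; rewrite [RHS](bddsupp2_fubini bF).
congr Rintegral; apply/funext => x /=; exact: (@Rintegral_oppr (fun y => F (y, x)) (bddsupp2_section x bS)).
Qed.

End PlaneIntegral.

(** * Change of variable on an interval *)

Section Substitution.
Variable R : realType.
Local Notation mu := (@lebesgue_measure R).

Lemma continuous_itv_integrable (f : R -> R) (a b : R) : {within `[a, b], continuous f} ->
  mu.-integrable `[a, b] (EFin \o f).
Proof. by move=> cf; apply: continuous_compact_integrable => //; exact: segment_compact. Qed.

(** End points have measure 0. Half-open intervals are needed to tile a sector, closed ones for
    substitution. *)
Lemma Rintegral_itv_cc (f : R -> R) (a b : R) bl br : {within `[a, b], continuous f} ->
  Rintegral mu [set` Interval (BSide bl a) (BSide br b)] f = Rintegral mu `[a, b] f.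
Proof.
move=> cf; have If := continuous_itv_integrable cf.
have Is bl' br' : mu.-integrable [set` Interval (BSide bl' a) (BSide br' b)] (EFin \o f).
  apply: integrableS If; [exact: measurable_itv|exact: measurable_itv|].
  move=> x /=; rewrite !in_itv /=; case: bl' br' => -[] /= /andP[] => [-> /ltW ->|-> ->|/ltW -> /ltW ->|/ltW -> ->] //.
transitivity (Rintegral mu [set` Interval (BSide bl a) (BRight b)] f).
  by case: br => //; apply: Rintegral_itv_bndo_bndc; exact: Is.
by case: bl => //; apply: Rintegral_itv_obnd_cbnd; exact: Is.
Qed.

(** The hypotheses are two-sided and include the end points, so the one-sided limits at [a] and [b]
    come from continuity; monotonicity of [phi] is the mean value theorem. *)
Lemma Rintegral_substitution (phi dphi f : R -> R) (a b : R) : a <= b ->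
  (forall x, a <= x <= b -> is_derive x 1 phi (dphi x)) ->
  (forall x, a <= x <= b -> {for x, continuous dphi}) ->
  (forall x, a <= x <= b -> 0 < dphi x) ->
  {within `[phi a, phi b], continuous f} ->
  Rintegral mu `[phi a, phi b] f = Rintegral mu `[a, b] (fun x => f (phi x) * dphi x).
Proof.
move=> ab Dp cdp dp0 cf; have [<-{b ab Dp cdp dp0 cf}|ab'] := eqVneq a b.
  by rewrite !set_itv1 !Rintegral_set1.
have {ab'} lab : a < b by rewrite lt_neqAle ab'.
have dE x : a <= x <= b -> derive1 phi x = dphi x.
  by move=> xab; rewrite derive1E; have := Dp x xab => ?; rewrite derive_val.
have cp x : a <= x <= b -> {for x, continuous phi}.
  move=> xab; apply: differentiable_continuous; apply/derivable1_diffP; have := Dp x xab => ?; exact: ex_derive.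
have abo x : x \in `]a, b[ -> a <= x <= b.
  by rewrite in_itv /= => /andP[/ltW -> /ltW ->].
congr fine; rewrite integration_by_substitution_increasing //.
- by apply: eq_integral => x; rewrite inE /= in_itv /= => xab; rewrite fctE /= dE.
- move=> x y; rewrite !in_itv /= => xab yab xy.
  have [||c] := @MVT _ phi dphi x y xy.
  + move=> t; rewrite in_itv /= => /andP[xt ty]; apply: Dp.
    by apply/andP; split; [exact: le_trans (andP xab).1 (ltW xt)| exact: le_trans (ltW ty) (andP yab).2].
  + apply: continuous_in_subspaceT => t; rewrite inE /= in_itv /= => /andP[xt ty]; apply: cp.
    by apply/andP; split; [exact: le_trans (andP xab).1 xt| exact: le_trans ty (andP yab).2].
  rewrite in_itv /= => /andP[xc cy] E; rewrite -subr_gt0 E mulr_gt0 ?subr_gt0 // dp0 //.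
  by apply/andP; split; [exact: le_trans (andP xab).1 (ltW xc)| exact: le_trans (ltW cy) (andP yab).2].
- move=> x xab; rewrite /continuous_at dE ?abo //.
  apply: cvg_trans (cdp _ (abo _ xab)); apply: near_eq_cvg.
  near=> y; rewrite dE // abo //; near: y; exact: near_in_itvoo.
- have ca : a <= a <= b by rewrite lexx ab.
  apply/cvg_ex; exists (dphi a); apply: cvg_trans (cvg_at_right_filter (cdp a ca)).
  apply: near_eq_cvg; near=> y; rewrite dE //; apply/andP; split.
    by near: y; exact: nbhs_right_ge.
  by near: y; apply: nbhs_right_le.
- have ca : a <= b <= b by rewrite lexx ab.
  apply/cvg_ex; exists (dphi b); apply: cvg_trans (cvg_at_left_filter (cdp b ca)).
  apply: near_eq_cvg; near=> y; rewrite dE //; apply/andP; split.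
    by near: y; apply: nbhs_left_ge.
  by near: y; exact: nbhs_left_le.
split.
- by move=> x /abo xab; have := Dp x xab => ?; exact: ex_derive.
- by apply: cvg_at_right_filter; apply: cp; rewrite lexx ab.
- by apply: cvg_at_left_filter; apply: cp; rewrite lexx ab.
Unshelve. all: by end_near. Qed.

End Substitution.

(** * Polar coordinates in a sector around the positive half-axis *)

Section RightHalfPlane.
Variable R : realType.
Local Notation mu := (@lebesgue_measure R).

(** Inversion is continuous off 0, and the exceptional point is a measurable singleton. *)
Lemma measurable_inv (D : set R) : measurable_fun D (fun x : R => x^-1).
Proof.
apply: measurable_funTS.
have -> : [set: R] = ~` [set 0] `|` [set 0] by rewrite setUC setUv.
apply/measurable_funU => //; first exact: measurableC.
split; last by exact: measurable_fun_set1.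
apply: open_continuous_measurable_fun; first exact: closed_openC.
by move=> x; rewrite inE /= => /eqP x0; exact: inv_continuous.
Qed.

Lemma measurable_fun_div d (T : measurableType d) (f g : T -> R) :
  measurable_fun setT f -> measurable_fun setT g -> measurable_fun setT (fun x => f x / g x).
Proof.
move=> mf mg; apply: measurable_funM => //.
exact: (measurableT_comp (@measurable_inv setT) mg).
Qed.

Lemma cos_gt0 (x : R) : - (pi / 2) < x < pi / 2 -> 0 < cos x.
Proof. by move=> h; apply: cos_gt0_pihalf. Qed.

(** Here |tan x| <= 1, so 1 / cos^2 x = 1 + tan^2 x <= 2. The bound 2 is crude; only boundedness
    matters. *)
Lemma cos_piquarter_bound (x : R) : - (pi / 4) <= x <= pi / 4 -> 0 < cos x /\ (cos x)^-1 <= 2.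
Proof.
have p0 := pi_gt0 R.
move=> /andP[h1 h2]; have hx : - (pi / 2) < x < pi / 2 by apply/andP; split; lra.
have c0 := cos_gt0 hx; split => //.
have t1 : tan x <= 1.
  rewrite -tan_piquarter leNgt ltr_tan ?in_itv /= -?leNgt //.
  by apply/andP; split; lra.
have t2 : -1 <= tan x.
  rewrite -tan_piquarter -tanN leNgt ltr_tan ?in_itv /= -?leNgt //.
  by apply/andP; split; lra.
have E := cos2_tan2 (lt0r_neq0 c0).
rewrite -exprVn in E.
have ci : 0 < (cos x)^-1 by rewrite invr_gt0.
nra.
Qed.

Variables (al be : R) (bl : bool).
Hypotheses (h_al : - (pi / 4) <= al) (h_be : be <= pi / 4) (h_ab : al <= be).
Variables (G H : R -> R) (A : R).
Hypotheses (cG : continuous G) (GA : forall x, A < `|x| -> G x = 0).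
Hypothesis cH : forall x, al <= x <= be -> {for x, continuous H}.

Let cHw : {within `[al, be], continuous H}.
Proof. by apply: continuous_in_subspaceT => x; rewrite inE /= in_itv /=; exact: cH. Qed.

Let i := Interval (BSide bl al) (BLeft be).
(** This is G(ln r) H(phi) on a sector, because in the right half-plane the argument is
    [atan (p.2 / p.1)]. With [bl = true] the ray phi = [al] is included; the ray phi = [be] never
    is, so that adjacent sectors can be disjoint. *)
Definition half_plane_fun (p : R * R) : R :=
  if (0 < p.1) && (atan (p.2 / p.1) \in i)
  then G (ln (p.1 ^+ 2 + p.2 ^+ 2) / 2) * H (atan (p.2 / p.1)) else 0.

(** [H] is controlled on [al, be] only; its extension by 0 is measurable and bounded on the whole
    line. *)
Let Hm : R -> R := patch (fun=> 0) `[al, be] H.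

Let mHm : measurable_fun setT Hm.
Proof.
apply/(measurable_restrictT _ _).1; first exact: measurable_itv.
by apply: subspace_continuous_measurable_fun => //; exact: measurable_itv.
Qed.

Let HmE x : x \in i -> Hm x = H x.
Proof.
move=> xi; rewrite /Hm patchE ifT // inE /=.
by move: xi; rewrite /i !in_itv /=; case: bl => /= /andP[] => [->|/ltW ->] /ltW ->.
Qed.

Let Hbd : exists2 M, 0 <= M & forall x, `|Hm x| <= M.
Proof.
have /compact_bounded[M [_ mrt]] := continuous_compact cHw (@segment_compact _ al be).
exists (`|M| + 1) => [|x]; first by rewrite addr_ge0.
rewrite /Hm patchE; case: ifPn; last by rewrite normr0 addr_ge0.
rewrite inE => xi; apply: (mrt (`|M| + 1)); last by exists x.
by rewrite ltr_pwDr // ler_norm.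
Qed.

Let Gbd : exists2 M, 0 <= M & forall x, `|G x| <= M.
Proof.
have cG' : {within `[- `|A|, `|A|], continuous G} by exact: continuous_subspaceT.
have /compact_bounded[M [_ mrt]] := continuous_compact cG' (@segment_compact _ _ _).
exists (`|M| + 1) => [|x]; first by rewrite addr_ge0.
have [xA|xA] := leP `|x| `|A|; last first.
  by rewrite GA ?normr0 ?addr_ge0 // (le_lt_trans (ler_norm A)).
apply: (mrt (`|M| + 1)); last by exists x => //=; rewrite in_itv /= -ler_norml.
by rewrite ltr_pwDr // ler_norm.
Qed.

Let mG : measurable_fun setT G.
Proof. exact: continuous_measurable_fun. Qed.

Let m_in d (T : measurableType d) (f : T -> R) (j : interval R) : measurable_fun setT f ->
  measurable_fun setT (fun x => f x \in j).
Proof.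
move=> mf; have := mf measurableT _ (measurable_itv j); rewrite setTI => mj.
by apply: (measurable_fun_bool true); rewrite setTI.
Qed.

Lemma bddsupp2_half_plane_fun : bddsupp2 half_plane_fun.
Proof.
have E : half_plane_fun = fun p => if (0 < p.1) && (atan (p.2 / p.1) \in i)
  then G (ln (p.1 ^+ 2 + p.2 ^+ 2) / 2) * Hm (atan (p.2 / p.1)) else 0.
  by apply/funext => p; rewrite /half_plane_fun; case: ifP => // /andP[_ /HmE ->].
have mq : measurable_fun setT (fun p : R * R => atan (p.2 / p.1)).
  apply: (measurableT_comp (continuous_measurable_fun (@continuous_atan R))).
  exact: measurable_fun_div.
split.
  rewrite E; apply: measurable_fun_ifT => //.
    apply: measurable_and; last exact: m_in.
    exact: measurable_fun_ltr.
  apply: measurable_funM; last exact: measurableT_comp mHm mq.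
  apply: (measurableT_comp mG).
  apply: measurable_fun_div => //.
  apply: (measurableT_comp (@measurable_ln R)).
  by apply: measurable_funD; exact: measurable_funX.
have [MG G0 hG] := Gbd; have [MH H0 hH] := Hbd.
(* Beyond [expR A] in either coordinate ln r exceeds [A], where [G] vanishes; [MG * MH] bounds the
   values. *)
exists (Num.max (expR A) (MG * MH)) => p; rewrite E; split.
  case: ifP => _; last by rewrite normr0 le_max expR_ge0.
  by rewrite le_max normrM ler_pM ?orbT.
move=> hp; case: ifP => // _; rewrite GA ?mul0r //.
have {}hp : expR A < `|p.1| \/ expR A < `|p.2|.
  by case: hp => /(le_lt_trans _) hp; [left|right]; apply: hp; rewrite le_max lexx.
have e0 := expR_gt0 A.
have : expR A ^+ 2 < p.1 ^+ 2 + p.2 ^+ 2.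
  rewrite -(real_normK (num_real p.1)) -(real_normK (num_real p.2)).
  have n1 := normr_ge0 p.1; have n2 := normr_ge0 p.2.
  by case: hp => ?; nra.
rewrite -expRM_natl => hl; apply: (lt_le_trans _ (ler_norm _)).
rewrite ltr_pdivlMr // -ltr_expR lnK; first by rewrite mulrC.
by rewrite posrE (lt_trans _ hl) // expR_gt0.
Qed.

(** The integrand after y2 = y1 tan t at fixed y1: the radius is y1 / cos t, and dy2 = y1 / cos^2 t
    dt. *)
Let K (p : R * R) : R := if (0 < p.1) && (p.2 \in `[al, be]) then
  G (ln (p.1 / cos p.2)) * Hm p.2 * (p.1 / cos p.2 ^+ 2) else 0.

Let cosb x : x \in `[al, be] -> 0 < cos x /\ (cos x)^-1 <= 2.
Proof.
rewrite in_itv /= => /andP[h1 h2]; apply: cos_piquarter_bound.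
by rewrite (le_trans h_al h1) (le_trans h2 h_be).
Qed.

Let bddsupp2_K : bddsupp2 K.
Proof.
have [MG G0 hG] := Gbd; have [MH H0 hH] := Hbd.
have mc : measurable_fun setT (fun p : R * R => cos p.2).
  exact: (measurableT_comp (continuous_measurable_fun (@continuous_cos R))).
split.
  apply: measurable_fun_ifT => //.
    apply: measurable_and; last exact: m_in.
    exact: measurable_fun_ltr.
  apply: measurable_funM; first apply: measurable_funM.
  - apply: (measurableT_comp mG); apply: (measurableT_comp (@measurable_ln R)).
    exact: measurable_fun_div.
  - exact: (measurableT_comp mHm).
  - by apply: measurable_fun_div => //; exact: measurable_funX.
have p4 : pi / 4 < pi :> R by have := pi_gt0 R; lra.
(* Where [G] does not vanish, y1 <= y1 / cos t <= exp A, hence y1 / cos^2 t <= 2 exp A; the angle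
   stays below pi / 4 < pi in absolute value. *)
exists (Num.max (Num.max (expR A) pi) (MG * MH * (2 * expR A))) => p; split.
  rewrite /K; case: ifPn; last by rewrite normr0 !le_max expR_ge0.
  move=> /andP[p0 /cosb[c0 c2]].
  have [lA|lA] := leP `|ln (p.1 / cos p.2)| A; last first.
    by rewrite GA // !mul0r normr0 !le_max expR_ge0.
  rewrite le_max; apply/orP; right; rewrite normrM ler_pM //.
    by rewrite normrM ler_pM.
  have pc : 0 < p.1 / cos p.2 by rewrite divr_gt0.
  have : p.1 / cos p.2 <= expR A.
    by rewrite -[leLHS]lnK ?posrE // ler_expR; exact: le_trans (ler_norm _) lA.
  rewrite gtr0_norm ?divr_gt0 ?exprn_gt0 // -exprVn expr2 mulrA => h1.
  by rewrite mulrC ler_pM ?invr_ge0 // ltW.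
rewrite !gt_max; move=> hp; rewrite /K; case: ifPn => // /andP[p0 pi2].
have [c0 c2] := cosb pi2; case: hp => /andP[/andP[h1 h2] h3].
  rewrite GA ?mul0r //; apply: (lt_le_trans _ (ler_norm _)).
  rewrite -ltr_expR lnK ?posrE ?divr_gt0 //.
  apply: (lt_le_trans h1); rewrite gtr0_norm // ler_pdivlMr //.
  by rewrite ger_pMr // cos_le1.
exfalso; move: pi2; rewrite in_itv /= => /andP[g1 g2].
have : `|p.2| <= pi / 4 by rewrite ler_norml (le_trans h_al g1) (le_trans g2 h_be).
by move=> /(lt_le_trans h2); rewrite ltNge (ltW p4).
Qed.

Let inner_y (x : R) : 
  Rintegral mu setT (fun y => half_plane_fun (x, y)) = Rintegral mu setT (fun t => K (x, t)).
Proof.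
have [x0|x0] := leP x 0.
  by congr Rintegral; apply/funext => t; rewrite /half_plane_fun /K /= ltNge x0.
have p0 := pi_gt0 R.
have i2 t : t \in `[al, be] -> t \in `](- (pi / 2)), (pi / 2)[.
  rewrite !in_itv /= => /andP[? ?].
  have a1 := h_al; have a2 := h_be; apply/andP; split; lra.
have ali : al \in `](- (pi / 2)), (pi / 2)[ by apply: i2; rewrite in_itv /= lexx h_ab.
have bei : be \in `](- (pi / 2)), (pi / 2)[ by apply: i2; rewrite in_itv /= lexx h_ab.
have tle (u v : R) : u \in `](- (pi / 2)), (pi / 2)[ -> v \in `](- (pi / 2)), (pi / 2)[ ->
    (tan u <= tan v) = (u <= v).
  by move=> hu hv; rewrite leNgt ltr_tan // -leNgt.
pose f y := G (ln (x ^+ 2 + y ^+ 2) / 2) * H (atan (y / x)).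
have ai y : atan (y / x) \in `](- (pi / 2)), (pi / 2)[.
  by rewrite in_itv /= atan_gtNpi2 atan_ltpi2.
have cf : {within `[x * tan al, x * tan be], continuous f}.
  have c1 : continuous (fun y : R => G (ln (x ^+ 2 + y ^+ 2) / 2)).
    move=> y; apply: continuous_comp; last exact: cG.
    apply: cvgM; last exact: cvg_cst.
    apply: continuous_comp; last first.
      apply: continuous_ln; rewrite ltr_wpDr ?sqr_ge0 ?exprn_gt0 //.
    apply: cvgD; first exact: cvg_cst.
    exact: exprn_continuous.
  have c2 : continuous (fun y : R => atan (y / x)).
    move=> y; apply: continuous_comp; last exact: continuous_atan.
    apply: cvgM; [exact: cvg_id | exact: cvg_cst].
  apply: continuous_in_subspaceT => y; rewrite inE => yi.
  apply: cvgM; first exact: c1.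
  apply: continuous_comp; first exact: c2.
  apply: cH; move: yi; rewrite /= in_itv /= -(tle _ _ ali (ai y)) -(tle _ _ (ai y) bei) atanK.
  by rewrite ler_pdivlMr // ler_pdivrMr // ![_ * x]mulrC.
transitivity (Rintegral mu [set` Interval (BSide bl (x * tan al)) (BLeft (x * tan be))] f).
  rewrite [RHS]Rintegral_mkcond; congr Rintegral; apply/funext => y.
  rewrite patchE /half_plane_fun /= x0 /=; have -> : (atan (y / x) \in i) = (y \in [set` Interval (BSide bl (x * tan al)) (BLeft (x * tan be))]).
    rewrite mem_setE /i !in_itv /= -(ltr_tan (ai y) bei) atanK ltr_pdivrMr // [_ * x]mulrC.
    congr (_ && _); case: bl => /=.
      by rewrite -(tle _ _ ali (ai y)) atanK ler_pdivlMr // [_ * x]mulrC.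
    by rewrite -(ltr_tan ali (ai y)) atanK ltr_pdivlMr // [_ * x]mulrC.
  by [].
rewrite Rintegral_itv_cc //.
have cost t : al <= t <= be -> 0 < cos t.
  by move=> tab; apply: (cosb _).1; rewrite in_itv.
have -> : Rintegral mu `[x * tan al, x * tan be] f = 
    Rintegral mu `[al, be] (fun t => f (x * tan t) * (x / cos t ^+ 2)).
  apply: (@Rintegral_substitution R (fun t => x * tan t)) => // t /cost c0.
  - have := is_derive_tan (lt0r_neq0 c0) => ?.
    apply: is_derive_eq; rewrite /GRing.scale /=; ring.
  - apply: cvgM; first exact: cvg_cst.
    apply: cvgV; first by rewrite expf_neq0 // gt_eqF.
    exact: (@continuous_comp _ _ _ (@cos R) (fun y => y ^+ 2) t (@continuous_cos R t) (@exprn_continuous _ _ _)).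
  - by rewrite divr_gt0 // exprn_gt0.
rewrite [LHS]Rintegral_mkcond; congr Rintegral; apply/funext => t.
  rewrite patchE mem_setE /K /= x0 /=; case: ifPn => // ti.
have [c0 _] := cosb ti.
rewrite /f; have -> : Hm t = H t by rewrite /Hm patchE mem_setE ti.
  have -> : x * tan t / x = tan t by rewrite mulrAC divff ?mul1r // gt_eqF.
  rewrite tanK ?i2 //; congr (G _ * _ * _).
  have -> : x ^+ 2 + (x * tan t) ^+ 2 = (x / cos t) ^+ 2.
    by rewrite [X in _ + X]exprMn [RHS]exprMn exprVn cos2_tan2 ?gt_eqF // mulrDr mulr1.
  by rewrite lnXn ?divr_gt0 // -[_ *+ 2]mulr_natr mulfK.
Qed.


(** With y1 = cos t exp(rho) the argument of [G] becomes rho, and y1 / cos^2 t dy1 becomes exp(2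
    rho) d rho: all dependence on t except [Hm t] disappears. *)
Let inner_x (t : R) :
  Rintegral mu setT (fun x => K (x, t)) =
  Hm t * Rintegral mu setT (fun rho => G rho * expR (2 * rho)).
Proof.
have [ti|ti] := boolP (t \in `[al, be]); last first.
  rewrite /Hm patchE mem_setE (negbTE ti) mul0r /K /=.
  under eq_Rintegral do rewrite (negbTE ti) andbF.
  by rewrite Rintegral_cst ?mul0r.
have [c0 _] := cosb ti.
pose B := `|A|.
have AB : - B <= B by rewrite /B ge0_cp.
pose f (x : R) := G (ln (x / cos t)) * Hm t * (x / cos t ^+ 2).
have cpos rho : 0 < cos t * expR rho by rewrite mulr_gt0 ?expR_gt0.
transitivity (Rintegral mu `[cos t * expR (- B), cos t * expR B] f).
  rewrite [RHS]Rintegral_mkcond; congr Rintegral; apply/funext => x.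
  rewrite patchE mem_setE /K /= ti andbT in_itv /=.
  have [x0|x0] := ltP 0 x; last by rewrite ifF //; apply: negbTE; rewrite negb_and -ltNge (le_lt_trans x0).
  case: ifPn => //; rewrite -[X in _ * X <= _]opprK.
  have xc : 0 < x / cos t by rewrite divr_gt0.
  have E : (cos t * expR (- B) <= x <= cos t * expR B) = (`|ln (x / cos t)| <= B).
    rewrite ler_norml -[X in - B <= X]expRK -[X in _ && (X <= B)]expRK !(lnK, posrE) //.
    by rewrite -(ler_expR (- B)) -(ler_expR _ B) lnK ?posrE // ler_pdivlMr // ler_pdivrMr // ![_ * cos t]mulrC.
  rewrite opprK E -ltNge => h; rewrite GA ?mul0r //.
  by rewrite (le_lt_trans _ h) // ler_norm.
have -> : Rintegral mu `[cos t * expR (- B), cos t * expR B] f =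
    Rintegral mu `[- B, B] (fun rho => f (cos t * expR rho) * (cos t * expR rho)).
  apply: (@Rintegral_substitution R (fun rho => cos t * expR rho)) => // [rho _|].
    by apply: cvgM; [exact: cvg_cst | exact: continuous_expR].
  apply: continuous_in_subspaceT => x; rewrite inE => xi.
  have x0 : 0 < x by move: xi; rewrite /= in_itv /= => /andP[x1 _]; exact: lt_le_trans (cpos _) x1.
  have c1 (c : R) : {for x, continuous (fun x : R => x / c)}.
    by apply: cvgM; [exact: cvg_id | exact: cvg_cst].
  have c2 : {for x, continuous (fun x : R => G (ln (x / cos t)))}.
    apply: continuous_comp; last exact: cG.
    apply: continuous_comp; first exact: c1.
    by apply: continuous_ln; rewrite divr_gt0.
  apply: cvgM; last exact: c1.
  by apply: cvgM; [exact: c2 | exact: cvg_cst].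
rewrite -RintegralZl //; last first.
  have : bddsupp1 (fun rho => G rho * expR (2 * rho)).
    have [MG G0 hG] := Gbd; split.
      by apply: measurable_funM => //; apply: measurableT_comp => //.
    exists (Num.max B (MG * expR (2 * B))) => rho; split; last first.
      by rewrite gt_max => /andP[h _]; rewrite GA ?mul0r // (le_lt_trans _ h) // ler_norm.
    have [rB|rB] := leP `|rho| B; last first.
      by rewrite GA ?mul0r ?normr0 ?le_max ?normr_ge0 // (le_lt_trans _ rB) // ler_norm.
    rewrite le_max normrM (gtr0_norm (expR_gt0 _)) ler_pM ?expR_ge0 ?orbT //.
    by rewrite ler_expR ler_pM2l // (le_trans _ rB) // ler_norm.
  exact: bddsupp1_integrable.
rewrite [LHS]Rintegral_mkcond; congr Rintegral; apply/funext => rho.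
rewrite patchE mem_setE in_itv /= -ler_norml; case: ifPn => [_|]; last first.
  by rewrite -ltNge => h; rewrite GA ?mul0r ?mulr0 // (le_lt_trans _ h) // ler_norm.
rewrite /f [X in ln X]mulrAC divff ?gt_eqF // mul1r expRK mulr_natl mulr2n expRD.
by field; rewrite gt_eqF.
Qed.

Lemma plane_integral_half_plane_fun : plane_integral half_plane_fun =
  Rintegral mu setT (fun rho => G rho * expR (2 * rho)) * Rintegral mu `]al, be[ H.
Proof.
rewrite /plane_integral; under eq_Rintegral do rewrite inner_y.
rewrite (bddsupp2_fubini bddsupp2_K); under eq_Rintegral do rewrite inner_x.
rewrite Rintegral_itv_cc // [X in _ = _ * X]Rintegral_mkcond mulrC -RintegralZr //.
have [MH H0 hH] := Hbd.
have : bddsupp1 Hm.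
  split => //; exists (Num.max MH pi) => t; split; first by rewrite le_max hH.
  rewrite gt_max => /andP[_ h]; rewrite /Hm patchE mem_setE ifF //.
  apply/negbTE/negP; rewrite in_itv /= => /andP[h1 h2].
  have : `|t| <= pi / 4 by rewrite ler_norml (le_trans h_al h1) (le_trans h2 h_be).
  by have := pi_gt0 R; lra.
exact: bddsupp1_integrable.
Qed.

End RightHalfPlane.

(** * Polar coordinates in an arbitrary sector of ]0, 2 pi[ *)

Section Polar.
Variable R : realType.
Local Notation mu := (@lebesgue_measure R).
Implicit Types (p : R * R).

Definition radius p : R := Num.sqrt (p.1 ^+ 2 + p.2 ^+ 2).
(** This is ln r, written without the square root so that it can be differentiated as the logarithm
    of a polynomial. *)
Definition logr p : R := ln (p.1 ^+ 2 + p.2 ^+ 2) / 2.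
(* Half-angle formula for the argument in ]0, 2 pi[; the value 0 on the ray
   phi = 0, where the quotient is undefined. *)
Definition arg p : R :=
  if radius p == p.1 then 0 else pi - 2 * atan (p.2 / (radius p - p.1)).

Definition polar (r phi : R) : R * R := (r * cos phi, r * sin phi).

Lemma sqr_polar r phi : (polar r phi).1 ^+ 2 + (polar r phi).2 ^+ 2 = r ^+ 2.
Proof. by rewrite !exprMn -mulrDr cos2Dsin2 mulr1. Qed.

Lemma radius_polar r phi : 0 < r -> radius (polar r phi) = r.
Proof. by move=> r0; rewrite /radius sqr_polar sqrtr_sqr gtr0_norm. Qed.

Lemma logr_polar r phi : 0 < r -> logr (polar r phi) = ln r.
Proof. by move=> r0; rewrite /logr sqr_polar lnXn // -[_ *+ 2]mulr_natr mulfK. Qed.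

(** Write cos x = 1 - 2 sin^2 (x / 2), where x / 2 lies in ]0, pi[. *)
Lemma cos_lt1 (x : R) : 0 < x < 2 * pi -> cos x < 1.
Proof.
move=> /andP[x0 x2]; have p0 := pi_gt0 R.
have -> : x = (x / 2) *+ 2 by rewrite -mulr_natr; field.
rewrite cos_mulr2n cos2sin2 ; have s0 : 0 < sin (x / 2) by apply: sin_gt0_pi; apply/andP; split; lra.
by have := exprn_gt0 2 s0; rewrite mulr2n; lra.
Qed.

(** The quotient sin phi / (1 - cos phi) is cot (phi / 2) = tan (pi / 2 - phi / 2), and pi / 2 - phi
    / 2 lies in the range of [atan] for all phi in ]0, 2 pi[. *)
Lemma arg_polar r phi : 0 < r -> 0 < phi < 2 * pi -> arg (polar r phi) = phi.
Proof.
move=> r0 hphi; rewrite /arg radius_polar //=.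
have c1 := cos_lt1 hphi; have p0 := pi_gt0 R; move/andP: hphi => [h1 h2].
rewrite ifF; last by apply/negbTE; rewrite -subr_eq0 -{1}[r]mulr1 -mulrBr mulf_neq0 ?gt_eqF // subr_gt0.
have s0 : 0 < sin (phi / 2) by apply: sin_gt0_pi; apply/andP; split; lra.
have E : phi = (phi / 2) *+ 2 by rewrite -mulr_natr; field.
have -> : r * sin phi / (r - r * cos phi) = tan (pi / 2 - phi / 2).
  have -> : r - r * cos phi = r * (2 * sin (phi / 2) ^+ 2).
    by rewrite [X in cos X]E cos_mulr2n cos2sin2 mulr2n; ring.
  have -> : r * sin phi = r * (2 * sin (phi / 2) * cos (phi / 2)).
    by rewrite [X in sin X]E sin_mulr2n mulr2n; ring.
  rewrite /tan [pi / 2 - _]addrC sinDpihalf cosDpihalf cosN sinN opprK.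
  by field; rewrite !gt_eqF.
rewrite tanK ?in_itv /=; last by apply/andP; split; lra.
by field.
Qed.

Lemma arg_polar_itv bl a b r phi : phi \in Interval (BSide bl a) (BLeft b) ->
  0 < a -> b <= 2 * pi -> 0 < r -> arg (polar r phi) = phi.
Proof.
rewrite in_itv /= => h u0 vb r0; apply: arg_polar => //.
by case: bl h => /= /andP[? ?]; apply/andP; split; lra.
Qed.

Lemma radius_gt0 p : 0 < p.1 ^+ 2 + p.2 ^+ 2 -> 0 < radius p.
Proof. by rewrite sqrtr_gt0. Qed.

Lemma radius_logr p : 0 < p.1 ^+ 2 + p.2 ^+ 2 -> radius p = expR (logr p).
Proof.
move=> h; have r0 := radius_gt0 h.
have -> : logr p = ln (radius p).
  rewrite /logr -[p.1 ^+ 2 + _]sqr_sqrtr ?ltW // -/(radius p) lnXn // -[_ *+ 2]mulr_natr mulfK //.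
by rewrite lnK.
Qed.

Lemma polar_arg p : radius p != p.1 ->
  0 < p.1 ^+ 2 + p.2 ^+ 2 /\ p = polar (radius p) (arg p).
Proof.
move=> h; have h0 : 0 < p.1 ^+ 2 + p.2 ^+ 2.
  rewrite lt_neqAle addr_ge0 ?sqr_ge0 // andbT eq_sym; apply: contraNN h.
  rewrite paddr_eq0 ?sqr_ge0 // !sqrf_eq0 => /andP[/eqP a /eqP b].
  by rewrite /radius a b expr0n addr0 sqrtr0.
split => //; have r0 := radius_gt0 h0; rewrite /arg (negbTE h).
have rE : radius p ^+ 2 = p.1 ^+ 2 + p.2 ^+ 2 by rewrite sqr_sqrtr // ltW.
set r := radius p in h r0 rE *.
have rp : r - p.1 != 0 by rewrite subr_eq0.
set t := p.2 / (r - p.1).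
have ct : cos (atan t) != 0 by rewrite gt_eqF // cos_gt0 // atan_gtNpi2 atan_ltpi2.
have tp : p.2 = t * (r - p.1) by rewrite /t mulfVK.
have sE : sin (atan t) = t * cos (atan t) by rewrite -{2}[t]atanK /tan mulfVK.
have c2 : cos (atan t) ^+ 2 * (1 + t ^+ 2) = 1.
  rewrite -{2}[t]atanK -cos2_tan2 // mulfV // expf_neq0 //.
(* With t = cot (phi / 2) this is cos phi = (t^2 - 1) / (t^2 + 1), cleared of denominators. *)
have e1 : r * (t ^+ 2 - 1) = p.1 * (1 + t ^+ 2).
  have : (r - p.1) * (r * (t ^+ 2 - 1) - p.1 * (1 + t ^+ 2)) = 0.
    have -> : (r - p.1) * (r * (t ^+ 2 - 1) - p.1 * (1 + t ^+ 2)) = (t * (r - p.1)) ^+ 2 - r ^+ 2 + p.1 ^+ 2 by ring.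
    by rewrite -tp rE; ring.
  by move/eqP; rewrite mulf_eq0 (negbTE rp) /= subr_eq0 => /eqP.
have aE : 2 * atan t = atan t *+ 2 by rewrite mulr_natl.
rewrite /polar [p]surjective_pairing /=; congr pair.
  rewrite [pi - _]addrC cosDpi cosN aE cos_mulr2n mulr2n.
  transitivity (p.1 * (cos (atan t) ^+ 2 * (1 + t ^+ 2))); first by rewrite c2 mulr1.
  rewrite mulrCA -e1.
  transitivity (r * (cos (atan t) ^+ 2 * (1 + t ^+ 2) - 2 * cos (atan t) ^+ 2)); first by ring.
  by rewrite c2; ring.
rewrite [pi - _]addrC sinDpi sinN opprK aE sin_mulr2n sE mulr2n.
transitivity (t * (r * (cos (atan t) ^+ 2 * (1 + t ^+ 2)) - p.1 * (cos (atan t) ^+ 2 * (1 + t ^+ 2)))).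
  by rewrite c2 !mulr1.
transitivity (t * cos (atan t) ^+ 2 * (r * (1 + t ^+ 2) - p.1 * (1 + t ^+ 2))); first by ring.
by rewrite -e1; ring.
Qed.

Definition rot90 p : R * R := (- p.2, p.1).

Lemma rot90_polar r phi : rot90 (polar r phi) = polar r (phi + pi / 2).
Proof. by rewrite /rot90 /polar /= cosDpihalf sinDpihalf mulrN. Qed.

Lemma iter_rot90_polar k r phi : iter k rot90 (polar r phi) = polar r (phi + k%:R * (pi / 2)).
Proof.
elim: k => [|k IH]; first by rewrite mul0r addr0.
by rewrite iterS IH rot90_polar -natr1; congr polar; ring.
Qed.

Lemma iter4_rot90 p : iter 4 rot90 p = p.
Proof. by case: p => a b; rewrite /= /rot90 /= !opprK. Qed.

Lemma bddsupp2_iter_rot90 k (F : R * R -> R) : bddsupp2 F ->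
  bddsupp2 (F \o iter k rot90) /\ plane_integral (F \o iter k rot90) = plane_integral F.
Proof.
elim: k F => [//|k IH] F bF; have [b1 <-] := bddsupp2_rot90 bF.
exact: (IH (F \o rot90) b1).
Qed.

Definition sector (i : interval R) p : Prop :=
  exists r phi, [/\ 0 < r, phi \in i & p = polar r phi].

Definition polar_fun (i : interval R) (G H : R -> R) p : R :=
  if `[< sector i p >] then G (logr p) * H (arg p) else 0.

Section Cut.
Variables (G : R -> R) (A : R).
Hypotheses (cG : continuous G) (GA : forall x, A < `|x| -> G x = 0).
Variable H : R -> R.

Let good bl a b := bddsupp2 (polar_fun (Interval (BSide bl a) (BLeft b)) G H) /\
  plane_integral (polar_fun (Interval (BSide bl a) (BLeft b)) G H) =
  Rintegral mu setT (fun rho => G rho * expR (2 * rho)) * Rintegral mu `]a, b[ H.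

(* Sectors are cut at the odd multiples of pi / 4; each piece is rotated by a
   multiple of pi / 2 into the sector `|phi| <= pi / 4, where Fubini applies to
   y2 = y1 tan phi. *)
Let good_base k bl a b : (k <= 4)%N -> 0 < a -> a <= b -> b < 2 * pi ->
  k%:R * (pi / 2) - pi / 4 <= a -> b <= k%:R * (pi / 2) + pi / 4 ->
  (forall x, a <= x <= b -> {for x, continuous H}) -> good bl a b.
Proof.
move=> k4 a0 ab b2 ka kb cH; set w := k%:R * (pi / 2) in ka kb.
have p0 := pi_gt0 R.
have h1 : - (pi / 4) <= a - w by lra.
have h2 : b - w <= pi / 4 by lra.
have h3 : a - w <= b - w by lra.
pose H' := H \o (fun x => x + w).
have cH' x : a - w <= x <= b - w -> {for x, continuous H'}.
  move=> /andP[xa xb]; apply: continuous_comp; last by apply: cH; apply/andP; split; lra.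
  by apply: cvgD; [exact: cvg_id | exact: cvg_cst].
have b1 := bddsupp2_half_plane_fun bl cG GA cH'.
have i1 := plane_integral_half_plane_fun bl h1 h2 h3 cG GA cH'.
set F := half_plane_fun _ _ _ _ _ in b1 i1.
have FE q : F q = if (0 < q.1) && (atan (q.2 / q.1) \in Interval (BSide bl (a - w)) (BLeft (b - w)))
    then G (logr q) * H' (atan (q.2 / q.1)) else 0 by [].
move: F FE b1 i1 => F FE b1 i1.
(* Since four quarter turns are the identity, [4 - k] of them move the sector around k pi / 2 to the
   one around the positive half-axis. *)
have [b3 i3] := bddsupp2_iter_rot90 (4 - k) b1.
have E : polar_fun (Interval (BSide bl a) (BLeft b)) G H = F \o iter (4 - k) rot90.
  apply/funext => p; rewrite /polar_fun; case: asboolP => [|np] /=.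
    move=> [r [phi [r0 phii pE]]].
    have hphi : a <= phi < b.
      by move: phii; rewrite in_itv /=; case: bl {F FE b1 i1 b3 i3} => //= /andP[/ltW -> ->].
    have qE : iter (4 - k) rot90 p = polar r (phi - w).
      rewrite pE iter_rot90_polar /polar.
      have -> : phi + (4 - k)%:R * (pi / 2) = phi - w + pi *+ 2.
        by rewrite natrB // /w -mulr_natr; field.
      by rewrite cosD2pi sinD2pi.
    have psi : - (pi / 2) < phi - w < pi / 2.
      by move/andP: hphi => [? ?]; apply/andP; split; lra.
    have c0 := cos_gt0 psi.
    rewrite FE qE.
    have -> : (polar r (phi - w)).2 / (polar r (phi - w)).1 = tan (phi - w).
      by rewrite /tan /=; field; rewrite !gt_eqF.
    rewrite tanK ?in_itv //= mulr_gt0 //=.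
    rewrite pE !(logr_polar _ r0) /H' /= subrK arg_polar //; last first.
      by move/andP: hphi => [? ?]; apply/andP; split; lra.
    rewrite ifT //; move: phii; rewrite in_itv /=.
    by case: bl {F FE b1 i1 b3 i3} => /= /andP[q1 q2]; apply/andP; split; lra.
  rewrite FE; set q := iter _ _ _; case: ifPn => // /andP[q0 qi]; exfalso; apply: np.
  have q2 : 0 < q.1 ^+ 2 + q.2 ^+ 2 by rewrite ltr_wpDr ?sqr_ge0 // exprn_gt0.
  have qE : q = polar (radius q) (atan (q.2 / q.1)).
    have hs : 0 < 1 + (q.2 / q.1) ^+ 2 by rewrite ltr_wpDr ?sqr_ge0.
    have rE : radius q = q.1 / cos (atan (q.2 / q.1)).
      rewrite cos_atan invrK /radius.
      have -> : q.1 ^+ 2 + q.2 ^+ 2 = q.1 ^+ 2 * (1 + (q.2 / q.1) ^+ 2) by field; rewrite gt_eqF.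
      by rewrite sqrtrM ?sqr_ge0 // sqrtr_sqr gtr0_norm.
    have ct : cos (atan (q.2 / q.1)) != 0.
      by rewrite gt_eqF // cos_gt0 // atan_gtNpi2 atan_ltpi2.
    rewrite /polar rE [LHS]surjective_pairing; congr pair; first by rewrite mulfVK.
    by rewrite -mulrA [_^-1 * _]mulrC -/(tan _) atanK mulrCA divff ?mulr1 // gt_eqF.
  exists (radius q), (atan (q.2 / q.1) + w); split; first exact: radius_gt0.
    move: qi; rewrite !in_itv /= => {F FE b1 i1 b3 i3}.
    by case: bl => /= /andP[? ?]; apply/andP; split; lra.
  by rewrite /w -iter_rot90_polar -qE /q -iterD subnKC // iter4_rot90.
rewrite /good E; split; [exact: b3 | rewrite i3 i1]; congr (_ * _).
have cw (f : R -> R) u v : (forall x, u <= x <= v -> {for x, continuous f}) -> {within `[u, v], continuous f}.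
  by move=> cf; apply: continuous_in_subspaceT => x; rewrite inE /= in_itv /=; exact: cf.
rewrite !Rintegral_itv_cc; [|exact: cw..].
have -> : a = a - w + w by rewrite subrK.
have -> : b = b - w + w by rewrite subrK.
rewrite !addrK.
have -> : Rintegral mu `[a - w + w, b - w + w] H = Rintegral mu `[a - w, b - w] (fun x => H (x + w) * 1).
  apply: (@Rintegral_substitution R (fun x => x + w)) => // [x _|x _|].
  - by apply: is_derive_eq; rewrite addr0.
  - exact: cvg_cst.
  - by rewrite !subrK; exact: cw.
by apply: eq_Rintegral => x _; rewrite mulr1.
Qed.

(** The second piece contains the ray phi = c and the first does not, so the two functions add up
    without overlap; disjointness holds because [arg] recovers the angle. *)
Let good_cat bl a c b : 0 < a -> a < c -> c <= b -> b < 2 * pi ->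
  (forall x, a <= x <= b -> {for x, continuous H}) ->
  good bl a c -> good true c b -> good bl a b.
Proof.
move=> a0 ac cb b2 cH [b1 i1] [b3 i3].
have E : polar_fun (Interval (BSide bl a) (BLeft b)) G H =
    polar_fun (Interval (BSide bl a) (BLeft c)) G H \+ polar_fun (Interval (BSide true c) (BLeft b)) G H.
  apply/funext => p; rewrite /polar_fun /=.
  case: (asboolP (sector (Interval (BSide bl a) (BLeft c)) p)) => [h1|h1].
    case: (asboolP (sector (Interval (BSide true c) (BLeft b)) p)) => [h2|h2].
      exfalso; move: h1 h2 => [r [phi [r0 hphi pE]]] [r' [psi [r0' hpsi pE']]].
      have := arg_polar_itv hphi a0 (ltW (le_lt_trans cb b2)) r0.
      rewrite -pE pE' (arg_polar_itv hpsi (lt_trans a0 ac) (ltW b2) r0') => e.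
      move: hphi hpsi; rewrite -e !in_itv /= => /andP[_ h] /andP[h' _].
      by move: (lt_le_trans h h'); rewrite ltxx.
    rewrite addr0 asboolT //; case: h1 => r [phi [r0 hphi pE]]; exists r, phi; split => //.
    by move: hphi; rewrite !in_itv /= => /andP[-> h]; exact: lt_le_trans h cb.
  case: (asboolP (sector (Interval (BSide true c) (BLeft b)) p)) => [h2|h2].
    rewrite add0r asboolT //; case: h2 => r [phi [r0 hphi pE]]; exists r, phi; split => //.
    move: hphi; rewrite !in_itv /= => /andP[h ->]; rewrite andbT.
    by case: bl {h1 b1 i1} => /=; [exact: le_trans (ltW ac) h | exact: lt_le_trans ac h].
  rewrite addr0 asboolF // => -[r [phi [r0 hphi pE]]].
  move: hphi; rewrite in_itv /= => /andP[ha hb].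
  have [pc|pc] := ltP phi c.
    by apply: h1; exists r, phi; split => //; rewrite in_itv /= pc andbT.
  by apply: h2; exists r, phi; split => //; rewrite in_itv /= pc hb.
have [bE iE] := bddsupp2D b1 b3; rewrite /good E; split; first exact: bE.
rewrite iE i1 i3 -mulrDr; congr (_ * _).
have cw : {within `[a, b], continuous H}.
  by apply: continuous_in_subspaceT => x; rewrite inE /= in_itv /=; exact: cH.
have cw1 : {within `[a, c], continuous H}.
  apply: continuous_in_subspaceT => x; rewrite inE /= in_itv /= => /andP[xa xc].
  by apply: cH; rewrite xa (le_trans xc).
have cw2 : {within `[c, b], continuous H}.
  apply: continuous_in_subspaceT => x; rewrite inE /= in_itv /= => /andP[xa xc].
  by apply: cH; rewrite xc (le_trans (ltW ac)).
rewrite !Rintegral_itv_cc // -(@Rintegral_itv_cc _ H c b false false) //.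
rewrite addrC; apply/eqP; rewrite eq_sym -subr_eq; apply/eqP.
apply: (@Rintegral_itvB R H (BLeft a) (BRight b) c (continuous_itv_integrable cw)).
  by rewrite bnd_simp ltW.
by rewrite bnd_simp.
Qed.

(** Induction on the number of odd multiples of pi / 4 available below b, splitting off the last
    piece. *)
Let good_all k bl a b : (k <= 4)%N -> 0 < a -> a <= b -> b < 2 * pi ->
  b <= k%:R * (pi / 2) + pi / 4 ->
  (forall x, a <= x <= b -> {for x, continuous H}) -> good bl a b.
Proof.
have p0 := pi_gt0 R.
elim: k bl a b => [|k IH] bl a b k4 a0 ab b2 bk cH.
  by apply: (@good_base 0) => //; lra.
have e : k.+1%:R * (pi / 2) - pi / 4 = k%:R * (pi / 2) + pi / 4 :> R.
  by rewrite -natr1; field.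
have [h|h] := leP (k%:R * (pi / 2) + pi / 4) a.
  by apply: (@good_base k.+1) => //; rewrite e.
have [h'|h'] := leP b (k%:R * (pi / 2) + pi / 4).
  by apply: IH => //; exact: ltnW.
apply: (@good_cat _ _ (k%:R * (pi / 2) + pi / 4)) => //; first exact: ltW.
  apply: IH => //; [exact: ltnW|exact: ltW|lra|].
  by move=> x /andP[xa xb]; apply: cH; rewrite xa (le_trans xb) // ltW.
apply: (@good_base k.+1) => //; [lra|exact: ltW|by rewrite e|].
by move=> x /andP[xa xb]; apply: cH; rewrite xb (le_trans (ltW h)).
Qed.

Lemma polar_integral a b : 0 < a -> a <= b -> b < 2 * pi ->
  (forall x, a <= x <= b -> {for x, continuous H}) ->
  bddsupp2 (polar_fun `]a, b[ G H) /\
  plane_integral (polar_fun `]a, b[ G H) =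
  Rintegral mu setT (fun rho => G rho * expR (2 * rho)) * Rintegral mu `]a, b[ H.
Proof.
(* Four suffices, as 4 (pi / 2) + pi / 4 exceeds 2 pi. *)
move=> a0 ab b2 cH; apply: (@good_all 4 false) => //.
by have := pi_gt0 R; lra.
Qed.

End Cut.
End Polar.

(** * Iterated complex integrals *)

Section ComplexIntegral.
Variable R : realType.
Local Notation C := R[i].
Local Notation mu := (@lebesgue_measure R).
Local Notation Re := (@complex.Re R).
Local Notation Im := (@complex.Im R).

Lemma ReM (x y : C) : Re (x * y) = Re x * Re y - Im x * Im y.
Proof. by case: x y => a b [c d]; simpc. Qed.
Lemma ImM (x y : C) : Im (x * y) = Re x * Im y + Im x * Re y.
Proof. by case: x y => a b [c d]; simpc. Qed.
Lemma ReD (x y : C) : Re (x + y) = Re x + Re y.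
Proof. by case: x y => a b [c d]. Qed.
Lemma ImD (x y : C) : Im (x + y) = Im x + Im y.
Proof. by case: x y => a b [c d]. Qed.
Lemma eq_complexP (x y : C) : Re x = Re y -> Im x = Im y -> x = y.
Proof. by case: x y => a b [c d] /= -> ->. Qed.

Definition has_cintegral (f : R -> C) (v : C) : Prop :=
  [/\ mu.-integrable setT (EFin \o (Re \o f)), mu.-integrable setT (EFin \o (Im \o f)),
      Rintegral mu setT (Re \o f) = Re v & Rintegral mu setT (Im \o f) = Im v].

Lemma has_cintegral_ext f g v : f =1 g -> has_cintegral f v -> has_cintegral g v.
Proof. by move=> /funext ->. Qed.

Lemma integrableDR (f g : R -> R) : mu.-integrable setT (EFin \o f) ->
  mu.-integrable setT (EFin \o g) -> mu.-integrable setT (EFin \o (f \+ g)).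
Proof. by move=> h1 h2; apply: eq_integrable (integrableD _ h1 h2). Qed.

Lemma integrableZR (c : R) (f : R -> R) : mu.-integrable setT (EFin \o f) ->
  mu.-integrable setT (EFin \o (fun x => c * f x)).
Proof. by move=> h; apply: eq_integrable (integrableZl _ c h). Qed.

Lemma has_cintegral0 : has_cintegral (fun=> 0) 0.
Proof.
by split; rewrite /= ?Rintegral_cst ?mul0r //; exact: integrable0.
Qed.

Lemma has_cintegralD f g v w : has_cintegral f v -> has_cintegral g w -> has_cintegral (fun x => f x + g x) (v + w).
Proof.
move=> [f1 f2 f3 f4] [g1 g2 g3 g4].
have rE : Re \o (fun x => f x + g x) = (Re \o f) \+ (Re \o g).
  by apply/funext => x /=; rewrite ReD.
have iE : Im \o (fun x => f x + g x) = (Im \o f) \+ (Im \o g).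
  by apply/funext => x /=; rewrite ImD.
split; rewrite ?rE ?iE ?ReD ?ImD; [exact: integrableDR|exact: integrableDR| |].
  by rewrite -f3 -g3 -RintegralD.
by rewrite -f4 -g4 -RintegralD.
Qed.

Lemma has_cintegralZ (c : C) f v : has_cintegral f v -> has_cintegral (fun x => c * f x) (c * v).
Proof.
move=> [f1 f2 f3 f4].
have rE : Re \o (fun x => c * f x) = (fun x => Re c * (Re \o f) x) \+ (fun x => - Im c * (Im \o f) x).
  by apply/funext => x /=; rewrite ReM mulNr.
have iE : Im \o (fun x => c * f x) = (fun x => Re c * (Im \o f) x) \+ (fun x => Im c * (Re \o f) x).
  by apply/funext => x /=; rewrite ImM.
split; rewrite ?rE ?iE ?ReM ?ImM.
- by apply: integrableDR; exact: integrableZR.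
- by apply: integrableDR; exact: integrableZR.
- by rewrite -f3 -f4 -mulNr -!RintegralZl // -RintegralD //; exact: integrableZR.
- by rewrite -f3 -f4 -!RintegralZl // -RintegralD //; exact: integrableZR.
Qed.

(** A relation that follows the recursion of [integral_rV] and records integrability in every
    variable; the bare iterated integral is not additive without it. *)
Fixpoint has_iter_cintegral (n : nat) : ('rV[R]_n -> C) -> C -> Prop :=
  match n with
  | 0%N => fun f v => f 0 = v
  | n'.+1 => fun f v => exists g : R -> C,
      (forall t, has_iter_cintegral (fun w : 'rV[R]_n' => f (row_mx (const_mx t : 'rV[R]_1) w)) (g t)) /\
      has_cintegral g v
  end.

Lemma has_iter_cintegral_integral n (f : 'rV[R]_n -> C) v : has_iter_cintegral f v ->
  cintegral (@integral_rV R n) f = v.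
Proof.
have H m : forall (f : 'rV[R]_m -> C) v, has_iter_cintegral f v ->
    integral_rV (Re \o f) = Re v /\ integral_rV (Im \o f) = Im v.
  elim: m => [|m IH] h u /=; first by move=> <-.
  move=> [g [hg [_ _ <- <-]]]; split; apply: eq_Rintegral => t _.
    exact: (IH _ _ (hg t)).1.
  exact: (IH _ _ (hg t)).2.
by move=> /H[rE iE]; apply: eq_complexP.
Qed.

Lemma has_iter_cintegral_ext n (f g : 'rV[R]_n -> C) v : f =1 g -> has_iter_cintegral f v -> has_iter_cintegral g v.
Proof. by move=> /funext ->. Qed.

Lemma has_iter_cintegral0 n : has_iter_cintegral ((fun=> 0) : 'rV[R]_n -> C) 0.
Proof. by elim: n => //= n IH; exists (fun=> 0); split => //; exact: has_cintegral0. Qed.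

Lemma has_iter_cintegralD n (f g : 'rV[R]_n -> C) v w : has_iter_cintegral f v -> has_iter_cintegral g w ->
  has_iter_cintegral (fun x => f x + g x) (v + w).
Proof.
elim: n f g v w => [|n IH] f g v w /=; first by move=> -> ->.
move=> [F [hF iF]] [G [hG iG]]; exists (fun t => F t + G t); split; last exact: has_cintegralD.
by move=> t; exact: IH.
Qed.

Lemma has_iter_cintegralZ n (c : C) (f : 'rV[R]_n -> C) v : has_iter_cintegral f v -> has_iter_cintegral (fun x => c * f x) (c * v).
Proof.
elim: n f v => [|n IH] f v /=; first by move=> ->.
move=> [F [hF iF]]; exists (fun t => c * F t); split; last exact: has_cintegralZ.
by move=> t; exact: IH.
Qed.

Lemma has_iter_cintegral_prod n (h : 'I_n -> R -> C) (c : 'I_n -> C) : (forall i, has_cintegral (h i) (c i)) ->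
  has_iter_cintegral (fun z : 'rV[R]_n => \prod_(i < n) h i (z 0 i)) (\prod_(i < n) c i).
Proof.
elim: n h c => [|n IH] h c hc /=; first by rewrite !big_ord0.
exists (fun t => h ord0 t * \prod_(i < n) c (lift ord0 i)); split.
  move=> t; apply: has_iter_cintegral_ext (has_iter_cintegralZ (h ord0 t) (IH _ _ (fun i => hc (lift ord0 i)))) => z.
  rewrite big_ord_recl; congr (h _ _ * _).
    rewrite mxE; case: splitP => j; first by rewrite mxE.
    by [].
  apply: eq_bigr => i _; congr (h _ _); rewrite mxE; case: splitP => j.
    by rewrite ord1.
  by move=> /= [] ij; congr (z _ _); exact/val_inj.
rewrite big_ord_recl mulrC.
by apply: has_cintegral_ext (has_cintegralZ _ (hc ord0)) => t; rewrite mulrC.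
Qed.

Definition cplane_integral (F : R * R -> C) : C := (plane_integral (Re \o F) +i* plane_integral (Im \o F))%C.

Definition cbddsupp2 (F : R * R -> C) := bddsupp2 (Re \o F) /\ bddsupp2 (Im \o F).

Lemma has_iter_cintegral_plane d (F : R * R -> C) (Z : 'rV[R]_d -> C) c (f : 'rV[R]_(2 + d) -> C) :
  cbddsupp2 F -> has_iter_cintegral Z c ->
  (forall x : 'rV[R]_(2 + d), f x = F (x 0 (lshift d 0), x 0 (lshift d 1)) * Z (rsubmx x)) ->
  has_iter_cintegral f (cplane_integral F * c).
Proof.
move=> [b1 b2] iZ fE.
pose F1 t := (Rintegral mu setT (fun y => Re (F (t, y))) +i* Rintegral mu setT (fun y => Im (F (t, y))))%C.
change (exists g : R -> C,
      (forall t, has_iter_cintegral (fun w : 'rV[R]_d.+1 => f (row_mx (const_mx t : 'rV[R]_1) w)) (g t)) /\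
      has_cintegral g (cplane_integral F * c)).
exists (fun t => F1 t * c); split; last first.
  have h : has_cintegral F1 (cplane_integral F).
    by split => //; [exact: (bddsupp2_integral_fst b1).1|exact: (bddsupp2_integral_fst b2).1].
  by rewrite mulrC; apply: has_cintegral_ext (has_cintegralZ c h) => t; rewrite mulrC.
move=> t.
exists (fun y => F (t, y) * c); split; last first.
  have h : has_cintegral (fun y => F (t, y)) (F1 t).
    split => //; [exact: (bddsupp1_integrable (bddsupp2_section t b1))|exact: (bddsupp1_integrable (bddsupp2_section t b2))].
  by rewrite mulrC; apply: has_cintegral_ext (has_cintegralZ c h) => y; rewrite mulrC.
move=> y; apply: has_iter_cintegral_ext (has_iter_cintegralZ _ iZ) => w /=; rewrite fE; congr (F (_, _) * Z _).
- rewrite mxE; case: splitP => j; first by rewrite mxE.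
  by move=> /eqP.
- rewrite mxE; case: splitP => j; first by rewrite ord1.
  move=> /= jE; rewrite mxE; case: splitP => k; first by rewrite mxE.
  by move=> kE; move: jE; rewrite kE.
- apply/rowP => k; rewrite !mxE; case: splitP => j; first by rewrite ord1.
  move=> /= kj; rewrite mxE; case: splitP => l lE; move: kj; rewrite lE.
    by rewrite ord1.
  by move=> [] /val_inj ->.
Qed.

Definition ccont (f : R -> C) (x : R) :=
  {for x, continuous (Re \o f)} /\ {for x, continuous (Im \o f)}.

Definition ccont_csupp (G : R -> C) := (forall x, ccont G x) /\ exists A, forall x, A < `|x| -> G x = 0.

Definition line_cintegral (f : R -> C) : C := cintegral (Rintegral mu setT) f.

Lemma bddsupp1_cs (g : R -> R) A : continuous g -> (forall x, A < `|x| -> g x = 0) -> bddsupp1 g.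
Proof.
move=> cg gA; split; first exact: continuous_measurable_fun.
have cg' : {within `[- `|A|, `|A|], continuous g} by exact: continuous_subspaceT.
have /compact_bounded[M [_ mrt]] := continuous_compact cg' (@segment_compact _ _ _).
exists (Num.max `|A| (`|M| + 1)) => x; split; last first.
  by rewrite gt_max => /andP[h _]; rewrite gA // (le_lt_trans (ler_norm _)).
have [xA|xA] := leP `|x| `|A|; last first.
  by rewrite gA ?normr0 ?le_max ?normr_ge0 // (le_lt_trans (ler_norm A)).
rewrite le_max; apply/orP; right; apply: (mrt (`|M| + 1)).
  by rewrite ltr_pwDr // ler_norm.
by exists x => //=; rewrite in_itv /= -ler_norml.
Qed.

Lemma ccont_csupp_has_cintegral G : ccont_csupp G -> has_cintegral G (line_cintegral G).
Proof.
move=> [cG [A GA]]; split => //; apply: bddsupp1_integrable.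
  apply: (@bddsupp1_cs _ A); first by move=> x; exact: (cG x).1.
  by move=> x h /=; rewrite GA.
apply: (@bddsupp1_cs _ A); first by move=> x; exact: (cG x).2.
by move=> x h /=; rewrite GA.
Qed.

Lemma has_cintegral_line_cintegral f v : has_cintegral f v -> line_cintegral f = v.
Proof. by move=> [_ _ rE iE]; apply: eq_complexP. Qed.

Definition cpolar_fun (i : interval R) (G H : R -> C) p : C :=
  if `[< sector i p >] then G (logr p) * H (arg p) else 0.

Lemma cpolar_integral (G H : R -> C) a b : ccont_csupp G -> 0 < a -> a <= b -> b < 2 * pi ->
  (forall x, a <= x <= b -> ccont H x) ->
  cbddsupp2 (cpolar_fun `]a, b[ G H) /\
  cplane_integral (cpolar_fun `]a, b[ G H) =
  line_cintegral (fun rho => (expR (2 * rho))%:C%C * G rho) * integral_arc a b H.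
Proof.
move=> [cG [A GA]] a0 ab b2 cH.
pose g1 := Re \o G; pose g2 := Im \o G; pose h1 := Re \o H; pose h2 := Im \o H.
(* Re (G H) = Re G Re H - Im G Im H; the sign goes into the radial factor so that only sums of real
   products occur. *)
pose n2 x := - g2 x.
have cg1 : continuous g1 by move=> x; exact: (cG x).1.
have cg2 : continuous g2 by move=> x; exact: (cG x).2.
have cn2 : continuous n2 by move=> x; apply: cvgN; exact: cg2.
have g1A x : A < `|x| -> g1 x = 0 by move=> h; rewrite /g1 /= GA.
have g2A x : A < `|x| -> g2 x = 0 by move=> h; rewrite /g2 /= GA.
have n2A x : A < `|x| -> n2 x = 0 by move=> h; rewrite /n2 g2A ?oppr0.
have ch1 x : a <= x <= b -> {for x, continuous h1} by move=> h; exact: (cH x h).1.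
have ch2 x : a <= x <= b -> {for x, continuous h2} by move=> h; exact: (cH x h).2.
have [b11 i11] := polar_integral cg1 g1A a0 ab b2 ch1.
have [b12 i12] := polar_integral cg1 g1A a0 ab b2 ch2.
have [b21 i21] := polar_integral cg2 g2A a0 ab b2 ch1.
have [b22 i22] := polar_integral cn2 n2A a0 ab b2 ch2.
have [bR iR] := bddsupp2D b11 b22; have [bI iI] := bddsupp2D b12 b21.
have rE : Re \o cpolar_fun `]a, b[ G H = polar_fun `]a, b[ g1 h1 \+ polar_fun `]a, b[ n2 h2.
  apply/funext => p; rewrite /cpolar_fun /polar_fun /=; case: ifP => _; last by rewrite addr0.
  by rewrite ReM /n2 mulNr.
have iE : Im \o cpolar_fun `]a, b[ G H = polar_fun `]a, b[ g1 h2 \+ polar_fun `]a, b[ g2 h1.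
  apply/funext => p; rewrite /cpolar_fun /polar_fun /=; case: ifP => _; last by rewrite addr0.
  by rewrite ImM.
rewrite /cbddsupp2 /cplane_integral rE iE; split => //; rewrite iR iI i11 i12 i21 i22.
have ReE : Re (line_cintegral (fun rho => (expR (2 * rho))%:C%C * G rho)) = Rintegral mu setT (fun rho => g1 rho * expR (2 * rho)).
  by apply: eq_Rintegral => x _ /=; rewrite ReM /= mul0r subr0 mulrC.
have ImE : Im (line_cintegral (fun rho => (expR (2 * rho))%:C%C * G rho)) = Rintegral mu setT (fun rho => g2 rho * expR (2 * rho)).
  by apply: eq_Rintegral => x _ /=; rewrite ImM /= mul0r addr0 mulrC.
have nE : Rintegral mu setT (fun rho => n2 rho * expR (2 * rho)) = - Rintegral mu setT (fun rho => g2 rho * expR (2 * rho)).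
  rewrite -mulN1r -RintegralZl //; first by apply: eq_Rintegral => x _; rewrite mulN1r mulNr.
  apply: bddsupp1_integrable; apply: (@bddsupp1_cs _ A).
    move=> x; apply: cvgM; first exact: cg2.
    apply: continuous_comp; last exact: continuous_expR.
    by apply: cvgM; [exact: cvg_cst | exact: cvg_id].
  by move=> x /g2A ->; rewrite mul0r.
apply: eq_complexP; rewrite ?ReM ?ImM ReE ImE /= ?nE ?mulNr //.
Qed.

(** The substitution r = exp(rho); bounded support of [g] keeps r away from 0 and from infinity. *)
Lemma integrable_half_line (g : R -> R) A : continuous g -> (forall x, A < `|x| -> g x = 0) ->
  mu.-integrable setT (EFin \o (fun r => if 0 < r then g (ln r) else 0)) /\
  Rintegral mu setT (fun r => if 0 < r then g (ln r) else 0) =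
  Rintegral mu setT (fun rho => g rho * expR rho).
Proof.
move=> cg gA; split.
  have [mg [M hM]] := bddsupp1_cs cg gA.
  apply: bddsupp1_integrable; split.
    apply: measurable_fun_ifT => //; last exact: (measurableT_comp mg (@measurable_ln R)).
    exact: measurable_fun_ltr.
  exists (Num.max M (expR A)) => r; split.
    case: ifP => _; first by rewrite le_max (hM _).1.
    by rewrite normr0 le_max expR_ge0 orbT.
  rewrite gt_max => /andP[_ h]; case: ifP => // r0; apply: gA.
  apply: lt_le_trans (ler_norm _); rewrite -ltr_expR lnK ?posrE //.
  by rewrite gtr0_norm in h.
pose B := `|A|; pose f (r : R) := g (ln r).
have AB : - B <= B by rewrite /B ge0_cp.
transitivity (Rintegral mu `[expR (- B), expR B] f).
  rewrite [RHS]Rintegral_mkcond; congr Rintegral; apply/funext => r.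
  rewrite patchE mem_setE in_itv /=.
  have [r0|r0] := ltP 0 r; last first.
    by rewrite ifF //; apply: negbTE; rewrite negb_and -ltNge (le_lt_trans r0) // expR_gt0.
  have -> : (expR (- B) <= r <= expR B) = (`|ln r| <= B).
    by rewrite ler_norml -(ler_expR (- B)) -(ler_expR _ B) lnK.
  case: ifPn => //; rewrite -ltNge => h; apply: gA.
  by rewrite (le_lt_trans _ h) // ler_norm.
have -> : Rintegral mu `[expR (- B), expR B] f = Rintegral mu `[- B, B] (fun rho => f (expR rho) * expR rho).
  apply: (@Rintegral_substitution R (@expR R)) => // [x _|x _|].
  - exact: continuous_expR.
  - exact: expR_gt0.
  apply: continuous_in_subspaceT => x; rewrite inE => xi.
  apply: continuous_comp; last exact: cg.
  by apply: continuous_ln; move: xi; rewrite /= in_itv /= => /andP[x1 _]; exact: lt_le_trans (expR_gt0 _) x1.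
rewrite [LHS]Rintegral_mkcond; congr Rintegral; apply/funext => rho.
rewrite patchE mem_setE in_itv /= -ler_norml /f expRK; case: ifPn => //.
by rewrite -ltNge => h; rewrite gA ?mul0r // (le_lt_trans _ h) // ler_norm.
Qed.

Lemma has_iter_cintegral_half d (G : R -> C) (Z : 'rV[R]_d -> C) c (f : 'rV[R]_(1 + d) -> C) :
  ccont_csupp G -> has_iter_cintegral Z c ->
  (forall w : 'rV[R]_(1 + d), f w = (if 0 < w 0 0 then G (ln (w 0 0)) else 0) * Z (rsubmx w)) ->
  has_iter_cintegral f (line_cintegral (fun rho => (expR rho)%:C%C * G rho) * c).
Proof.
move=> [cG [A GA]] iZ fE.
change (exists g : R -> C,
      (forall t, has_iter_cintegral (fun w : 'rV[R]_d => f (row_mx (const_mx t : 'rV[R]_1) w)) (g t)) /\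
      has_cintegral g (line_cintegral (fun rho => (expR rho)%:C%C * G rho) * c)).
exists (fun r => (if 0 < r then G (ln r) else 0) * c); split.
  move=> t; apply: has_iter_cintegral_ext (has_iter_cintegralZ _ iZ) => w /=; rewrite fE row_mxKr.
  have -> : (row_mx (const_mx t : 'rV[R]_1) w) 0 0 = t; last by [].
  rewrite mxE; case: splitP => j; first by rewrite mxE.
  by move=> /eqP.
rewrite mulrC; apply: (@has_cintegral_ext (fun r => c * (if 0 < r then G (ln r) else 0))).
  by move=> r; rewrite mulrC.
apply: has_cintegralZ.
have [i1 e1] := @integrable_half_line (Re \o G) A (fun x => (cG x).1) (fun x h => congr1 Re (GA x h)).
have [i2 e2] := @integrable_half_line (Im \o G) A (fun x => (cG x).2) (fun x h => congr1 Im (GA x h)).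
have rE : Re \o (fun r => if 0 < r then G (ln r) else 0) = (fun r => if 0 < r then (Re \o G) (ln r) else 0).
  by apply/funext => r /=; case: ifP.
have iE : Im \o (fun r => if 0 < r then G (ln r) else 0) = (fun r => if 0 < r then (Im \o G) (ln r) else 0).
  by apply/funext => r /=; case: ifP.
split; rewrite ?rE ?iE // ?e1 ?e2; apply: eq_Rintegral => x _ /=.
  by rewrite ReM /= mul0r subr0 mulrC.
by rewrite ImM /= mul0r addr0 mulrC.
Qed.

End ComplexIntegral.

(** * Calculus of D *)

Section ComplexCalculus.
Variable R : realType.
Local Notation C := R[i].
Local Notation Re := (@complex.Re R).
Local Notation Im := (@complex.Im R).

(** Both functions have the same first-order expansion at x, and such an expansion determines the
    differential. *)
Lemma near_eq_differentiable (V W : normedModType R) (f g : V -> W) (x : V) :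
  (\forall y \near x, f y = g y) -> differentiable f x -> differentiable g x.
Proof.
move=> fg /diff_locallyP[cf ff].
have fgx : f x = g x by exact: nbhs_singleton fg.
have fg0 : \forall h \near (0 : V), f (h + x) = g (h + x).
  by move: fg; rewrite (near_shift 0 x) subr0; apply: filterS => h /=; rewrite /= ?addr0.
have gg : g \o shift x = cst (g x) + 'd f x +o_ 0 id.
  apply/eqaddoP => e e0; move/eqaddoP : ff => /(_ e e0) ff.
  by apply: filterS2 fg0 ff => h fgh; rewrite !fctE /= fgh fgx.
have dE := diff_unique cf gg.
by apply/diff_locallyP; split; rewrite dE.
Qed.

Section Pointwise.
Variable V : normedModType R.
Implicit Types (u w : V -> C) (x v : V) (h : V -> R).

Lemma near_cdifferentiable u w x : (\forall y \near x, u y = w y) ->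
  cdifferentiable u x -> cdifferentiable w x.
Proof.
move=> uw [ru iu]; split.
  by apply: near_eq_differentiable ru; apply: filterS uw => y ->.
by apply: near_eq_differentiable iu; apply: filterS uw => y ->.
Qed.

Lemma near_Dop u w x v : (\forall y \near x, u y = w y) -> Dop v u x = Dop v w x.
Proof.
move=> uw; rewrite /Dop /cderive.
by congr (- 'i * (_ +i* _)%C); apply: near_eq_derive; apply: filterS uw => y ->.
Qed.

Lemma cdifferentiable_cst (c : C) x : cdifferentiable (fun=> c) x.
Proof. by split; exact: differentiable_cst. Qed.

Lemma Dop_cst (c : C) x v : Dop v (fun=> c) x = 0.
Proof. by rewrite /Dop /cderive !derive_cst mulr0. Qed.

Lemma cdifferentiableD u w x : cdifferentiable u x -> cdifferentiable w x ->
  cdifferentiable (fun y => u y + w y) x.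
Proof.
move=> [ru iu] [rw iw]; split.
  have -> : (fun y => Re (u y + w y)) = (fun y => Re (u y)) + (fun y => Re (w y)).
    by apply/funext => y; rewrite ReD.
  exact: differentiableD.
have -> : (fun y => Im (u y + w y)) = (fun y => Im (u y)) + (fun y => Im (w y)).
  by apply/funext => y; rewrite ImD.
exact: differentiableD.
Qed.

Lemma DopD u w x v : cdifferentiable u x -> cdifferentiable w x ->
  Dop v (fun y => u y + w y) x = Dop v u x + Dop v w x.
Proof.
move=> [ru iu] [rw iw]; rewrite /Dop /cderive.
have -> : (fun y => Re (u y + w y)) = (fun y => Re (u y)) + (fun y => Re (w y)).
  by apply/funext => y; rewrite ReD.
have -> : (fun y => Im (u y + w y)) = (fun y => Im (u y)) + (fun y => Im (w y)).
  by apply/funext => y; rewrite ImD.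
rewrite !deriveD; [|exact: diff_derivable..].
by rewrite -mulrDr.
Qed.

Lemma cdifferentiableM u w x : cdifferentiable u x -> cdifferentiable w x ->
  cdifferentiable (fun y => u y * w y) x.
Proof.
move=> [ru iu] [rw iw]; split.
  have -> : (fun y => Re (u y * w y)) = (fun y => Re (u y)) * (fun y => Re (w y)) - (fun y => Im (u y)) * (fun y => Im (w y)).
    by apply/funext => y; rewrite ReM.
  by apply: differentiableB; exact: differentiableM.
have -> : (fun y => Im (u y * w y)) = (fun y => Re (u y)) * (fun y => Im (w y)) + (fun y => Im (u y)) * (fun y => Re (w y)).
  by apply/funext => y; rewrite ImM.
by apply: differentiableD; exact: differentiableM.
Qed.

Lemma DopM u w x v : cdifferentiable u x -> cdifferentiable w x ->
  Dop v (fun y => u y * w y) x = Dop v u x * w x + u x * Dop v w x.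
Proof.
move=> [ru iu] [rw iw]; rewrite /Dop /cderive.
have -> : (fun y => Re (u y * w y)) = (fun y => Re (u y)) * (fun y => Re (w y)) - (fun y => Im (u y)) * (fun y => Im (w y)).
  by apply/funext => y; rewrite ReM.
have -> : (fun y => Im (u y * w y)) = (fun y => Re (u y)) * (fun y => Im (w y)) + (fun y => Im (u y)) * (fun y => Re (w y)).
  by apply/funext => y; rewrite ImM.
have := diff_derivable (v := v) ru; have := diff_derivable (v := v) iu.
have := diff_derivable (v := v) rw; have := diff_derivable (v := v) iw => d1 d2 d3 d4.
rewrite (deriveB (derivableM d4 d2) (derivableM d3 d1)) (deriveD (derivableM d4 d1) (derivableM d3 d2)).
rewrite (deriveM d4 d2) (deriveM d3 d1) (deriveM d4 d1) (deriveM d3 d2) -mulrA [u x * _]mulrCA -mulrDr; congr (_ * _).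
apply: eq_complexP; rewrite ?ReD ?ImD ?ReM ?ImM /= /GRing.scale /=.
  by ring.
by ring.
Qed.

Lemma cdifferentiableZ (c : C) u x : cdifferentiable u x -> cdifferentiable (fun y => c * u y) x.
Proof. by move=> du; apply: cdifferentiableM => //; exact: cdifferentiable_cst. Qed.

Lemma DopZ (c : C) u x v : cdifferentiable u x -> Dop v (fun y => c * u y) x = c * Dop v u x.
Proof.
by move=> du; rewrite (DopM _ (cdifferentiable_cst c x) du) Dop_cst mul0r add0r.
Qed.

Lemma cdifferentiable_real h x : differentiable h x -> cdifferentiable (fun y => (h y)%:C%C) x.
Proof. by move=> dh; split => //; exact: differentiable_cst. Qed.

Lemma Dop_real h x v : Dop v (fun y => (h y)%:C%C) x = - 'i * ('D_v h x)%:C%C.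
Proof. by rewrite /Dop /cderive /= derive_cst. Qed.

Lemma Dop_chain (f : R -> C) h x v : differentiable h x -> cdifferentiable f (h x) ->
  cdifferentiable (f \o h) x /\ Dop v (f \o h) x = ('D_v h x)%:C%C * Dop (1 : R) f (h x).
Proof.
move=> dh [rf jf]; split.
  by split; [exact: (differentiable_comp dh rf) | exact: (differentiable_comp dh jf)].
have D (g : R -> R) : differentiable g (h x) -> 'D_v (g \o h) x = 'D_v h x * 'D_1 g (h x).
  move=> dg; rewrite (deriveE _ (differentiable_comp dh dg)) diff_comp //=.
  have lin (a : R) : 'd g (h x) a = a * 'd g (h x) 1.
    by rewrite -[in LHS](mulr1 a) -[a * 1]/(a *: (1 : R)) linearZ.
  by rewrite lin -(deriveE v dh) -(deriveE (1 : R) dg).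
rewrite /Dop /cderive [in LHS](D (fun y => Re (f y))) // (D (fun y => Im (f y))) //.
apply: eq_complexP; rewrite !(ReM, ImM) /=.
  by ring.
by ring.
Qed.

Lemma Dop_linear u x v v' (a b : R) : cdifferentiable u x ->
  Dop (a *: v + b *: v') u x = a%:C%C * Dop v u x + b%:C%C * Dop v' u x.
Proof.
move=> [ru iu].
have D (f : V -> R) : differentiable f x -> 'D_(a *: v + b *: v') f x = a * 'D_v f x + b * 'D_v' f x.
  by move=> df; rewrite (deriveE _ df) linearP [in LHS]linearZ -!(deriveE _ df).
rewrite /Dop /cderive (D _ ru) (D _ iu).
apply: eq_complexP; rewrite !(ReD, ImD, ReM, ImM) /=.
  by ring.
by ring.
Qed.

Lemma Dop_sum u x n (a : 'I_n -> R) (e : 'I_n -> V) : cdifferentiable u x ->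
  Dop (\sum_(i < n) a i *: e i) u x = \sum_(i < n) (a i)%:C%C * Dop (e i) u x.
Proof.
move=> [ru iu].
elim: n a e => [|n IH] a e.
  rewrite !big_ord0 /Dop /cderive !derive0; apply: eq_complexP => /=.
    by ring.
  by ring.
rewrite !big_ord_recl -IH.
have := @Dop_linear u x (e ord0) (\sum_(i < n) a (lift ord0 i) *: e (lift ord0 i)) (a ord0) 1 (conj ru iu).
by rewrite scale1r mul1r => ->.
Qed.

End Pointwise.

Section Smooth.
Variables (V : normedModType R) (O : set V).
Hypothesis oO : open O.
Implicit Types (u w : V -> C).

Let near_O u w x : O x -> (forall y, O y -> u y = w y) -> \forall y \near x, u y = w y.
Proof. by move=> Ox uw; apply: filterS uw (open_nbhs_nbhs (conj oO Ox)). Qed.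

Lemma eq_foldr_Dop u w (s : seq V) : (forall y, O y -> u y = w y) ->
  forall y, O y -> foldr (@Dop R V) u s y = foldr (@Dop R V) w s y.
Proof.
move=> uw; elim: s => //= v s IH y Oy; apply: near_Dop; exact: near_O.
Qed.

Lemma csmooth_Dop u v : csmooth O u -> csmooth O (Dop v u).
Proof. by move=> su s x Ox; have := su (rcons s v) x Ox; rewrite foldr_rcons. Qed.

(** The innermost derivative of a word is replaced by a member of [P] that agrees with it on [O];
    since [O] is open, the remaining derivatives do not notice. *)
Lemma csmooth_ind (P : (V -> C) -> Prop) :
  (forall u, P u -> forall x, O x -> cdifferentiable u x) ->
  (forall u v, P u -> exists2 w, P w & forall x, O x -> Dop v u x = w x) ->
  forall u, P u -> csmooth O u.
Proof.
move=> Pd PD u Pu s; elim/last_ind: s u Pu => [|s v IH] u Pu x Ox; first exact: Pd.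
have [w Pw wE] := PD u v Pu; rewrite foldr_rcons.
apply: near_cdifferentiable (IH w Pw x Ox).
by apply: near_O => // y Oy; apply: eq_foldr_Dop => // t Ot; rewrite wE.
Qed.

Inductive smooth_alg (B : (V -> C) -> Prop) : (V -> C) -> Prop :=
| SAbase u : B u -> smooth_alg B u
| SAcst c : smooth_alg B (fun=> c)
| SAadd u w : smooth_alg B u -> smooth_alg B w -> smooth_alg B (fun x => u x + w x)
| SAmul u w : smooth_alg B u -> smooth_alg B w -> smooth_alg B (fun x => u x * w x).

Lemma smooth_alg_csmooth (B : (V -> C) -> Prop) :
  (forall u, B u -> forall x, O x -> cdifferentiable u x) ->
  (forall u v, B u -> exists2 w, smooth_alg B w & forall x, O x -> Dop v u x = w x) ->
  forall u, smooth_alg B u -> csmooth O u.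
Proof.
move=> Bd BD; have Sd u : smooth_alg B u -> forall x, O x -> cdifferentiable u x.
  elim=> {u} [u Bu x Ox|c x _|u w _ IHu _ IHw x Ox|u w _ IHu _ IHw x Ox].
  - exact: Bd.
  - exact: cdifferentiable_cst.
  - by apply: cdifferentiableD; [exact: IHu | exact: IHw].
  - by apply: cdifferentiableM; [exact: IHu | exact: IHw].
apply: csmooth_ind => // u v; elim=> {u} [u Bu|c|u w Su [u' Su' uE] Sw [w' Sw' wE]|u w Su [u' Su' uE] Sw [w' Sw' wE]].
- exact: BD.
- by exists (fun=> 0) => [|x _]; [exact: SAcst | rewrite Dop_cst].
- exists (fun x => u' x + w' x) => [|x Ox]; first exact: SAadd.
  by rewrite DopD ?uE ?wE //; exact: Sd.
- exists (fun x => u' x * w x + u x * w' x) => [|x Ox]; first by apply: SAadd; exact: SAmul.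
  by rewrite DopM ?uE ?wE //; exact: Sd.
Qed.

Lemma csmooth_alg (B : (V -> C) -> Prop) : (forall u, B u -> csmooth O u) ->
  forall u, smooth_alg B u -> csmooth O u.
Proof.
move=> sB u Su; apply: (@smooth_alg_csmooth (csmooth O)).
- by move=> w sw x Ox; exact: (sw [::]).
- by move=> w v sw; exists (Dop v w) => //; apply: SAbase; exact: csmooth_Dop.
elim: Su => {u} [u /sB|c|u w _ h1 _ h2|u w _ h1 _ h2]; by [exact: SAbase|exact: SAcst|exact: SAadd|exact: SAmul].
Qed.

Lemma csmoothD u w : csmooth O u -> csmooth O w -> csmooth O (fun x => u x + w x).
Proof.
by move=> su sw; apply: (@csmooth_alg (csmooth O)) => //; apply: SAadd; exact: SAbase.
Qed.

Lemma csmoothM u w : csmooth O u -> csmooth O w -> csmooth O (fun x => u x * w x).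
Proof.
by move=> su sw; apply: (@csmooth_alg (csmooth O)) => //; apply: SAmul; exact: SAbase.
Qed.

Lemma csmooth_cst (c : C) : csmooth O (fun=> c).
Proof. by apply: (@csmooth_alg (csmooth O)) => //; exact: SAcst. Qed.

End Smooth.
End ComplexCalculus.

(** * Cut-off functions *)

Section Bump.
Variable R : realType.
Local Notation C := R[i].
Local Notation mu := (@lebesgue_measure R).

(* The functions t^-k exp(- 1 / t) span a space stable under differentiation. *)
Definition flat (k : nat) (x : R) : R := if 0 < x then (x^-1) ^+ k * expR (- x^-1) else 0.

Lemma flat_ge0 k x : 0 <= flat k x.
Proof.
by rewrite /flat; case: ifP => // x0; rewrite mulr_ge0 ?expR_ge0 // exprn_ge0 // invr_ge0 ltW.
Qed.

Lemma expR_ge_pow (u : R) k : 0 <= u -> (u / k.+1%:R) ^+ k.+1 <= expR u.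
Proof.
move=> u0; have -> : expR u = expR (u / k.+1%:R) ^+ k.+1.
  by rewrite -expRM_natl mulrC mulfVK.
rewrite lerXn2r ?nnegrE ?divr_ge0 ?expR_ge0 //.
by apply: le_trans (expR_ge1Dx _); rewrite lerDr.
Qed.

(** Apply exp u >= (u / (k + 2))^(k + 2) to u = 1 / x. The exponent k + 2 leaves a factor x^2, which
    forces a zero derivative at 0. *)
Lemma flat_le k x : flat k x <= (k.+2%:R) ^+ k.+2 * x ^+ 2.
Proof.
have c0 : 0 <= k.+2%:R ^+ k.+2 :> R by rewrite exprn_ge0.
rewrite /flat; case: ifPn => [x0|_]; last by rewrite mulr_ge0 ?sqr_ge0.
have i0 : 0 < x^-1 by rewrite invr_gt0.
have h := @expR_ge_pow x^-1 k.+1 (ltW i0).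
rewrite expRN ler_pdivrMr ?expR_gt0 //.
have Kx0 : 0 <= k.+2%:R ^+ k.+2 * x ^+ 2 by rewrite mulr_ge0 ?sqr_ge0.
apply: le_trans (ler_wpM2l Kx0 h).
rewrite exprMn [k.+2%:R^-1 ^+ _]exprVn.
have -> : x^-1 ^+ k.+2 = x^-1 ^+ k * x ^- 2 by rewrite -exprVn -exprD addn2.
have -> : k.+2%:R ^+ k.+2 * x ^+ 2 * (x^-1 ^+ k * x ^- 2 * k.+2%:R ^- k.+2) =
    (k.+2%:R ^+ k.+2 / k.+2%:R ^+ k.+2) * (x ^+ 2 / x ^+ 2) * x^-1 ^+ k by ring.
by rewrite !divff ?mul1r // expf_neq0 // ?pnatr_eq0 // gt_eqF.
Qed.

Lemma is_derive_flat k (x : R) : is_derive x 1 (flat k) (flat k.+2 x - k%:R * flat k.+1 x).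
Proof.
have [x0|x0|x0] := ltgtP x 0.
- have E : \forall y \near x, 0 = flat k y.
    near=> y; rewrite /flat ifF //; apply/negbTE; rewrite -leNgt ltW //.
    by near: y; exact: lt_nbhsl.
  have -> : flat k.+2 x - k%:R * flat k.+1 x = 0.
    by rewrite /flat ltNge (ltW x0) /= mulr0 subr0.
  exact: near_eq_is_derive E (is_derive_cst 0 x 1).
- have E : \forall y \near x, (fun y : R => (y^-1) ^+ k * expR (- y^-1)) y = flat k y.
    near=> y; rewrite /flat ifT //.
    by near: y; exact: lt_nbhsr.
  apply: near_eq_is_derive E _.
  have xn : x != 0 by rewrite gt_eqF.
  have dV : is_derive x 1 (fun y : R => y^-1) (- x ^- 2).
    by have := is_deriveV (f := id) xn (is_derive_id x 1); rewrite [_ *: 1]mulr1.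
  have dE : is_derive x 1 (fun y : R => expR (- y^-1)) (expR (- x^-1) * - (- x ^- 2)).
    exact: (is_derive1_comp (f := expR) (is_derive_expR _) (is_deriveN dV)).
  have dX := is_deriveX k dV.
  have := is_deriveM dX dE.
  rewrite (_ : _ * _ = fun y : R => y^-1 ^+ k * expR (- y^-1)); last first.
    by apply/funext => y; rewrite fctE exprfctE.
  move=> H; apply: (is_derive_eq H); rewrite /GRing.scale /= exprfctE /flat x0 -!exprVn.
  by case: k {dX H} => [|k] /=; rewrite ?(mul0r, mulr0) !exprS !expr0; ring.
rewrite x0; have -> : flat k.+2 0 - k%:R * flat k.+1 0 = 0.
  by rewrite /flat ltxx mulr0 subr0.
(* By [flat_le] the difference quotient is at most a constant times |h|. *)
have H : h^-1 *: (flat k (h *: 1 + 0) - flat k 0) @[h --> (0 : R)^'] --> (0 : R).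
  apply/cvgrPdist_le => e e0; near=> h.
  rewrite sub0r normrN {2}/flat ltxx subr0 addr0 [h *: 1]mulr1 /GRing.scale /= normrM normfV.
  have h0 : h != 0 by near: h; exact: nbhs_dnbhs_neq.
  rewrite ler_pdivrMl ?normr_gt0 // ger0_norm ?flat_ge0 //.
  apply: (le_trans (flat_le _ _)).
  have c0 : 0 < k.+2%:R ^+ k.+2 :> R by rewrite exprn_gt0.
  rewrite -(real_normK (num_real h)) expr2 mulrA [leRHS]mulrC ler_wpM2r //.
  rewrite mulrC -ler_pdivlMr //; near: h; apply: dnbhs0_le.
  by rewrite divr_gt0.
apply: DeriveDef; first by apply/cvg_ex; exists 0.
exact: cvg_lim H.
Unshelve. all: by end_near. Qed.

Let base (u : R -> C) := exists k, u = (fun x => (flat k x)%:C%C) \/ u = (fun x => (flat k (1 - x))%:C%C).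

Lemma Dop_real1 (g : R -> R) (dg x v : R) : is_derive x 1 g dg ->
  cdifferentiable (fun y => (g y)%:C%C) x /\ Dop v (fun y => (g y)%:C%C) x = - 'i * v%:C%C * dg%:C%C.
Proof.
move=> H; have dgx : differentiable g x by apply/derivable1_diffP; exact: ex_derive.
split; first exact: cdifferentiable_real.
rewrite Dop_real -mulrA -rmorphM /=; congr (_ * _%:C%C).
rewrite (deriveE v dgx) -[in LHS](mulr1 v) -[v * 1]/(v *: (1 : R)) linearZ /= -(deriveE (1 : R) dgx).
by rewrite derive_val.
Qed.

Lemma flat_onem k (x : R) : is_derive x 1 (fun y : R => flat k (1 - y)) (- (flat k.+2 (1 - x) - k%:R * flat k.+1 (1 - x))).
Proof.
have := is_derive_flat k (1 - x) => d.
have d1 : is_derive x 1 (fun y : R => 1 - y) (0 - 1).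
  exact: (is_deriveB (is_derive_cst (1 : R) x (1 : R)) (is_derive_id x (1 : R))).
have H := is_derive1_comp (f := flat k) (g := fun y : R => 1 - y) d d1.
apply: (is_derive_eq H).
by rewrite sub0r mulrN1.
Qed.

(** It equals exp(- 1 / x - 1 / (1 - x)) on ]0, 1[ and 0 elsewhere. *)
Definition bump0 (x : R) : C := (flat 0 x)%:C%C * (flat 0 (1 - x))%:C%C.

Lemma csmooth_bump0 : csmooth setT bump0.
Proof.
apply: (@smooth_alg_csmooth R _ _ openT base).
- move=> u [k [->|->]] x _.
    exact: (Dop_real1 0 (is_derive_flat k x)).1.
  exact: (Dop_real1 0 (flat_onem k x)).1.
- move=> u v [k [->|->]].
    exists (fun x => - 'i * v%:C%C * ((flat k.+2 x)%:C%C + (- k%:R) * (flat k.+1 x)%:C%C)).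
      apply: SAmul; first exact: SAcst.
      apply: SAadd; first by apply: SAbase; exists k.+2; left.
      by apply: SAmul; [exact: SAcst | apply: SAbase; exists k.+1; left].
    move=> x _; rewrite (Dop_real1 v (is_derive_flat k x)).2; congr (_ * _).
    by rewrite rmorphB rmorphM /= rmorph_nat mulNr.
  exists (fun x => - 'i * v%:C%C * (-1 * ((flat k.+2 (1 - x))%:C%C + (- k%:R) * (flat k.+1 (1 - x))%:C%C))).
    apply: SAmul; first exact: SAcst.
    apply: SAmul; first exact: SAcst.
    apply: SAadd; first by apply: SAbase; exists k.+2; right.
    by apply: SAmul; [exact: SAcst | apply: SAbase; exists k.+1; right].
  move=> x _; rewrite (Dop_real1 v (flat_onem k x)).2; congr (_ * _).
  by rewrite rmorphN rmorphB rmorphM /= rmorph_nat mulN1r mulNr.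
by apply: SAmul; apply: SAbase; exists 0%N; [left|right].
Qed.

Lemma cdifferentiable_ccont (u : R -> C) x : cdifferentiable u x -> ccont u x.
Proof. by move=> [ru iu]; split; exact: differentiable_continuous. Qed.

Lemma line_cintegral_Dop (u : R -> C) A : (forall x, cdifferentiable u x) ->
  (forall x, cdifferentiable (Dop (1 : R) u) x) -> (forall x, A < `|x| -> u x = 0) ->
  line_cintegral (Dop (1 : R) u) = 0.
Proof.
move=> du ddu uA.
have key (g : R -> R) : (forall x, differentiable g x) -> continuous (fun x => 'D_1 g x) ->
    (* The 1 added to |A| makes [g] vanish at the end points themselves, where the fundamental
       theorem evaluates it. *)
    (forall x, A < `|x| -> g x = 0) -> Rintegral mu setT (fun x => 'D_1 g x) = 0.
  move=> dg cg gA; pose B := `|A| + 1.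
  have AB : A < B by rewrite /B (le_lt_trans (ler_norm A)) // ltrDl.
  have B0 : 0 < B by rewrite /B ltr_wpDl.
  have E : Rintegral mu setT (fun x => 'D_1 g x) = Rintegral mu `[- B, B] (fun x => 'D_1 g x).
    rewrite [RHS]Rintegral_mkcond; congr Rintegral; apply/funext => x.
    rewrite patchE mem_setE in_itv /= -ler_norml; case: ifPn => //; rewrite -ltNge => Bx.
    have H : \forall y \near x, g y = cst (0 : R) y.
      near=> y; rewrite gA //; near: y.
      exact: (cvgr_gt _ (@norm_continuous _ R x) _ (lt_trans AB Bx)).
    rewrite (near_eq_derive (1 : R) H) derive_cst; reflexivity.
  rewrite E /Rintegral (continuous_FTC2 (F := g)).
  - by rewrite !gA ?normrN ?gtr0_norm // sube0.
  - by rewrite gt0_cp.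
  - exact: continuous_subspaceT.
  - split; first by move=> x _; apply: diff_derivable.
      by apply: cvg_at_right_filter; apply: differentiable_continuous.
    by apply: cvg_at_left_filter; apply: differentiable_continuous.
  - by move=> x _; rewrite derive1E.
have rE x : complex.Re (Dop (1 : R) u x) = 'D_1 (fun y => complex.Im (u y)) x.
  by rewrite /Dop /cderive -complexiE ReM /=; ring.
have iE x : complex.Im (Dop (1 : R) u x) = - 'D_1 (fun y => complex.Re (u y)) x.
  by rewrite /Dop /cderive -complexiE ImM /=; ring.
have eI : @complex.Re R \o Dop (1 : R) u = fun x => 'D_1 (fun y => complex.Im (u y)) x.
  by apply/funext => x; exact: rE.
have eR : @complex.Im R \o Dop (1 : R) u = fun x => 'D_1 (fun y => - complex.Re (u y)) x.
  apply/funext => x; apply: etrans (iE x) _.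
  by rewrite deriveN //; apply: diff_derivable; exact: (du x).1.
have cI : continuous (fun x => 'D_1 (fun y => complex.Im (u y)) x).
  by rewrite -eI => x; exact: (cdifferentiable_ccont (ddu x)).1.
have cR : continuous (fun x => 'D_1 (fun y => - complex.Re (u y)) x).
  by rewrite -eR => x; exact: (cdifferentiable_ccont (ddu x)).2.
apply: eq_complexP; rewrite /=.
  rewrite -[fun x => _]/(@complex.Re R \o Dop (1 : R) u) eI; apply: key => // [x|x h].
    exact: (du x).2.
  by rewrite uA.
rewrite -[fun x => _]/(@complex.Im R \o Dop (1 : R) u) eR; apply: key => // [x|x h].
  by apply: differentiableN; exact: (du x).1.
by rewrite uA //= oppr0.
Unshelve. all: by end_near. Qed.

(* A function together with its iterated derivatives, so that the derivatives of a
   cut-off can be named by their index. *)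
Definition tower (g : nat -> R -> C) : Prop :=
  forall n x, cdifferentiable (g n) x /\ Dop (1 : R) (g n) x = g n.+1 x.

Definition bump_tower (g : nat -> R -> C) : Prop :=
  [/\ tower g, exists A, forall n x, A < `|x| -> g n x = 0 &
      forall n, line_cintegral (g n) = (n == 0%N)%:R].

(* No cut-off: the derivatives of the constant 1. *)
Definition unit_tower (n : nat) (x : R) : C := (n == 0%N)%:R.

Lemma tower_unit : tower unit_tower.
Proof.
by move=> [|n] x; split; rewrite /unit_tower /= ?Dop_cst //; exact: cdifferentiable_cst.
Qed.

Lemma tower_ccont_csupp g A : tower g -> (forall n x, A < `|x| -> g n x = 0) -> forall n, ccont_csupp (g n).
Proof.
move=> tg gA n; split; first by move=> x; apply: cdifferentiable_ccont; exact: (tg n x).1.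
by exists A => x; exact: gA.
Qed.

Let D0 n : R -> C := iter n (Dop (1 : R)) bump0.

Let D0_smooth n : csmooth setT (D0 n).
Proof. by elim: n => [|n IH]; [exact: csmooth_bump0 | exact: csmooth_Dop]. Qed.

Let D0_support n (x : R) : 1 < `|x| -> D0 n x = 0.
Proof.
elim: n x => [|n IH] x x1; rewrite /D0 /=.
  rewrite /bump0 /flat; have [x0|x0] := ltP 0 x; last by rewrite mul0r.
  by rewrite gtr0_norm // in x1; rewrite subr_gt0 [x < 1]ltNge (ltW x1) /= mulr0.
have H : \forall y \near x, D0 n y = 0.
  near=> y; rewrite IH //; near: y.
  exact: (cvgr_gt _ (@norm_continuous _ R x) _ x1).
by rewrite (near_Dop (1 : R) H) Dop_cst.
Unshelve. all: by end_near. Qed.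

Let D0_ccont_csupp n : ccont_csupp (D0 n).
Proof.
split; last by exists 1 => x; exact: D0_support.
by move=> x; apply: cdifferentiable_ccont; exact: (@D0_smooth n [::]).
Qed.

(** On [1/4, 3/4] both factors are at least exp(-4), so the integral is at least exp(-4)^2 / 2. *)
Let bump0_int_neq0 : line_cintegral bump0 != 0.
Proof.
have [iR _ _ _] := ccont_csupp_has_cintegral (D0_ccont_csupp 0); have c4 : (0 : R) < 4^-1 by [].
have fE (x : R) : 4^-1 <= x -> expR (- 4) <= flat 0 x.
  move=> x4; have x0 : 0 < x by apply: lt_le_trans x4.
  rewrite /flat x0 expr0 mul1r ler_expR lerN2 -[leRHS]invrK lef_pV2 ?posrE ?invr_gt0 //.
have m4 : measurable (`[4^-1, 3 / 4]%classic : set R) by exact: measurable_itv.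
have i1 : mu.-integrable setT (EFin \o (fun x => expR (- 4) ^+ 2 * \1_`[4^-1, 3 / 4] x)).
  by apply: integrableZR; exact: integrable_indic_itv.
have e0 := expR_gt0 (- 4 : R).
suff : 0 < complex.Re (line_cintegral bump0).
  by move=> h; apply/eqP => E; move: h; rewrite E ltxx.
have : Rintegral mu setT (fun x => expR (- 4) ^+ 2 * \1_`[4^-1, 3 / 4] x) <= complex.Re (line_cintegral bump0).
  apply: le_Rintegral => // x _; rewrite /bump0 ReM /= mulr0 subr0 indicE.
  have [xi|xi] := boolP (x \in _); last by rewrite mulr0 mulr_ge0 ?flat_ge0.
  move: xi; rewrite mem_setE in_itv /= => /andP[x1 x2].
  by rewrite mulr1 expr2 ler_pM ?expR_ge0 //; apply: fE => //; lra.
apply: lt_le_trans; rewrite RintegralZl //; last exact: integrable_indic_itv.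
rewrite mulr_gt0 ?exprn_gt0 // /Rintegral integral_indic // setIT /=.
rewrite lebesgue_measure_itv /= lte_fin ifT; last by lra.
by rewrite -EFinB /=; lra.
Qed.

Lemma exists_bump_tower : exists g, bump_tower g.
Proof.
exists (fun n x => (line_cintegral bump0)^-1 * D0 n x).
have dD n x : cdifferentiable (D0 n) x by exact: (@D0_smooth n [::]).
split.
- move=> n x; split; first exact: cdifferentiableZ.
  by rewrite DopZ.
- by exists 1 => n x h; rewrite D0_support ?mulr0.
- move=> n; rewrite (has_cintegral_line_cintegral (has_cintegralZ _ (ccont_csupp_has_cintegral (D0_ccont_csupp n)))).
  case: n => [|n]; first by rewrite (mulVf bump0_int_neq0).
  have -> : line_cintegral (D0 n.+1) = 0; last by rewrite mulr0.
  apply: (@line_cintegral_Dop (D0 n) 1) => //.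
    by move=> x; exact: (dD n.+1 x).
  by move=> x; exact: D0_support.
Qed.

End Bump.

(** * Polar coordinates along the edge *)

Section PolarDerivatives.
Variables (R : realType) (d : nat).
Local Notation pt := ('rV[R]_(2 + d)).

(** The differential is recorded through its values on all directions, so composite derivatives are
    found by computing with real expressions. *)
Definition has_diff (V : normedModType R) (h : V -> R) (x : V) (D : V -> R) : Prop :=
  differentiable h x /\ forall v, 'D_v h x = D v.

Section Calculus.
Variable V : normedModType R.
Implicit Types (h : V -> R) (x v : V) (D : V -> R).

Lemma has_diff_eq h x D D' : has_diff h x D -> D =1 D' -> has_diff h x D'.
Proof. by move=> [dh hD] DD; split => // v; rewrite hD. Qed.

Lemma has_diff_near h h' x D : (\forall y \near x, h y = h' y) -> has_diff h x D -> has_diff h' x D.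
Proof.
move=> hh [dh hD]; split; first exact: near_eq_differentiable hh dh.
by move=> v; rewrite -hD; apply/esym/near_eq_derive.
Qed.

Lemma has_diff_cst (c : R) x : has_diff (fun=> c) x (fun=> 0).
Proof. by split; [exact: differentiable_cst | move=> v; exact: derive_cst]. Qed.

Lemma has_derD h1 h2 x D1 D2 : has_diff h1 x D1 -> has_diff h2 x D2 ->
  has_diff (fun y => h1 y + h2 y) x (fun v => D1 v + D2 v).
Proof.
move=> [d1 e1] [d2 e2]; split; first exact: differentiableD.
by move=> v; rewrite -e1 -e2; apply: deriveD; exact: diff_derivable.
Qed.

Lemma has_derM h1 h2 x D1 D2 : has_diff h1 x D1 -> has_diff h2 x D2 ->
  has_diff (fun y => h1 y * h2 y) x (fun v => h1 x * D2 v + h2 x * D1 v).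
Proof.
move=> [d1 e1] [d2 e2]; split; first exact: differentiableM.
by move=> v; rewrite -e1 -e2; apply: deriveM; exact: diff_derivable.
Qed.

Lemma has_diff_comp (f : R -> R) df h x D : has_diff h x D -> is_derive (h x) 1 f df ->
  has_diff (fun y => f (h y)) x (fun v => D v * df).
Proof.
move=> [dh hD] H; have dg : differentiable f (h x) by apply/derivable1_diffP; exact: ex_derive.
split; first exact: (differentiable_comp dh dg).
move=> v; rewrite (deriveE v (differentiable_comp dh dg)) diff_comp //=.
have lin (a : R) : 'd f (h x) a = a * 'd f (h x) 1.
  by rewrite -[in LHS](mulr1 a) -[a * 1]/(a *: (1 : R)) linearZ.
by rewrite lin -(deriveE v dh) -(deriveE (1 : R) dg) hD derive_val.
Qed.

Lemma has_diff_cont h x D : has_diff h x D -> {for x, continuous h}.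
Proof. by move=> [dh _]; exact: differentiable_continuous. Qed.

End Calculus.

Lemma has_diff_coord (x : pt) i : has_diff (fun y : pt => y 0 i) x (fun v => v 0 i).
Proof.
split; first exact: differentiable_coord.
move=> v; apply: cvg_lim => //.
have E : (fun h : R => h^-1 *: ((h *: v + x) 0 i - x 0 i)) @ 0^' --> v 0 i.
  apply: (@cvg_trans _ (v 0 i @[h --> (0 : R)^'])); last exact: cvg_cst.
  apply: near_eq_cvg; near=> h; rewrite !mxE addrK /GRing.scale /= mulKf //.
  by near: h; exact: nbhs_dnbhs_neq.
exact: E.
Unshelve. all: by end_near. Qed.

Definition ypart (x : pt) : R * R := (x 0 (lshift d 0), x 0 (lshift d 1)).
Definition rho (x : pt) : R := logr (ypart x).
Definition phi (x : pt) : R := arg (ypart x).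
(** The equality r = y1 holds exactly when y2 = 0 and y1 >= 0, that is, on the edge and on phi = 0,
    where [arg] takes its default value. *)
Definition off_ray (x : pt) : Prop := radius (ypart x) != (ypart x).1.
Definition sqradius (x : pt) : R := (ypart x).1 ^+ 2 + (ypart x).2 ^+ 2.

Lemma has_diff_sqradius (x : pt) : has_diff sqradius x
  (fun v => 2 * ((ypart x).1 * (ypart v).1 + (ypart x).2 * (ypart v).2)).
Proof.
have h1 := has_diff_coord x (lshift d 0); have h2 := has_diff_coord x (lshift d 1).
apply: (has_diff_eq (has_derD (has_derM h1 h1) (has_derM h2 h2))).
by move=> v; rewrite /ypart /=; ring.
Qed.

Lemma has_diff_rho (x : pt) : 0 < sqradius x -> has_diff rho x
  (fun v => ((ypart x).1 * (ypart v).1 + (ypart x).2 * (ypart v).2) / sqradius x).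
Proof.
move=> r0; have h := has_diff_comp (has_diff_sqradius x) (is_derive1_ln r0).
apply: (has_diff_eq (has_derM h (has_diff_cst 2^-1 x))).
move=> v /=; rewrite mulr0 add0r; by field; rewrite gt_eqF.
Qed.

Lemma near_sqradius (x : pt) : 0 < sqradius x -> \forall y \near x, 0 < sqradius y.
Proof. by move=> r0; exact: (cvgr_gt _ (has_diff_cont (has_diff_sqradius x)) _ r0). Qed.

Lemma has_diff_radius (x : pt) : 0 < sqradius x -> has_diff (fun y => radius (ypart y)) x
  (fun v => ((ypart x).1 * (ypart v).1 + (ypart x).2 * (ypart v).2) / radius (ypart x)).
Proof.
move=> r0; have h := has_diff_comp (has_diff_rho r0) (is_derive_expR (rho x)).
apply: (has_diff_near (h := fun y => expR (rho y))).
  by apply: filterS (near_sqradius r0) => y y0; rewrite radius_logr.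
apply: (has_diff_eq h) => v; rewrite -(radius_logr r0).
have -> : sqradius x = radius (ypart x) ^+ 2 by rewrite sqr_sqrtr // ltW.
by field; rewrite gt_eqF // radius_gt0.
Qed.

Lemma off_ray_sqradius (x : pt) : off_ray x -> 0 < sqradius x.
Proof. by move=> /polar_arg[]. Qed.

Lemma near_off_ray (x : pt) : off_ray x -> \forall y \near x, off_ray y.
Proof.
move=> ox; have h1 := has_diff_radius (off_ray_sqradius ox).
have h2 := has_derM (has_diff_cst (- 1) x) (has_diff_coord x (lshift d 0)).
have c := has_diff_cont (has_derD h1 h2).
have n0 : radius (ypart x) + - 1 * x 0 (lshift d 0) != 0 by rewrite mulN1r subr_eq0.
have : \forall y \near x, radius (ypart y) + - 1 * y 0 (lshift d 0) != 0.
  exact: (cvgr_neq0 _ c n0).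
by apply: filterS => y; rewrite mulN1r subr_eq0.
Qed.

Lemma has_diff_phi (x : pt) : off_ray x -> has_diff phi x
  (fun v => ((ypart x).1 * (ypart v).2 - (ypart x).2 * (ypart v).1) / sqradius x).
Proof.
move=> ox; have r0 := off_ray_sqradius ox.
have hr := has_diff_radius r0.
have h1 := has_diff_coord x (lshift d 0); have h2 := has_diff_coord x (lshift d 1).
have hd := has_derD hr (has_derM (has_diff_cst (- 1) x) h1).
set q := ypart x in ox r0 hr *.
have dn : radius q + - 1 * x 0 (lshift d 0) != 0 by rewrite mulN1r subr_eq0.
have iV : is_derive (radius q + - 1 * x 0 (lshift d 0)) 1 (fun y : R => y^-1)
    (- (radius q + - 1 * x 0 (lshift d 0)) ^- 2).
  by have := is_deriveV (f := id) dn (is_derive_id (radius q + - 1 * x 0 (lshift d 0)) 1); rewrite [_ *: 1]mulr1.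
have ht := has_derM h2 (has_diff_comp hd iV).
have ha := has_diff_comp ht (is_derive1_atan _).
have hf := has_derD (has_diff_cst pi x) (has_derM (has_diff_cst (- 2) x) ha).
apply: (has_diff_near (h := fun y : pt => pi + - 2 * atan (y 0 (lshift d 1) / (radius (ypart y) + - 1 * y 0 (lshift d 0))))).
  apply: filterS (near_off_ray ox) => y oy.
  by rewrite /phi /arg (negbTE oy) mulNr mulN1r.
apply: (has_diff_eq hf) => v /=.
have rE : radius q ^+ 2 = q.1 ^+ 2 + q.2 ^+ 2 by rewrite sqr_sqrtr // ltW.
have rp : 0 < radius q by exact: radius_gt0.
rewrite /sqradius -/q -rE; rewrite -[x 0 (lshift d 0)]/q.1 -[x 0 (lshift d 1)]/q.2.
rewrite -[v 0 (lshift d 0)]/(ypart v).1 -[v 0 (lshift d 1)]/(ypart v).2.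
move: (ypart v) => w; rewrite -[x 0 (lshift d 0)]/q.1 in dn.
move: q.1 q.2 (radius q) rE rp dn => a b r rE rp dn {hr h1 h2 hd iV ht ha hf ox r0 q}.
have r1 : r - a != 0 by rewrite -mulN1r.
have bE : b ^+ 2 = r ^+ 2 - a ^+ 2 by rewrite rE; ring.
(* As b^2 = (r - a)(r + a), the sum is 1 + (r + a) / (r - a) = 2 r / (r - a). *)
have -> : (1 + (b / (r + - 1 * a)) ^+ 2)^-1 = (r - a) / (2 * r).
  have -> : 1 + (b / (r + - 1 * a)) ^+ 2 = (2 * r) / (r - a).
    by rewrite mulN1r exprMn exprVn bE; field.
  by rewrite invf_div.
rewrite mulN1r; have rn : r != 0 by rewrite gt_eqF.
transitivity (- r^-1 * (w.2 + b * w.1 / r - b ^+ 2 * w.2 / (r * (r - a)))).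
  by field; rewrite r1 rn.
by rewrite bE; field; rewrite r1 rn.
Qed.

Definition polar_dom (O : set R) : set pt := [set x | off_ray x /\ O (phi x)].

Lemma open_polar_dom (O : set R) : open O -> open (polar_dom O).
Proof.
move=> oO; rewrite openE => x [ox Ox].
have cx := has_diff_cont (has_diff_phi ox).
have : \forall y \near x, O (phi y) by apply: cx; exact: open_nbhs_nbhs.
by apply: filterS2 (near_off_ray ox) => y.
Qed.

End PolarDerivatives.

(** * Operators on separated functions *)

Section ComplexExponential.
Variable R : realType.
Local Notation C := R[i].

Lemma cexpD (z w : C) : cexp (z + w) = cexp z * cexp w.
Proof.
by apply: eq_complexP; rewrite /cexp !(ReD, ImD, ReM, ImM) /= expRD ?cosD ?sinD; [ring|ring].
Qed.

Lemma cexp0 : cexp (0 : C) = 1.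
Proof. by rewrite /cexp /= expR0 cos0 sin0 mulr1 mulr0. Qed.

Lemma cexp_real (x : R) : cexp x%:C%C = (expR x)%:C%C.
Proof. by rewrite /cexp /= cos0 sin0 mulr1 mulr0. Qed.

Lemma cexp_conj (z : C) : (cexp z)^* = cexp z^*.
Proof. by case: z => a b; rewrite /cexp /= sinN cosN mulrN. Qed.

Lemma Dop_cexp (c : C) (x : R) :
  cdifferentiable (fun t : R => cexp (c * t%:C%C)) x /\
  Dop (1 : R) (fun t : R => cexp (c * t%:C%C)) x = - 'i * c * cexp (c * x%:C%C).
Proof.
case: c => a b.
have hx : has_diff (id : R -> R) x id.
  by split; [apply/derivable1_diffP; exact: derivable_id | move=> v; exact: derive_id].
have hs (k : R) : has_diff (fun t : R => k * t) x (fun v => k * v).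
  apply: (has_diff_eq (has_derM (has_diff_cst k x) hx)) => v /=; ring.
have he := has_diff_comp (hs a) (is_derive_expR _).
have hc := has_diff_comp (hs b) (is_derive_cos _).
have hn := has_diff_comp (hs b) (is_derive_sin _).
have hR := has_derM he hc; have hI := has_derM he hn.
have rE : (fun t : R => complex.Re (cexp ((a +i* b)%C * t%:C%C))) = (fun t => expR (a * t) * cos (b * t)).
  by apply/funext => t; rewrite /cexp /= !(mulr0, subr0, add0r).
have iE : (fun t : R => complex.Im (cexp ((a +i* b)%C * t%:C%C))) = (fun t => expR (a * t) * sin (b * t)).
  by apply/funext => t; rewrite /cexp /= !(mulr0, subr0, add0r).
split; first by split; rewrite ?rE ?iE; [exact: hR.1|exact: hI.1].
rewrite /Dop /cderive rE iE hR.2 hI.2 -complexiE.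
apply: eq_complexP; rewrite /cexp !(ReM, ImM) /= !(mulr0, subr0, add0r, mulr1).
  by ring.
by ring.
Qed.

End ComplexExponential.

Section Terms.
Variables (R : realType) (d : nat).
Local Notation C := R[i].
Local Notation pt := ('rV[R]_(2 + d)).
Variables (lambda : C) (g : nat -> R -> C) (O : set R).
Hypotheses (tg : tower g) (oO : open O).

(* The function r^(i lambda - k) g_n(ln r) b(phi) \prod_i g_(alpha i)(z_i). *)
Record term := Term { pw : nat; tn : nat; ta : 'I_d -> nat; tb : R -> C }.

Definition radial (k n : nat) (t : R) : C := cexp (('i * lambda - k%:R) * t%:C%C) * g n t.

Definition axial (a : 'I_d -> nat) (x : pt) : C := \prod_(i < d) g (a i) (x 0 (rshift 2 i)).

Definition eval_term (t : term) (x : pt) : C :=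
  radial (pw t) (tn t) (rho x) * tb t (phi x) * axial (ta t) x.

Definition eval_terms (L : seq term) (x : pt) : C := \sum_(t <- L) eval_term t x.

Definition pdy1 := polar1 id (fun w (p : R) => lambda * w p) (Dop (1 : R)).
Definition pdy2 := polar2 id (fun w (p : R) => lambda * w p) (Dop (1 : R)).

(** In D_y1 = r^-1 (cos phi r D_r - sin phi D_phi), the operator r D_r multiplies r^(i lambda - k)
    by lambda + i k, which together with D_phi gives the first term; acting on g_n(ln r) it gives
    the second. *)
Definition dy1 (t : term) : seq term :=
  [:: Term (pw t).+1 (tn t) (ta t) (pdy1 (pw t) (tb t));
      Term (pw t).+1 (tn t).+1 (ta t) (fun p => (cos p)%:C%C * tb t p)].
Definition dy2 (t : term) : seq term :=
  [:: Term (pw t).+1 (tn t) (ta t) (pdy2 (pw t) (tb t));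
      Term (pw t).+1 (tn t).+1 (ta t) (fun p => (sin p)%:C%C * tb t p)].
Definition dz (j : 'I_d) (t : term) : term :=
  Term (pw t) (tn t) (fun i => ta t i + (i == j))%N (tb t).

Definition smooth (t : term) := csmooth O (tb t).

Local Notation dom := (@polar_dom R d O).
Local Notation e0 := (delta_mx 0 (lshift d 0) : pt).
Local Notation e1 := (delta_mx 0 (lshift d 1) : pt).
Local Notation ez j := (delta_mx 0 (rshift 2 j) : pt).

Lemma radial_der k n t : cdifferentiable (radial k n) t /\
  Dop (1 : R) (radial k n) t = (lambda + 'i * k%:R) * radial k n t + radial k n.+1 t.
Proof.
have [d1 D1] := Dop_cexp ('i * lambda - k%:R) t; have [d2 D2] := tg n t.
split; first exact: cdifferentiableM.
rewrite DopM // D1 D2 /radial.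
have ii : - 'i * ('i * lambda - k%:R) = lambda + 'i * k%:R :> C.
  by rewrite mulrBr mulrA mulNr -expr2 sqrCi opprK mul1r mulNr opprK.
by rewrite ii; ring.
Qed.

Lemma coord_delta (i j : 'I_(2 + d)) : (delta_mx 0 i : pt) 0 j = (j == i)%:R.
Proof. by rewrite mxE. Qed.

Lemma axial_der a (x : pt) (v : pt) : cdifferentiable (axial a) x /\
  Dop v (axial a) x = \sum_(j < d) (v 0 (rshift 2 j))%:C%C * axial (fun i => a i + (i == j))%N x.
Proof.
(* Without repetitions z_i occurs in a single factor, so differentiating that factor leaves the
   others unchanged. *)
have key (s : seq 'I_d) : uniq s ->
    cdifferentiable (fun y : pt => \prod_(i <- s) g (a i) (y 0 (rshift 2 i))) x /\
    Dop v (fun y : pt => \prod_(i <- s) g (a i) (y 0 (rshift 2 i))) x =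
    \sum_(j <- s) (v 0 (rshift 2 j))%:C%C * \prod_(i <- s) g (a i + (i == j)) (x 0 (rshift 2 i)).
  elim: s => [_|i s IH /= /andP[si us]].
    rewrite (_ : (fun y : pt => _) = fun=> 1); last by apply/funext => y; rewrite big_nil.
    by rewrite big_nil Dop_cst; split => //; exact: cdifferentiable_cst.
  rewrite (_ : (fun y : pt => _) = fun y => g (a i) (y 0 (rshift 2 i)) * \prod_(i <- s) g (a i) (y 0 (rshift 2 i))); last first.
    by apply/funext => y; rewrite big_cons.
  have [ds Ds] := IH us.
  have [hd hD] := has_diff_coord x (rshift 2 i).
  have [d1 D1] := Dop_chain v hd (tg (a i) (x 0 (rshift 2 i))).1.
  split; first exact: cdifferentiableM.
  rewrite (DopM v d1 ds) D1 Ds hD (tg _ _).2 !big_cons eqxx addn1 mulr_sumr; congr (_ + _).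
    rewrite -mulrA; congr (_ * (_ * _)); apply: eq_big_seq => k ks.
    by rewrite (_ : (k == i) = false) ?addn0 //; apply: contraNF si => /eqP <-.
  apply: eq_big_seq => j js; rewrite big_cons (_ : (i == j) = false) ?addn0; last first.
    by apply: contraNF si => /eqP ->.
  by rewrite mulrCA.
exact: (key _ (index_enum_uniq _)).
Qed.

Lemma has_diff_rho_dom (x : pt) : dom x -> has_diff (@rho R d) x
  (fun v => expR (- rho x) * (cos (phi x) * (ypart v).1 + sin (phi x) * (ypart v).2)).
Proof.
move=> [ox _]; have r0 := off_ray_sqradius ox; apply: (has_diff_eq (has_diff_rho r0)) => v.
have rp := radius_gt0 r0.
have [_ E] := polar_arg ox; rewrite expRN -(radius_logr r0).
have -> : sqradius x = radius (ypart x) ^+ 2 by rewrite sqr_sqrtr // ltW.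
rewrite {1 2}E /polar /= -/(phi x); by field; rewrite gt_eqF.
Qed.

Lemma has_diff_phi_dom (x : pt) : dom x -> has_diff (@phi R d) x
  (fun v => expR (- rho x) * (cos (phi x) * (ypart v).2 - sin (phi x) * (ypart v).1)).
Proof.
move=> [ox _]; have r0 := off_ray_sqradius ox; apply: (has_diff_eq (has_diff_phi ox)) => v.
have rp := radius_gt0 r0.
have [_ E] := polar_arg ox; rewrite expRN -(radius_logr r0).
have -> : sqradius x = radius (ypart x) ^+ 2 by rewrite sqr_sqrtr // ltW.
rewrite {1 2}E /polar /= -/(phi x); by field; rewrite gt_eqF.
Qed.

Lemma eval_term_der t (x v : pt) : smooth t -> dom x -> cdifferentiable (eval_term t) x /\
  Dop v (eval_term t) x =
  ('D_v (@rho R d) x)%:C%C * ((lambda + 'i * (pw t)%:R) * radial (pw t) (tn t) (rho x) + radial (pw t) (tn t).+1 (rho x))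
     * tb t (phi x) * axial (ta t) x
  + ('D_v (@phi R d) x)%:C%C * radial (pw t) (tn t) (rho x) * Dop (1 : R) (tb t) (phi x) * axial (ta t) x
  + \sum_(j < d) (v 0 (rshift 2 j))%:C%C * eval_term (dz j t) x.
Proof.
move=> st Dx; have [d1 D1] := radial_der (pw t) (tn t) (rho x).
have d2 : cdifferentiable (tb t) (phi x) by exact: (st [::] _ Dx.2).
have [d3 D3] := Dop_chain v (has_diff_rho_dom Dx).1 d1.
have [d4 D4] := Dop_chain v (has_diff_phi_dom Dx).1 d2.
have [d5 D5] := axial_der (ta t) x v.
have d6 := cdifferentiableM d3 d4.
split; first exact: (cdifferentiableM d6 d5).
rewrite [LHS](DopM v d6 d5) (DopM v d3 d4) D3 D4 D5 D1 /= mulr_sumr mulrDl; congr (_ + _ + _).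
- by ring.
- by rewrite /eval_term /=; apply: eq_bigr => j _; rewrite mulrCA.
Qed.

End Terms.

(** * Action of a homogeneous operator on a separated function *)

Section OperatorOnTerms.
Variables (R : realType) (d : nat).
Local Notation C := R[i].
Local Notation pt := ('rV[R]_(2 + d)).
Variables (lambda : C) (g : nat -> R -> C) (O : set R).
Hypotheses (tg : tower g) (oO : open O).
Local Notation dom := (@polar_dom R d O).
Local Notation e0 := (delta_mx 0 (lshift d 0) : pt).
Local Notation e1 := (delta_mx 0 (lshift d 1) : pt).
Local Notation ez j := (delta_mx 0 (rshift 2 j) : pt).
Local Notation eval_term := (@eval_term R d lambda g).
Local Notation eval_terms := (@eval_terms R d lambda g).
Local Notation smooth := (@smooth R d O).
Local Notation p1 := (@pdy1 R lambda).
Local Notation p2 := (@pdy2 R lambda).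

Fixpoint Forall_seq (T : Type) (P : T -> Prop) (s : seq T) : Prop :=
  if s is t :: s' then P t /\ Forall_seq P s' else True.

Lemma Forall_cat (T : Type) (P : T -> Prop) s s' : Forall_seq P s -> Forall_seq P s' -> Forall_seq P (s ++ s').
Proof. by elim: s => //= t s IH [Pt Ps] Ps'; split => //; exact: IH. Qed.

Lemma Forall_flatten_map (T : Type) (P Q : T -> Prop) (f : T -> seq T) s :
  (forall t, P t -> Forall_seq Q (f t)) -> Forall_seq P s -> Forall_seq Q (flatten (map f s)).
Proof. by move=> PQ; elim: s => //= t s IH [/PQ Pt Ps]; apply: Forall_cat => //; exact: IH. Qed.

Lemma eval_terms_cat L L' x : eval_terms (L ++ L') x = eval_terms L x + eval_terms L' x.
Proof. by rewrite /eval_terms big_cat. Qed.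

Lemma radialS k n t : radial lambda g k.+1 n t = (expR (- t))%:C%C * radial lambda g k n t.
Proof.
rewrite /radial -cexp_real mulrA -cexpD; congr (cexp _ * _).
by rewrite rmorphN /= -natr1; ring.
Qed.

Lemma csmooth_trig : csmooth O (fun p => (cos p)%:C%C) /\ csmooth O (fun p => (sin p)%:C%C).
Proof.
pose base (u : R -> C) := u = (fun p => (cos p)%:C%C) \/ u = (fun p => (sin p)%:C%C).
have key u : smooth_alg base u -> csmooth O u.
  apply: smooth_alg_csmooth => //.
    move=> w [->|->] x _.
      exact: (Dop_real1 0 (is_derive_cos x)).1.
    exact: (Dop_real1 0 (is_derive_sin x)).1.
  move=> w v [->|->].
    exists (fun p => (- 'i * v%:C%C * -1) * (sin p)%:C%C).
      by apply: SAmul; [exact: SAcst | apply: SAbase; right].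
    by move=> x _; rewrite (Dop_real1 v (is_derive_cos x)).2 rmorphN; ring.
  exists (fun p => (- 'i * v%:C%C) * (cos p)%:C%C).
    by apply: SAmul; [exact: SAcst | apply: SAbase; left].
  by move=> x _; rewrite (Dop_real1 v (is_derive_sin x)).2.
by split; apply: key; apply: SAbase; [left|right].
Qed.

Lemma csmoothZ (c : C) (b : R -> C) : csmooth O b -> csmooth O (fun p => c * b p).
Proof. by move=> sb; apply: csmoothM => //; exact: csmooth_cst. Qed.

Lemma csmooth_p1 k b : csmooth O b -> csmooth O (p1 k b).
Proof.
move=> sb; have [sc ss] := csmooth_trig.
have -> : p1 k b = fun p => (cos p)%:C%C * (lambda * b p + 'i * k%:R * b p) + (- 1) * ((sin p)%:C%C * Dop (1 : R) b p).
  by apply/funext => p; rewrite mulN1r.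
apply: csmoothD => //; first by apply: csmoothM => //; apply: csmoothD => //; exact: csmoothZ.
by apply: csmoothZ; apply: csmoothM => //; exact: csmooth_Dop.
Qed.

Lemma csmooth_p2 k b : csmooth O b -> csmooth O (p2 k b).
Proof.
move=> sb; have [sc ss] := csmooth_trig.
have -> : p2 k b = fun p => (sin p)%:C%C * (lambda * b p + 'i * k%:R * b p) + (cos p)%:C%C * Dop (1 : R) b p by [].
apply: csmoothD => //; first by apply: csmoothM => //; apply: csmoothD => //; exact: csmoothZ.
by apply: csmoothM => //; exact: csmooth_Dop.
Qed.

Lemma smooth_dy1 t : smooth t -> Forall_seq smooth (dy1 lambda t).
Proof.
move=> st; split; first exact: csmooth_p1.
by split => //; apply: csmoothM => //; exact: csmooth_trig.1.
Qed.

Lemma smooth_dy2 t : smooth t -> Forall_seq smooth (dy2 lambda t).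
Proof.
move=> st; split; first exact: csmooth_p2.
by split => //; apply: csmoothM => //; exact: csmooth_trig.2.
Qed.

Lemma Dop_eval_term_y1 t x : smooth t -> dom x -> Dop e0 (eval_term t) x = eval_terms (dy1 lambda t) x.
Proof.
move=> st Dx; rewrite (eval_term_der lambda tg e0 st Dx).2 (has_diff_rho_dom Dx).2 (has_diff_phi_dom Dx).2.
rewrite big1 => [|j _]; last by rewrite coord_delta eq_rlshift mul0r.
rewrite /ypart !coord_delta eqxx eq_lshift /= addr0 /eval_terms !big_cons big_nil /eval_term /= !radialS.
rewrite /pdy1 /polar1 /= !(rmorphM, rmorphB, rmorphD, rmorph0, rmorph1) /=.
by ring.
Qed.

Lemma Dop_eval_term_y2 t x : smooth t -> dom x -> Dop e1 (eval_term t) x = eval_terms (dy2 lambda t) x.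
Proof.
move=> st Dx; rewrite (eval_term_der lambda tg e1 st Dx).2 (has_diff_rho_dom Dx).2 (has_diff_phi_dom Dx).2.
rewrite big1 => [|j _]; last by rewrite coord_delta eq_rlshift mul0r.
rewrite /ypart !coord_delta eqxx eq_lshift /= addr0 /eval_terms !big_cons big_nil /eval_term /= !radialS.
rewrite /pdy2 /polar2 /= !(rmorphM, rmorphB, rmorphD, rmorph0, rmorph1) /=.
by ring.
Qed.

Lemma Dop_eval_term_z j t x : smooth t -> dom x -> Dop (ez j) (eval_term t) x = eval_term (dz j t) x.
Proof.
move=> st Dx; rewrite (eval_term_der lambda tg (ez j) st Dx).2 (has_diff_rho_dom Dx).2 (has_diff_phi_dom Dx).2.
rewrite /ypart !coord_delta !eq_lrshift !mulr0 !subr0 !addr0 !mulr0 !rmorph0 !mul0r !add0r.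
rewrite (bigD1 j) //= coord_delta eqxx mul1r big1 ?addr0 // => i ij.
by rewrite coord_delta eq_rshift (negbTE ij) mul0r.
Qed.

Lemma cdifferentiable_eval_terms L x : Forall_seq smooth L -> dom x -> cdifferentiable (eval_terms L) x.
Proof.
move=> sL Dx; elim: L sL => [_|t L IH /= [st sL]].
  rewrite (_ : eval_terms [::] = fun=> 0); first exact: cdifferentiable_cst.
  by apply/funext => y; rewrite /eval_terms big_nil.
rewrite (_ : eval_terms (t :: L) = fun y => eval_term t y + eval_terms L y); last by apply/funext => y; rewrite /eval_terms big_cons.
by apply: cdifferentiableD; [exact: (eval_term_der lambda tg 0 st Dx).1 | exact: IH].
Qed.

Let near_dom (u w : pt -> C) x : dom x -> (forall y, dom y -> u y = w y) -> \forall y \near x, u y = w y.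
Proof. by move=> Dx uw; apply: filterS uw _; apply: open_nbhs_nbhs; split => //; exact: open_polar_dom. Qed.

Lemma Dop_eval_terms (v : pt) (D : term R d -> seq (term R d)) L x :
  (forall t x, smooth t -> dom x -> Dop v (eval_term t) x = eval_terms (D t) x) ->
  Forall_seq smooth L -> dom x -> Dop v (eval_terms L) x = eval_terms (flatten (map D L)) x.
Proof.
move=> DD sL Dx; elim: L sL => [_|t L IH /= [st sL]].
  rewrite (_ : eval_terms [::] = fun=> 0); last by apply/funext => y; rewrite /eval_terms big_nil.
  by rewrite Dop_cst.
rewrite (_ : eval_terms (t :: L) = fun y => eval_term t y + eval_terms L y); last by apply/funext => y; rewrite /eval_terms big_cons.
rewrite (DopD v (eval_term_der lambda tg 0 st Dx).1 (cdifferentiable_eval_terms sL Dx)) DD // IH //.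
by rewrite eval_terms_cat.
Qed.

(* Applying D_y1 or D_y2 raises k and leaves a single term in which the radial
   cut-off is not differentiated. *)
Definition represented (u : pt -> C) (k : nat) (a : 'I_d -> nat) (b : R -> C) : Prop :=
  csmooth O b /\ exists rest, [/\ Forall_seq smooth rest,
    Forall_seq (fun t => [/\ pw t = k, ta t = a & (0 < tn t)%N]) rest &
    forall x, dom x -> u x = eval_term (Term k 0 a b) x + eval_terms rest x].

Lemma represented_y1 u k a b : represented u k a b -> represented (Dop e0 u) k.+1 a (p1 k b).
Proof.
move=> [sb [L [sL hL uE]]]; split; first exact: csmooth_p1.
have st : smooth (Term k 0 a b) by [].
(* The part of the leading term in which D_y1 hits the cut-off joins the remainder; the terms
   already there keep a differentiated cut-off. *)
exists (Term k.+1 1 a (fun p => (cos p)%:C%C * b p) :: flatten (map (dy1 lambda) L)); split => /=.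
- split; first by have [_ []] := smooth_dy1 st.
  exact: Forall_flatten_map smooth_dy1 sL.
- split => //; apply: Forall_flatten_map hL => t [tk ta_ tn_] /=.
  by rewrite tk.
- move=> x Dx; rewrite (near_Dop e0 (near_dom Dx uE)).
  rewrite (DopD e0 (eval_term_der lambda tg 0 st Dx).1 (cdifferentiable_eval_terms sL Dx)) Dop_eval_term_y1 //.
  rewrite (Dop_eval_terms Dop_eval_term_y1) // /eval_terms !big_cons big_nil addr0 -addrA.
  by [].
Qed.

Lemma represented_y2 u k a b : represented u k a b -> represented (Dop e1 u) k.+1 a (p2 k b).
Proof.
move=> [sb [L [sL hL uE]]]; split; first exact: csmooth_p2.
have st : smooth (Term k 0 a b) by [].
exists (Term k.+1 1 a (fun p => (sin p)%:C%C * b p) :: flatten (map (dy2 lambda) L)); split => /=.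
- split; first by have [_ []] := smooth_dy2 st.
  exact: Forall_flatten_map smooth_dy2 sL.
- split => //; apply: Forall_flatten_map hL => t [tk ta_ tn_] /=.
  by rewrite tk.
- move=> x Dx; rewrite (near_Dop e1 (near_dom Dx uE)).
  rewrite (DopD e1 (eval_term_der lambda tg 0 st Dx).1 (cdifferentiable_eval_terms sL Dx)) Dop_eval_term_y2 //.
  rewrite (Dop_eval_terms Dop_eval_term_y2) // /eval_terms !big_cons big_nil addr0 -addrA.
  by [].
Qed.

Definition separated (b : R -> C) : pt -> C := eval_term (Term 0 0 (fun=> 0%N) b).

Let zmon (a : multinom (2 + d)) (s : seq 'I_d) (u : pt -> C) : pt -> C :=
  foldr (fun (i : 'I_d) f => iter (a (rshift 2 i)) (Dop (ez i)) f) u s.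

(** Multiplicities make the statement provable by induction on the list; in the enumeration of the
    indices each of them is 1. *)
Let zmonE a s b : csmooth O b -> forall x, dom x ->
  zmon a s (separated b) x = eval_term (Term 0 0 (fun i => count_mem i s * a (rshift 2 i))%N b) x.
Proof.
move=> sb; elim: s => [|j s IH] x Dx //=.
have key m y : dom y -> iter m (Dop (ez j)) (zmon a s (separated b)) y =
    eval_term (Term 0 0 (fun i => (i == j) * m + count_mem i s * a (rshift 2 i))%N b) y.
  elim: m y => [|m IHm] y Dy /=.
    rewrite IH //; congr (eval_term (Term _ _ _ _) _).
    by apply/funext => i; rewrite muln0.
  rewrite (near_Dop _ (near_dom Dy IHm)) Dop_eval_term_z //; congr (eval_term (Term _ _ _ _) _).
  by apply/funext => i /=; rewrite mulnS addnC addnA.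
rewrite key //; congr (eval_term (Term _ _ _ _) _); apply/funext => i.
rewrite mulnDl eq_sym; congr (_ + _)%N.
by case: eqP => [->|_] //; rewrite !mul0n.
Qed.

Let DmonE (a : multinom (2 + d)) (u : pt -> C) :
  Dmon a u = iter (a (lshift d 0)) (@Dop R pt e0) (iter (a (lshift d 1)) (@Dop R pt e1) (zmon a (enum 'I_d) u)).
Proof.
rewrite /Dmon (@enum_ordSl (1 + d)) /= (@enum_ordSl d) /=.
have -> : ord0 = lshift d 0 :> 'I_(2 + d) by exact/val_inj.
have -> : lift (lshift d 0 : 'I_(2 + d)) (ord0 : 'I_(1 + d)) = lshift d 1 :> 'I_(2 + d) by exact/val_inj.
congr (iter _ _ (iter _ _ _)).
rewrite -map_comp foldr_map /zmon; elim: (enum _) => //= i s ->.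
by have -> : lift (lshift d 0 : 'I_(2 + d)) (lift (ord0 : 'I_(1 + d)) i) = rshift 2 i by exact/val_inj.
Qed.

Local Notation pmon := (polar_mon id (fun w (p : R) => lambda * w p) (Dop (1 : R))).

Lemma represented_Dmon (a : multinom (2 + d)) b : csmooth O b ->
  represented (Dmon a (separated b)) (a (lshift d 0) + a (lshift d 1)) (fun i => a (rshift 2 i))
    (pmon (a (lshift d 0)) (a (lshift d 1)) b).
Proof.
move=> sb; rewrite DmonE.
have r0 : represented (zmon a (enum 'I_d) (separated b)) 0 (fun i => a (rshift 2 i)) b.
  split => //; exists [::]; split => // x Dx.
  rewrite zmonE // /eval_terms big_nil addr0; congr (eval_term (Term _ _ _ _) _).
  by apply/funext => i; rewrite count_uniq_mem ?enum_uniq // mem_enum mul1n.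
have r2 m : represented (iter m (Dop e1) (zmon a (enum 'I_d) (separated b))) m (fun i => a (rshift 2 i)) (pmon 0 m b).
  by elim: m => //= m IH; exact: represented_y2.
elim: (a (lshift d 0)) => [|m IH] //=.
exact: represented_y1.
Qed.

(* The terms with vanishing integrals: the integrand has a factor g_n with
   n > 0, in some z_i or in ln r; in the latter case the power of r must be the
   one which cancels. *)
Definition vanishing_term (kappa : nat) (t : term R d) : Prop :=
  (exists i, ta t i != 0%N) \/ ((0 < tn t)%N /\ pw t = kappa).

Definition scale (c : C) (t : term R d) : term R d := Term (pw t) (tn t) (ta t) (fun p => c * tb t p).

Lemma eval_terms_scale c L x : c * eval_terms L x = eval_terms (map (scale c) L) x.
Proof.
rewrite /eval_terms mulr_sumr big_map; apply: eq_bigr => t _; rewrite /eval_term /=; ring.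
Qed.

Lemma Forall_map (T T' : Type) (P : T' -> Prop) (Q : T -> Prop) (f : T -> T') s :
  (forall t, Q t -> P (f t)) -> Forall_seq Q s -> Forall_seq P (map f s).
Proof. by move=> QP; elim: s => //= t s IH [/QP Pt Ps]; split => //; exact: IH. Qed.

(** A monomial containing some D_z differentiates a cut-off in z, so all its terms are of the first
    vanishing kind. One without D_z has full order kappa in y: its leading term carries r^(i lambda
    - kappa) and contributes to [tilde A], and the others have that same power and a differentiated
    radial cut-off. *)
Lemma opD_represented (kappa : nat) (A : symbol R (2 + d)) b : homogeneous kappa A -> csmooth O b ->
  csmooth O (tilde A lambda b) /\
  exists L, [/\ Forall_seq smooth L, Forall_seq (vanishing_term kappa) L &
    forall x, dom x -> opD A (separated b) x = eval_term (Term kappa 0 (fun=> 0%N) (tilde A lambda b)) x + eval_terms L x].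
Proof.
move=> /dhomogP hA sb.
pose pure (a : multinom (2 + d)) := [forall i : 'I_d, a (rshift 2 i) == 0%N].
pose F (s : seq (multinom (2 + d))) (p : R) : C :=
  \sum_(a <- s | pure a) mcoeff a A * pmon (a (lshift d 0)) (a (lshift d 1)) b p.
have key (s : seq (multinom (2 + d))) : (forall a, a \in s -> mdeg a = kappa) ->
    csmooth O (F s) /\
    exists L, [/\ Forall_seq smooth L, Forall_seq (vanishing_term kappa) L &
    forall x, dom x -> \sum_(a <- s) mcoeff a A * Dmon a (separated b) x =
      eval_term (Term kappa 0 (fun=> 0%N) (F s)) x
      + eval_terms L x].
  elim: s => [_|a s IH hs].
    rewrite (_ : F [::] = fun=> 0); last by apply/funext => p; rewrite /F big_nil.
    split; first exact: csmooth_cst.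
    by exists [::]; split => // x Dx; rewrite big_nil /eval_terms big_nil /eval_term /= !(mulr0, mul0r, addr0).
  have [|ss [L [sL bL EL]]] := IH; first by move=> a' a's; apply: hs; rewrite inE a's orbT.
  have [sm [M [sM hM EM]]] := represented_Dmon a sb.
  have [pa|npa] := boolP (pure a).
    have a0 : (fun i => a (rshift 2 i)) = (fun=> 0%N).
      by apply/funext => i; apply/eqP; exact: (forallP pa).
    have ak : (a (lshift d 0%R) + a (lshift d 1%R))%N = kappa.
      have <- := hs a (mem_head _ _); rewrite mdegE big_split_ord /=.
      rewrite (big1 _ (fun i : 'I_d => true)) ?addn0; last by move=> i _; apply/eqP/(forallP pa).
      by rewrite big_ord_recl big_ord1; congr (a _ + a _)%N; exact/val_inj.
    rewrite (_ : F (a :: s) = fun p => mcoeff a A * pmon (a (lshift d 0)) (a (lshift d 1)) b p + F s p); last first.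
      by apply/funext => p; rewrite /F big_cons pa.
    split; first by apply: csmoothD => //; exact: csmoothZ.
    exists (map (scale (mcoeff a A)) M ++ L); split.
    - by apply: Forall_cat => //; apply: Forall_map sM => t; exact: csmoothZ.
    - apply: Forall_cat => //; apply: Forall_map hM => t [tk _ t0]; right.
      by rewrite /= t0 tk.
    - move=> x Dx; rewrite big_cons EL // EM // eval_terms_cat -eval_terms_scale a0 ak /eval_term /=; ring.
  rewrite (_ : F (a :: s) = F s); last by apply/funext => p; rewrite /F big_cons (negbTE npa).
  split => //; move: npa; rewrite negb_forall => /existsP[i ai].
  exists (scale (mcoeff a A) (Term (a (lshift d 0) + a (lshift d 1)) 0 (fun i => a (rshift 2 i))
     (pmon (a (lshift d 0)) (a (lshift d 1)) b)) :: map (scale (mcoeff a A)) M ++ L); split.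
  - split; first exact: csmoothZ.
    by apply: Forall_cat => //; apply: Forall_map sM => t; exact: csmoothZ.
  - split; first by left; exists i.
    apply: Forall_cat => //; apply: Forall_map hM => t [_ ta_ _]; left; exists i.
    by rewrite /= ta_.
  - move=> x Dx; rewrite big_cons EL // EM // -cat_cons eval_terms_cat -map_cons -eval_terms_scale /eval_terms big_cons; ring.
have [|ss [L [sL bL EL]]] := key (msupp A); first by move=> a /hA.
by split => //; exists L; split => // x Dx; rewrite /opD EL.
Qed.

End OperatorOnTerms.

(** * Smoothness, domain and support of the separated functions *)

Section SeparatedFunctions.
Variables (R : realType) (d : nat).
Local Notation C := R[i].
Local Notation pt := ('rV[R]_(2 + d)).
Variables (lambda : C) (g : nat -> R -> C) (O : set R).
Hypotheses (tg : tower g) (oO : open O).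
Local Notation dom := (@polar_dom R d O).

(** A derivative in any direction is a combination of those in the coordinate directions, and these
    send terms to sums of terms; the algebra generated by the terms is therefore stable. *)
Lemma csmooth_eval_term (t : term R d) : smooth O t -> csmooth dom (eval_term lambda g t).
Proof.
pose B (u : pt -> C) := exists2 s : term R d, smooth O s & u = eval_term lambda g s.
have Bsum (I : Type) (s : seq I) (F : I -> pt -> C) : (forall i, smooth_alg B (F i)) ->
    smooth_alg B (fun x => \sum_(i <- s) F i x).
  move=> hF; elim: s => [|i s IH].
    by rewrite (_ : (fun x : pt => _) = fun=> 0); [exact: SAcst | apply/funext => x; rewrite big_nil].
  rewrite (_ : (fun x : pt => _) = fun x => F i x + \sum_(i <- s) F i x); first exact: SAadd.
  by apply/funext => x; rewrite big_cons.
have Bevs L : Forall_seq (smooth O) L -> smooth_alg B (eval_terms lambda g L).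
  elim: L => [_|s L IH /= [ss sL]].
    by rewrite (_ : eval_terms _ _ _ = fun=> 0); [exact: SAcst | apply/funext => x; rewrite /eval_terms big_nil].
  rewrite (_ : eval_terms _ _ _ = fun x => eval_term lambda g s x + eval_terms lambda g L x).
    by apply: SAadd; [apply: SAbase; exists s | exact: IH].
  by apply/funext => x; rewrite /eval_terms big_cons.
move=> st; apply: (@smooth_alg_csmooth R _ dom _ B).
- exact: open_polar_dom.
- by move=> u [s ss ->] x Dx; exact: (eval_term_der lambda tg 0 ss Dx).1.
- move=> u v [s ss ->].
  exists (fun x => (v 0 (lshift d 0))%:C%C * eval_terms lambda g (dy1 lambda s) x
      + (v 0 (lshift d 1))%:C%C * eval_terms lambda g (dy2 lambda s) x
      + \sum_(j < d) (v 0 (rshift 2 j))%:C%C * eval_term lambda g (dz j s) x).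
    apply: SAadd; first apply: SAadd.
    + by apply: SAmul; [exact: SAcst | apply: Bevs; exact: smooth_dy1].
    + by apply: SAmul; [exact: SAcst | apply: Bevs; exact: smooth_dy2].
    + by apply: Bsum => j; apply: SAmul; [exact: SAcst | apply: SAbase; exists (dz j s)].
  move=> x Dx; rewrite -(Dop_eval_term_y1 lambda tg ss Dx) -(Dop_eval_term_y2 lambda tg ss Dx).
  rewrite {1}[v]row_sum_delta (Dop_sum (fun j => v 0 j) (fun j => delta_mx 0 j : pt) (eval_term_der lambda tg 0 ss Dx).1).
  rewrite big_split_ord /= !big_ord_recl big_ord0 addr0.
  rewrite (_ : lift ord0 ord0 = 1 :> 'I_2); last exact/val_inj.
  by congr (_ + _); apply: eq_bigr => j _; rewrite (Dop_eval_term_z lambda tg j ss Dx).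
- by apply: SAbase; exists t.
Qed.

Lemma ypart_cyl r (p : R) (z : 'rV[R]_d) : ypart (cyl r p z) = polar r p.
Proof.
rewrite /ypart /polar /cyl; congr pair; rewrite !mxE.
  by rewrite (unsplitK (inl _)) mxE.
by rewrite (unsplitK (inl _)) mxE.
Qed.

Lemma cyl_coord r (p : R) (z : 'rV[R]_d) : 0 < r -> 0 < p < 2 * pi ->
  [/\ off_ray (cyl r p z), rho (cyl r p z) = ln r & phi (cyl r p z) = p].
Proof.
move=> r0 hp; rewrite /off_ray /rho /phi ypart_cyl radius_polar // logr_polar // arg_polar //; split => //.
rewrite /= -subr_eq0 -{1}[r]mulr1 -mulrBr mulf_neq0 ?gt_eqF // subr_gt0; exact: cos_lt1.
Qed.

Lemma cyl_dom r p (z : 'rV[R]_d) : 0 < r -> 0 < p < 2 * pi -> O p -> dom (cyl r p z).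
Proof. by move=> r0 hp Op; have [h1 _ h3] := cyl_coord z r0 hp; split => //; rewrite h3. Qed.

Lemma rotdil_cyl om ch r p (z : 'rV[R]_d) : rotdil om ch (cyl r p z) = cyl (ch * r) (p + om) z.
Proof.
have [h1 h2] : (cyl r p z) 0 (lshift d 0) = r * cos p /\ (cyl r p z) 0 (lshift d 1) = r * sin p.
  by have := ypart_cyl r p z; rewrite /ypart /polar => -[].
rewrite /rotdil h1 h2 /cyl row_mxKr; congr row_mx; apply/rowP => i; rewrite !mxE.
rewrite cosD sinD; case: i => -[|[|//]] ? /=; ring.
Qed.

Lemma wedge_sector a b (x : pt) : wedge a b x <-> sector `]a, b[ (ypart x).
Proof.
split.
  move=> [r [p [z [r0 hp ->]]]]; exists r, p; split; [exact: r0 | by rewrite in_itv | exact: ypart_cyl].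
move=> [r [p [r0 hp E]]]; exists r, p, (rsubmx x); split; [exact: r0 | by move: hp; rewrite in_itv |].
move: E; rewrite /ypart /polar /cyl => -[E1 E2].
rewrite -[LHS]hsubmxK; congr row_mx; apply/rowP => i; rewrite !mxE.
by case: i => -[|[|//]] ? /=; rewrite -?E1 -?E2; congr (x _ _); exact/val_inj.
Qed.

(** The cosine decreases up to pi and increases afterwards, so on the interval its maximum is
    attained at an end point. *)
Lemma cos_le_max (a b p : R) : 0 < a -> b < 2 * pi -> a <= p <= b -> cos p <= Num.max (cos a) (cos b).
Proof.
move=> a0 b2 /andP[ap pb]; have p0 := pi_gt0 R.
have mono (x y : R) : 0 <= x -> x <= y -> y <= pi -> cos y <= cos x.
  move=> x0 xy y1; rewrite leNgt; apply/negP.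
  by rewrite ltr_cos ?in_itv /= ?x0 ?y1 ?(le_trans x0) ?(le_trans xy) // ltNge xy.
rewrite le_max; have [pp|pp] := leP p pi.
  by rewrite (mono a p (ltW a0) ap pp).
apply/orP; right; rewrite -(cosN p) -(cosN b) -cosD2pi -[leRHS]cosD2pi -mulr_natl; apply: mono; lra.
Qed.

Lemma not_edge_sqradius (x : pt) : ~ edge x -> 0 < sqradius x.
Proof.
move=> nex; rewrite lt_neqAle addr_ge0 ?sqr_ge0 // andbT; apply/eqP => E; apply: nex.
move/eqP: E; rewrite eq_sym paddr_eq0 ?sqr_ge0 // !sqrf_eq0 => /andP[/eqP h1 /eqP h2].
apply/rowP => i; rewrite !mxE; case: i => -[|[|//]] ? /=.
  by rewrite -h1; congr (x _ _); exact/val_inj.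
by rewrite -h2; congr (x _ _); exact/val_inj.
Qed.

(** On the open wedge y1 <= M r with M = max (cos a) (cos b) < 1. This passes to the closure and
    excludes y1 = r off the edge; there phi is continuous, so a <= phi <= b passes to the closure as
    well. *)
Lemma closed_wedge_dom a b (x : pt) : 0 < a -> a <= b -> b < 2 * pi ->
  (forall p, a <= p <= b -> O p) -> closed_wedge a b x -> dom x.
Proof.
move=> a0 ab b2 abO [clx nex].
have rx := not_edge_sqradius nex.
have meets (P : pt -> Prop) : (\forall y \near x, P y) -> exists2 y, wedge a b y & P y.
  by move=> /clx [y [wy Py]]; exists y.
pose M := Num.max (cos a) (cos b).
have M1 : M < 1.
  by rewrite /M gt_max !cos_lt1 //; apply/andP; split; rewrite ?(lt_le_trans a0) // ?(le_lt_trans ab).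
have yw (y : pt) : wedge a b y -> [/\ off_ray y, a < phi y < b & (ypart y).1 <= M * radius (ypart y)].
  move=> [r [p [z [r0 /andP[ap pb] ->]]]].
  have hp : 0 < p < 2 * pi by rewrite (lt_trans a0) // (lt_trans pb).
  have [h1 _ h3] := cyl_coord z r0 hp; split => //; first by rewrite h3 ap.
  rewrite ypart_cyl radius_polar //= mulrC ler_pM2r // cos_le_max //.
  by rewrite !ltW.
have ox : off_ray x.
  apply/negP => /eqP E.
  have h1 := has_diff_radius rx; have h2 := has_diff_coord x (lshift d 0).
  have c := has_diff_cont (has_derD h2 (has_derM (has_diff_cst (- M) x) h1)).
  have pos : 0 < x 0 (lshift d 0) + - M * radius (ypart x).
    rewrite -[x 0 _]/(ypart x).1 -E -{1}[radius _]mul1r -mulrDl mulr_gt0 ?radius_gt0 //.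
    by rewrite subr_gt0.
  have [y wy] := meets _ (cvgr_gt _ c _ pos).
  have [_ _] := yw _ wy; rewrite -subr_le0 -mulNr => h.
  by rewrite ltNge h.
split => //; apply: abO.
have c := has_diff_cont (has_diff_phi ox); apply/andP; split; rewrite leNgt; apply/negP => h.
  have [y wy] := meets _ (cvgr_lt _ c _ h).
  by have [_ /andP[h1 _] _] := yw _ wy; rewrite ltNge (ltW h1).
have [y wy] := meets _ (cvgr_gt _ c _ h).
by have [_ /andP[_ h1] _] := yw _ wy; rewrite ltNge (ltW h1).
Qed.

(** The cut-off in ln r confines r to [exp(-B), exp B], away from the edge, and the others bound the
    z_i; what remains of the closed wedge is closed and bounded. *)
Lemma separated_support a b (f : R -> C) A : (forall n x, A < `|x| -> g n x = 0) ->
  csupport_in (@closed_wedge R d a b) (separated lambda g f).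
Proof.
move=> gA; pose B := `|A|.
have gB n x : B < `|x| -> g n x = 0.
  by move=> h; apply: gA; exact: le_lt_trans (ler_norm A) h.
pose K2 : set pt := [set x | expR (- (2 * B)) <= sqradius x <= expR (2 * B)].
pose K3 : set pt := [set x | forall i : 'I_d, `|x 0 (rshift 2 i)| <= B].
exists (closure (wedge a b) `&` (K2 `&` K3)); split.
- have crsq : continuous (@sqradius R d) by move=> x; exact: has_diff_cont (has_diff_sqradius x).
  have K2c : closed K2.
    have -> : K2 = @sqradius R d @^-1` `[expR (- (2 * B)), expR (2 * B)].
      by apply/seteqP; split => x; rewrite /K2 /= in_itv.
    by apply: preimage_closed => //; exact: itv_closed.
  have K3c : closed K3.
    have -> : K3 = \bigcap_(i in [set: 'I_d]) ((fun x : pt => x 0 (rshift 2 i)) @^-1` `[- B, B]).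
      apply/seteqP; split => x h; first by move=> i _; rewrite /= in_itv /= -ler_norml; exact: h.
      by move=> i; have := h i I; rewrite /= in_itv /= -ler_norml.
    apply: closed_bigI => i _; apply: preimage_closed; last exact: itv_closed.
    by move=> x _; exact: has_diff_cont (has_diff_coord x _).
  apply: bounded_closed_compact; last first.
    by apply: closedI; [exact: closed_closure | exact: closedI].
  exists (Num.max B (expR B)); split; first exact: num_real.
  move=> M hM x [_ [/andP[_ x2] x3]].
  have rb (c : R) : c ^+ 2 <= expR (2 * B) -> `|c| <= M.
    rewrite expRM_natl -[c ^+ 2]real_normK ?num_real // ler_pXn2r ?nnegrE ?expR_ge0 // => h.
    by rewrite (le_trans h) // ltW // (le_lt_trans _ hM) // le_max lexx orbT.
  suff : mx_norm x <= M by [].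
  rewrite mx_normrE; apply: bigmax_le; first by rewrite ltW // (le_lt_trans _ hM) // le_max normr_ge0.
  move=> [i j] _ /=; rewrite ord1; case: (splitP j) => k jk.
    have -> : j = lshift d k by exact/val_inj.
    apply: rb; apply: le_trans x2; rewrite /sqradius /ypart /=.
    case: k jk => -[|[|//]] ? _.
      rewrite (_ : Ordinal _ = 0); last exact/val_inj.
      by rewrite lerDl sqr_ge0.
    rewrite (_ : Ordinal _ = 1); last exact/val_inj.
    by rewrite lerDr sqr_ge0.
  have -> : j = rshift 2 k by exact/val_inj.
  by rewrite (le_trans (x3 k)) // ltW // (le_lt_trans _ hM) // le_max lexx.
- move=> x [clx [/andP[x1 _] _]]; split => // ex.
  move: x1; rewrite /sqradius /ypart leNgt => /negP; apply.
  have e0 i : x 0 (lshift d i) = 0 by move/rowP/(_ i) : ex; rewrite !mxE.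
  by rewrite !e0 expr0n addr0 expR_gt0.
- move=> x [clx nex] nL; have rx := not_edge_sqradius nex; rewrite /separated /eval_term /=.
  have [K2x|nK2] := pselect (K2 x).
    have : ~ K3 x by move=> K3x; apply: nL.
    move=> /existsNP[i /negP]; rewrite -ltNge => zi.
    by rewrite /axial (bigD1 i) //= gB // mul0r mulr0.
  rewrite /radial gB ?mulr0 ?mul0r // ltNge; apply/negP => h; apply: nK2; rewrite /K2 /=.
  have -> : sqradius x = expR (2 * rho x) by rewrite /rho /logr mulrC mulfVK // lnK.
  by move: h; rewrite ler_norml => /andP[h1 h2]; rewrite !ler_expR; apply/andP; split; lra.
Qed.

End SeparatedFunctions.

(** * Integrals over wedges and faces *)

Section Integrals.
Variables (R : realType) (d m : nat).
Local Notation C := R[i].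
Local Notation pt := ('rV[R]_(2 + d)).
Variables (lambda lambda' : C).
Hypothesis (hlambda' : lambda' = lambda^* - 2 * 'i * (m%:R - 1)).
Variables (g : nat -> R -> C) (O : set R).
Hypotheses (bg : bump_tower g) (oO : open O).
Local Notation dom := (@polar_dom R d O).
Local Notation eval_term := (@eval_term R d lambda g).
Local Notation eval_terms := (@eval_terms R d lambda g).

Let tg : tower g. Proof. by case: bg. Qed.
Let gA : exists A, forall n x, A < `|x| -> g n x = 0. Proof. by case: bg. Qed.

Lemma ccontM (f h : R -> C) x : ccont f x -> ccont h x -> ccont (fun y => f y * h y) x.
Proof.
move=> [rf jf] [rh jh]; split.
  rewrite (_ : _ \o _ = ((@complex.Re R \o f) \* (@complex.Re R \o h)) \- ((@complex.Im R \o f) \* (@complex.Im R \o h))).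
    by apply: cvgB; apply: cvgM.
  by apply/funext => y /=; rewrite ReM.
rewrite (_ : _ \o _ = ((@complex.Re R \o f) \* (@complex.Im R \o h)) \+ ((@complex.Im R \o f) \* (@complex.Re R \o h))).
  by apply: cvgD; apply: cvgM.
by apply/funext => y /=; rewrite ImM.
Qed.

Lemma ccont_conj (f : R -> C) x : ccont f x -> ccont (fun y => (f y)^*) x.
Proof.
move=> [rf jf]; split.
  rewrite (_ : _ \o _ = @complex.Re R \o f) //.
  by apply/funext => y /=; case: (f y).
rewrite (_ : _ \o _ = \- (@complex.Im R \o f)); first exact: cvgN.
by apply/funext => y /=; case: (f y).
Qed.

Definition weight' (k : nat) (t : R) : C := cexp (('i * lambda' - k%:R) * t%:C%C).

(** The conjugate of i lambda' is - i lambda + 2 (m - 1), so the exponents add up to 2 m - 2 + j - k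
    - k' = 0. Here j = 2 stands for r dr = e^(2t) dt on wedges, where the orders sum to 2m, and j =
    1 for dr = e^t dt on faces, where they sum to 2m - 1. *)
Lemma weight_cancel (j k k' : nat) (t : R) : (k + k' + 2 = m.*2 + j)%N ->
  (expR (j%:R * t))%:C%C * (cexp (('i * lambda - k%:R) * t%:C%C) * (weight' k' t)^*) = 1.
Proof.
move=> E; rewrite /weight' cexp_conj -cexp_real -!cexpD -[RHS]cexp0; congr cexp.
have c2 : (2 : C)^* = 2 by rewrite rmorph_nat.
rewrite hlambda' !(rmorphM, rmorphB, rmorph_nat, rmorph1) /= conjCK.
have -> : (t%:C%C)^* = t%:C%C by apply: eq_complexP; rewrite //= oppr0.
rewrite conjCi.
have EC : k%:R + k'%:R + 2 = 2 * m%:R + j%:R :> C.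
  by rewrite -[2 * _]natrM -!natrD E mul2n.
have ii : 'i * 'i = -1 :> C by rewrite -expr2 sqrCi.
transitivity (t%:C%C * (j%:R - k%:R - k'%:R - 2 * ('i * 'i) * (m%:R - 1))); first by ring.
rewrite ii; have -> : j%:R = k%:R + k'%:R + 2 - 2 * m%:R :> C by rewrite EC; ring.
by ring.
Qed.

Lemma cdiff_weight k t : cdifferentiable (fun t => (weight' k t)^*) t.
Proof.
rewrite (_ : (fun t => _) = fun t : R => cexp (('i * lambda' - k%:R)^* * t%:C%C)).
  exact: (Dop_cexp _ _).1.
apply/funext => y; rewrite /weight' cexp_conj rmorphM; congr (cexp (_ * _)).
by apply: eq_complexP; rewrite //= oppr0.
Qed.

(** The shift [s] is ln chi for a factor evaluated after dilation by chi, and 0 without dilation. *)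
Definition weighted_radial (s : R) (k n k' : nat) (t : R) : C := radial lambda g k n (t + s) * (weight' k' t)^*.

Lemma ccont_csupp_weighted_radial s k n k' : ccont_csupp (weighted_radial s k n k').
Proof.
split.
  move=> t; apply: cdifferentiable_ccont; apply: cdifferentiableM; last exact: cdiff_weight.
  have hx : differentiable (fun y : R => y + s) t.
    apply: differentiableD; last exact: differentiable_cst.
    by apply/derivable1_diffP; exact: derivable_id.
  exact: (Dop_chain (0 : R) hx (radial_der lambda tg k n (t + s)).1).1.
case: gA => A hA; exists (`|A| + `|s|) => t ts.
rewrite /weighted_radial /radial hA ?mulr0 ?mul0r //.
have h1 := ler_norm A; have h2 := ler_normB (t + s) s; rewrite addrK in h2.
by lra.
Qed.

Lemma line_cintegral_shift (f : R -> C) s : ccont_csupp f -> line_cintegral (fun t => f (t + s)) = line_cintegral f.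
Proof.
move=> [cf [A fA]].
have key (h : R -> R) : continuous h -> (forall x, A < `|x| -> h x = 0) ->
    Rintegral (@lebesgue_measure R) setT (fun t => h (t + s)) = Rintegral (@lebesgue_measure R) setT h.
  move=> ch hA; pose B := `|A|.
  have AB x : B < `|x| -> h x = 0 by move=> hx; apply: hA; exact: le_lt_trans (ler_norm _) hx.
  have BB : - B - s <= B - s by rewrite lerD2r /B ge0_cp.
  transitivity (Rintegral (@lebesgue_measure R) `[- B - s, B - s] (fun t => h (t + s) * 1)).
    rewrite [RHS]Rintegral_mkcond; congr Rintegral; apply/funext => x.
    rewrite patchE mem_setE in_itv /= lerBlDr lerBrDr -ler_norml mulr1; case: ifPn => //.
    by rewrite -ltNge => /AB ->.
  have <- : Rintegral (@lebesgue_measure R) `[- B - s + s, B - s + s] h =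
      Rintegral (@lebesgue_measure R) `[- B - s, B - s] (fun t => h (t + s) * 1).
    apply: (@Rintegral_substitution R (fun t => t + s)) => // [x _|x _|].
    - by apply: is_derive_eq; rewrite addr0.
    - exact: cvg_cst.
    - exact: continuous_subspaceT.
  rewrite !subrK [LHS]Rintegral_mkcond; congr Rintegral; apply/funext => x.
  rewrite patchE mem_setE in_itv /= -ler_norml; case: ifPn => //.
  by rewrite -ltNge => /AB ->.
apply: eq_complexP.
  apply: (key (@complex.Re R \o f)) => [x|x h]; first exact: (cf x).1.
  by rewrite /= fA.
apply: (key (@complex.Im R \o f)) => [x|x h]; first exact: (cf x).2.
by rewrite /= fA.
Qed.

(** The powers cancel up to the constant exp((i lambda - k) s) produced by the shift, leaving the
    integral of a translate of g_n, which is 1 or 0. The exponential factors of the nonlocal terms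
    in U arise here. *)
Lemma weighted_radial_integral (j : nat) s k n k' : (k + k' + 2 = m.*2 + j)%N ->
  line_cintegral (fun t => (expR (j%:R * t))%:C%C * weighted_radial s k n k' t) =
  cexp (('i * lambda - k%:R) * s%:C%C) * (n == 0%N)%:R.
Proof.
move=> E; case: gA => A hA; have cg := tower_ccont_csupp tg hA n.
have cs : ccont_csupp (fun t => g n (t + s)).
  split; last first.
    exists (`|A| + `|s|) => t ts; rewrite hA //.
    have h1 := ler_norm A; have h2 := ler_normB (t + s) s; rewrite addrK in h2.
    by lra.
  move=> t; apply: cdifferentiable_ccont.
  have hx : differentiable (fun y : R => y + s) t.
    apply: differentiableD; last exact: differentiable_cst.
    by apply/derivable1_diffP; exact: derivable_id.
  exact: (Dop_chain (0 : R) hx (tg n (t + s)).1).1.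
have [_ _ gI] := bg; rewrite -(gI n) -(line_cintegral_shift s cg) -(has_cintegral_line_cintegral (has_cintegralZ _ (ccont_csupp_has_cintegral cs))).
congr line_cintegral; apply/funext => t; rewrite /weighted_radial /radial rmorphD mulrDr cexpD.
transitivity ((expR (j%:R * t))%:C%C * (cexp (('i * lambda - k%:R) * t%:C%C) * (weight' k' t)^*) *
  (cexp (('i * lambda - k%:R) * s%:C%C) * g n (t + s))); first by ring.
by rewrite weight_cancel // mul1r.
Qed.

Definition axial_int (t : term R d) : C := \prod_(i < d) line_cintegral (g (ta t i)).

Lemma axial_has_iter_cintegral (t : term R d) : has_iter_cintegral (fun z : 'rV[R]_d => \prod_(i < d) g (ta t i) (z 0 i)) (axial_int t).
Proof.
case: gA => A hA; apply: (@has_iter_cintegral_prod R d (fun i => g (ta t i)) (fun i => line_cintegral (g (ta t i)))) => i.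
exact: (ccont_csupp_has_cintegral (tower_ccont_csupp tg hA (ta t i))).
Qed.

Lemma axial_int0 (t : term R d) : (exists i, ta t i != 0%N) -> axial_int t = 0.
Proof.
move=> [i ti]; rewrite /axial_int (bigD1 i) //=; have [_ _ ->] := bg.
by rewrite (negbTE ti) mul0r.
Qed.

Lemma axial_int1 (t : term R d) : (forall i, ta t i = 0%N) -> axial_int t = 1.
Proof.
by move=> t0; rewrite /axial_int big1 // => i _; have [_ _ ->] := bg; rewrite t0.
Qed.

Lemma axialE (t : term R d) (x : pt) : axial g (ta t) x = \prod_(i < d) g (ta t i) ((rsubmx x) 0 i).
Proof. by rewrite /axial; apply: eq_bigr => i _; rewrite mxE. Qed.

Section Volume.
Variables (a b : R) (k' : nat) (v : R -> C).
Hypotheses (a0 : 0 < a) (ab : a <= b) (b2 : b < 2 * pi).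
Hypothesis abO : forall p, a <= p <= b -> O p.
Hypothesis cv : forall p, a <= p <= b -> ccont v p.

Let val (t : term R d) : C := line_cintegral (fun r => (expR (2 * r))%:C%C * weighted_radial 0 (pw t) (tn t) k' r)
  * integral_arc a b (fun p => tb t p * (v p)^*) * axial_int t.

Let integrand (f : pt -> C) (x : pt) : C := patch (fun=> 0) (wedge a b)
  (fun x => f x * (weight' k' (rho x) * v (phi x))^*) x.

Let integrand_term t : smooth O t -> has_iter_cintegral (integrand (eval_term t)) (val t).
Proof.
move=> st.
have cH p : a <= p <= b -> ccont (fun p => tb t p * (v p)^*) p.
  move=> hp; apply: ccontM; last by apply: ccont_conj; exact: cv.
  by apply: cdifferentiable_ccont; exact: (st [::] _ (abO hp)).
have [bF vF] := cpolar_integral (ccont_csupp_weighted_radial 0 (pw t) (tn t) k') a0 ab b2 cH.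
rewrite /val -vF; apply: (has_iter_cintegral_plane bF (axial_has_iter_cintegral t)) => x.
rewrite /integrand /patch -axialE /cpolar_fun.
have -> : (x \in wedge a b) = `[< sector `]a, b[ (x 0 (lshift d 0), x 0 (lshift d 1)) >].
  by apply/idP/idP => [|/asboolP h]; [rewrite inE => /wedge_sector h; exact/asboolP | rewrite inE; exact/wedge_sector].
case: asboolP => _; last by rewrite mul0r.
by rewrite -/(ypart x) -/(rho x) -/(phi x) /weighted_radial addr0 /eval_term rmorphM; ring.
Qed.

Let val_vanishing_term kappa t : (kappa + k' = m.*2)%N -> vanishing_term kappa t -> val t = 0.
Proof.
move=> E [ht|[n0 tk]]; first by rewrite /val axial_int0 // mulr0.
rewrite /val tk (@weighted_radial_integral 2) ?E //.
by rewrite (gtn_eqF n0) mulr0 !mul0r.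
Qed.

(** [kappa] and [k'] are the orders applied to the two factors: 2m and 0 when P_j acts on U_j, 0 and
    2m when Q_j acts on V_jt. *)
Lemma volume_integral (f h : pt -> C) kappa u L : (kappa + k' = m.*2)%N ->
  csmooth O u -> Forall_seq (smooth O) L -> Forall_seq (vanishing_term kappa) L ->
  (forall x, dom x -> f x = eval_term (Term kappa 0 (fun=> 0%N) u) x + eval_terms L x) ->
  (forall x, dom x -> h x = weight' k' (rho x) * v (phi x)) ->
  integral_wedge a b (fun x => f x * (h x)^*) = integral_arc a b (fun p => u p * (v p)^*).
Proof.
move=> E su sL bL fE hE; apply: has_iter_cintegral_integral.
have v0 : val (Term kappa 0 (fun=> 0%N) u) = integral_arc a b (fun p => u p * (v p)^*).
  by rewrite /val axial_int1 // mulr1 (@weighted_radial_integral 2) ?E // mulr0 cexp0 !mul1r.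
rewrite -v0 -[val _]addr0.
have iL : @has_iter_cintegral R (2 + d) (fun x : pt => \sum_(t <- L) integrand (eval_term t) x) 0.
  elim: L sL bL {fE} => [_ _|t L IH [st sL] [bt bL]].
    by apply: has_iter_cintegral_ext (has_iter_cintegral0 R (2 + d)) => x; rewrite big_nil.
  have i1 : has_iter_cintegral (integrand (eval_term t)) 0 by rewrite -(val_vanishing_term E bt); exact: integrand_term.
  have i2 := has_iter_cintegralD i1 (IH sL bL); rewrite addr0 in i2.
  by apply: has_iter_cintegral_ext i2 => x; rewrite big_cons.
have su' : smooth O (Term kappa 0 ((fun=> 0%N) : 'I_d -> nat) u) by [].
apply: has_iter_cintegral_ext (has_iter_cintegralD (integrand_term su') iL) => x.
rewrite /integrand /patch; case: ifPn => wx; last by rewrite big1 ?addr0.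
have Dx : dom x.
  move: wx; rewrite inE => -[r [p [z [r0 /andP[ap pb] ->]]]]; apply: cyl_dom => //.
    by rewrite (lt_trans a0) // (lt_trans pb).
  by apply: abO; rewrite !ltW.
by rewrite fE // hE // mulrDl /eval_terms mulr_suml.
Qed.

End Volume.
End Integrals.

(** * Integrals over faces, with dilations *)

Section FaceIntegrals.
Variables (R : realType) (d m : nat).
Local Notation C := R[i].
Local Notation pt := ('rV[R]_(2 + d)).
Variables (lambda lambda' : C).
Hypothesis hlambda' : lambda' = lambda^* - 2 * 'i * (m%:R - 1).
Variables (g : nat -> R -> C) (O : set R).
Hypotheses (bg : bump_tower g) (oO : open O).
Local Notation dom := (@polar_dom R d O).
Local Notation eval_term := (@eval_term R d lambda g).
Local Notation eval_terms := (@eval_terms R d lambda g).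

Definition half_space_fun (b : R) (k' : nat) (c0 : C) (f : pt -> C) (w : 'rV[R]_(1 + d)) : C :=
  if 0 < w 0 0 then f (cyl (w 0 0) b (rsubmx w)) * (weight' lambda' k' (ln (w 0 0)) * c0)^* else 0.

(* The integrals over {phi = b} against all the functions r^(i lambda' - k') c0 of
   complementary order. *)
Definition face_val (b : R) (kappa : nat) (f : pt -> C) (val : C) : Prop :=
  forall k' c0, (kappa + k' + 1 = m.*2)%N -> has_iter_cintegral (half_space_fun b k' c0 f) (val * c0^*).

Lemma face_val0 b kappa : face_val b kappa (fun=> 0) 0.
Proof.
move=> k' c0 _; rewrite mul0r; apply: has_iter_cintegral_ext (has_iter_cintegral0 R (1 + d)) => w.
by rewrite /half_space_fun mul0r if_same.
Qed.

Lemma face_valD b kappa f1 f2 v1 v2 : face_val b kappa f1 v1 -> face_val b kappa f2 v2 ->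
  face_val b kappa (fun x => f1 x + f2 x) (v1 + v2).
Proof.
move=> h1 h2 k' c0 E; rewrite mulrDl; apply: has_iter_cintegral_ext (has_iter_cintegralD (h1 k' c0 E) (h2 k' c0 E)) => w.
by rewrite /half_space_fun; case: ifP => _; rewrite ?mulrDl ?addr0.
Qed.

Lemma face_val_sum b kappa (I : eqType) (s : seq I) (f : I -> pt -> C) (v : I -> C) :
  (forall i, i \in s -> face_val b kappa (f i) (v i)) ->
  face_val b kappa (fun x => \sum_(i <- s) f i x) (\sum_(i <- s) v i).
Proof.
elim: s => [_|i s IH h].
  rewrite big_nil (_ : (fun x => _) = fun=> 0); first exact: face_val0.
  by apply/funext => x; rewrite big_nil.
rewrite big_cons (_ : (fun x => _) = fun x => f i x + \sum_(i <- s) f i x).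
  apply: face_valD; first by apply: h; rewrite mem_head.
  by apply: IH => j js; apply: h; rewrite inE js orbT.
by apply/funext => x; rewrite big_cons.
Qed.

Lemma face_integral b kappa f val k' c0 (h : pt -> C) : (kappa + k' + 1 = m.*2)%N ->
  face_val b kappa f val ->
  (forall r z, 0 < r -> h (cyl r b z) = weight' lambda' k' (ln r) * c0) ->
  integral_face b (fun x => f x * (h x)^*) = val * c0^*.
Proof.
move=> E fv hE; apply: has_iter_cintegral_integral; apply: has_iter_cintegral_ext (fv k' c0 E) => w.
rewrite /half_space_fun /patch.
have -> : (w \in [set w : 'rV[R]_(1 + d) | 0 < w 0 0]) = (0 < w 0 0).
  by apply/idP/idP; rewrite inE.
by case: ifP => // w0; rewrite hE.
Qed.

(** The values of [f] on the face phi = b are taken from phi = p at the radius ch r; in ln r this is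
    a translation by ln ch, to which [weighted_radial_integral] applies. *)
Lemma face_val_opD (b ch p : R) kappa (A : symbol R (2 + d)) (u : R -> C) (f : pt -> C) :
  0 < ch -> 0 < p < 2 * pi -> O p -> homogeneous kappa A -> csmooth O u ->
  (forall r z, 0 < r -> f (cyl r b z) = opD A (separated lambda g u) (cyl (ch * r) p z)) ->
  face_val b kappa f (cexp (('i * lambda - kappa%:R) * (ln ch)%:C%C) * tilde A lambda u p).
Proof.
move=> ch0 hp Op hA su fE k' c0 E.
have [tg _ _] := bg.
have [_ [L [_ bL EL]]] := opD_represented lambda tg oO hA su.
pose val (t : term R d) : C := line_cintegral (fun r => (expR r)%:C%C * weighted_radial lambda lambda' g (ln ch) (pw t) (tn t) k' r)
  * axial_int g t * (tb t p * c0^*).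
pose F (t : term R d) (w : 'rV[R]_(1 + d)) : C :=
  if 0 < w 0 0 then eval_term t (cyl (ch * w 0 0) p (rsubmx w)) * (weight' lambda' k' (ln (w 0 0)) * c0)^* else 0.
have iF t : has_iter_cintegral (F t) (val t).
  have ih := has_iter_cintegral_half (ccont_csupp_weighted_radial lambda lambda' bg (ln ch) (pw t) (tn t) k') (axial_has_iter_cintegral bg t) (fun w => erefl).
  rewrite /val mulrC; apply: has_iter_cintegral_ext (has_iter_cintegralZ (tb t p * c0^*) ih) => w.
  rewrite /F; case: ifP => w0; last by rewrite mul0r mulr0.
  have [_ e1 e2] := cyl_coord (rsubmx w) (mulr_gt0 ch0 w0) hp.
  rewrite /eval_term e1 e2 axialE rmorphM lnM ?posrE // /weighted_radial [ln ch + _]addrC.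
  have -> : rsubmx (cyl (ch * w 0 0) p (rsubmx w)) = rsubmx w by rewrite /cyl row_mxKr.
  by ring.
have RI n (k : nat) : (k + k' + 1 = m.*2)%N ->
    line_cintegral (fun r => (expR r)%:C%C * weighted_radial lambda lambda' g (ln ch) k n k' r) =
    cexp (('i * lambda - k%:R) * (ln ch)%:C%C) * (n == 0%N)%:R.
  move=> Ek; rewrite -(@weighted_radial_integral R m lambda lambda' hlambda' g bg 1 (ln ch) k n k'); last by rewrite -Ek; ring.
  by congr line_cintegral; apply/funext => t; rewrite mul1r.
have v0 : val (Term kappa 0 (fun=> 0%N) (tilde A lambda u)) =
    cexp (('i * lambda - kappa%:R) * (ln ch)%:C%C) * tilde A lambda u p * c0^*.
  by rewrite /val axial_int1 // RI // !mulr1 mulrA.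
have iL : has_iter_cintegral (fun w => \sum_(t <- L) F t w) 0.
  elim: L bL {EL} => [_|t L IH [bt bL]].
    by apply: has_iter_cintegral_ext (has_iter_cintegral0 R (1 + d)) => x; rewrite big_nil.
  have i1 : has_iter_cintegral (F t) 0.
    rewrite -[X in has_iter_cintegral _ X](_ : val t = 0) //; case: bt => [h|[h1 h2]].
      by rewrite /val axial_int0 // mulr0 mul0r.
    by rewrite /val h2 RI // (gtn_eqF h1) mulr0 !mul0r.
  have i2 := has_iter_cintegralD i1 (IH bL); rewrite addr0 in i2.
  by apply: has_iter_cintegral_ext i2 => x; rewrite big_cons.
rewrite -v0 -[val _]addr0; apply: has_iter_cintegral_ext (has_iter_cintegralD (iF _) iL) => w.
rewrite /half_space_fun /F; case: ifP => w0; last by rewrite big1 ?addr0.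
rewrite fE // EL; last by apply: cyl_dom => //; exact: mulr_gt0.
by rewrite mulrDl /eval_terms mulr_suml.
Qed.

Lemma face_val_local (p : R) kappa (A : symbol R (2 + d)) (u : R -> C) :
  0 < p < 2 * pi -> O p -> homogeneous kappa A -> csmooth O u ->
  face_val p kappa (opD A (separated lambda g u)) (tilde A lambda u p).
Proof.
move=> hp Op hA su.
rewrite -[tilde _ _ _ _]mul1r -[X in X * _](_ : cexp (('i * lambda - kappa%:R) * (ln (1 : R))%:C%C) = 1).
  by apply: face_val_opD => // r z r0; rewrite mul1r.
by rewrite ln1 mulr0 cexp0.
Qed.

End FaceIntegrals.

(** * Operators on homogeneous functions without cut-off *)

Section UnitTower.
Variables (R : realType) (d : nat).
Local Notation C := R[i].
Variables (lambda : C) (O : set R).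
Hypothesis oO : open O.
Local Notation dom := (@polar_dom R d O).

Lemma eval_term_unit (t : term R d) (x : 'rV[R]_(2 + d)) : tn t = 0%N -> (forall i, ta t i = 0%N) ->
  eval_term lambda (@unit_tower R) t x = weight' lambda (pw t) (rho x) * tb t (phi x).
Proof.
move=> t0 ta0; rewrite /eval_term /radial /axial t0 big1 ?mulr1 // => i _.
by rewrite ta0.
Qed.

Lemma eval_term_unit_vanishing_term kappa (t : term R d) (x : 'rV[R]_(2 + d)) : vanishing_term kappa t ->
  eval_term lambda (@unit_tower R) t x = 0.
Proof.
case=> [[i ti]|[t0 _]].
  by rewrite /eval_term /axial (bigD1 i) //= /unit_tower (negbTE ti) mul0r mulr0.
by rewrite /eval_term /radial /unit_tower (gtn_eqF t0) mulr0 !mul0r.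
Qed.

Lemma separated_unit (u : R -> C) (x : 'rV[R]_(2 + d)) :
  separated lambda (@unit_tower R) u x = weight' lambda 0 (rho x) * u (phi x).
Proof. by rewrite /separated eval_term_unit. Qed.

(** For the constant cut-off 1 the vanishing terms are zero pointwise, since each contains a
    derivative of 1. *)
Lemma opD_unit kappa (A : symbol R (2 + d)) (u : R -> C) x : homogeneous kappa A -> csmooth O u ->
  dom x -> opD A (separated lambda (@unit_tower R) u) x =
    weight' lambda kappa (rho x) * tilde A lambda u (phi x).
Proof.
move=> hA su Dx; have [_ [L [_ bL ->]]] := opD_represented lambda (@tower_unit R) oO hA su; last by [].
rewrite eval_term_unit // /eval_terms; elim: L bL => [_|t L IH [bt bL]]; first by rewrite big_nil addr0.
by rewrite big_cons (eval_term_unit_vanishing_term x bt) add0r IH.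
Qed.

Lemma opD_unit_cyl kappa (A : symbol R (2 + d)) (u : R -> C) (ch r p : R) z :
  0 < ch -> 0 < r -> 0 < p < 2 * pi -> O p -> homogeneous kappa A -> csmooth O u ->
  opD A (separated lambda (@unit_tower R) u) (cyl (ch * r) p z) =
  weight' lambda kappa (ln r) * (cexp (('i * lambda - kappa%:R) * (ln ch)%:C%C) * tilde A lambda u p).
Proof.
move=> ch0 r0 hp Op hA su; rewrite (opD_unit hA su); last by apply: cyl_dom => //; exact: mulr_gt0.
have [_ -> ->] := cyl_coord z (mulr_gt0 ch0 r0) hp.
by rewrite lnM ?posrE // /weight' rmorphD mulrDr cexpD; ring.
Qed.

Lemma opD_unit_local kappa (A : symbol R (2 + d)) (u : R -> C) (r p : R) z :
  0 < r -> 0 < p < 2 * pi -> O p -> homogeneous kappa A -> csmooth O u ->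
  opD A (separated lambda (@unit_tower R) u) (cyl r p z) =
  weight' lambda kappa (ln r) * tilde A lambda u p.
Proof.
move=> r0 hp Op hA su; rewrite -[r in LHS]mul1r (opD_unit_cyl _ _ r0 hp Op hA su) //.
by rewrite ln1 mulr0 cexp0 mul1r.
Qed.

End UnitTower.

(** * The Green formula *)

Lemma csmooth_sub (R : realType) (V : normedModType R) (O O' : set V) (u : V -> R[i]) :
  O' `<=` O -> csmooth O u -> csmooth O' u.
Proof. by move=> sW su s x /sW Ox; exact: su. Qed.

Lemma homogeneous_formal_adjoint (R : realType) n kappa (A : symbol R n) :
  homogeneous kappa A -> homogeneous kappa (formal_adjoint A).
Proof.
move=> /dhomogP hA; apply/dhomogP => a; rewrite mcoeff_msupp mcoeff_map_mpoly => h.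
apply: hA; rewrite mcoeff_msupp; apply: contraNN h => /eqP ->; apply/eqP; exact: conjC0.
Qed.

Lemma dirichlet_homogeneous (R : realType) n (nu : 'rV[R]_n) M ops kappa (A : symbol R n) :
  dirichlet_system nu M ops -> (kappa, A) \in ops -> homogeneous kappa A.
Proof. by move=> [[_ h] _] /h []. Qed.

(** * Position of the angles and sectors *)

Section Angles.
Variables (R : realType) (N : nat) (g : geometry R N).

Lemma ang_le j q q' : (1 <= q <= q')%N -> (q' <= (nR g j).+1)%N -> ang g j q <= ang g j q'.
Proof.
move=> /andP[q1]; elim: q' => [|q' IH]; first by case: q q1.
rewrite leq_eqVlt => /orP[/eqP -> //|qq] q'R.
apply: le_trans (IH qq (ltnW q'R)) (ltW _).
by apply: ang_lt; rewrite (leq_trans q1 qq).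
Qed.

Lemma ang_itv j q : (1 <= q <= (nR g j).+1)%N -> 0 < ang g j q < 2 * pi.
Proof.
move=> /andP[q1 qR]; rewrite (lt_le_trans (ang_gt0 g j)) ?ang_le ?q1 //.
by rewrite (le_lt_trans _ (ang_lt2pi g j)) // ang_le ?q1.
Qed.

Lemma side_range j sigma : (1 <= side g j sigma <= (nR g j).+1)%N.
Proof. by case: sigma; rewrite /side //= ltnS leqnn. Qed.

Lemma side_sector_range j sigma : (1 <= side_sector g j sigma <= nR g j)%N.
Proof. by have h := nR_gt0 g j; case: sigma; rewrite /side_sector ?h ?leqnn. Qed.

Lemma ang_side_sector j sigma :
  `[ang g j (side_sector g j sigma), ang g j (side_sector g j sigma).+1]%classic (ang_side g j sigma).
Proof.
have h := ang_lt (side_sector_range j sigma); rewrite /= in_itv /=.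
by move: h; case: sigma => h; rewrite /ang_side /side /side_sector lexx ?andbT ltW.
Qed.

End Angles.

(** * Evaluation of the two sides on the test functions *)

Section GreenFormulaWithParameter.
Variables (R : realType) (N d m : nat).
Local Notation C := R[i].
Variables (g : geometry R N) (pb : nonlocal_problem g d m) (G : green_operators pb).
Variables (lambda lambda' : C) (hlambda' : lambda' = lambda^* - 2 * 'i * (m%:R - 1)).
Variables (U : 'I_N -> R -> C) (V : 'I_N -> nat -> R -> C).
Hypothesis hU : forall j, csmooth_upto `[ang g j 1, ang g j (nR g j).+1]%classic (U j).
Hypothesis hV : forall j t, (1 <= t <= nR g j)%N ->
  csmooth_upto `[ang g j t, ang g j t.+1]%classic (V j t).
Variables (b : nat -> R -> C) (bb : bump_tower b).

Definition test_U j : 'rV[R]_(2 + d) -> C := separated lambda b (U j).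
Definition test_V j t : 'rV[R]_(2 + d) -> C := separated lambda' (@unit_tower R) (V j t).
Local Notation u := test_U.
Local Notation v := test_V.

Lemma ang_mem_U j q : (1 <= q <= (nR g j).+1)%N ->
  `[ang g j 1, ang g j (nR g j).+1]%classic (ang g j q).
Proof. by move=> /andP[q1 qR]; rewrite /= in_itv /= !ang_le ?q1 ?leqnn. Qed.

(** The orders are read off the Dirichlet systems, in which each operator is paired with its own. *)
Lemma homog_side j sigma mu : (1 <= mu <= m)%N ->
  [/\ homogeneous (ordB pb j sigma mu) (opB pb j sigma mu),
      homogeneous (m.*2.-1 - ordC G j sigma mu) (opB' G j sigma mu),
      homogeneous (ordC G j sigma mu) (opC G j sigma mu) &
      homogeneous (m.*2.-1 - ordB pb j sigma mu) (opF G j sigma mu)].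
Proof.
move=> hmu; have mi : mu \in iota 1 m by rewrite mem_iota add1n ltnS.
split.
- apply: dirichlet_homogeneous (BB'_dirichlet G j sigma) _.
  by rewrite mem_cat (map_f (fun mu => (ordB pb j sigma mu, opB pb j sigma mu)) mi).
- apply: dirichlet_homogeneous (BB'_dirichlet G j sigma) _.
  by rewrite mem_cat (map_f (fun mu => (m.*2.-1 - ordC G j sigma mu, opB' G j sigma mu)%N) mi) orbT.
- apply: dirichlet_homogeneous (CF_dirichlet G j sigma) _.
  by rewrite mem_cat (map_f (fun mu => (ordC G j sigma mu, opC G j sigma mu)) mi).
- apply: dirichlet_homogeneous (CF_dirichlet G j sigma) _.
  by rewrite mem_cat (map_f (fun mu => (m.*2.-1 - ordB pb j sigma mu, opF G j sigma mu)%N) mi) orbT.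
Qed.

Lemma homog_inner j q mu : (2 <= q <= nR g j)%N -> (1 <= mu <= m)%N ->
  homogeneous (m.*2 - mu) (opBi G j q mu) /\ homogeneous (m - mu) (opBi' G j q mu).
Proof.
move=> hq hmu; have mi : mu \in iota 1 m by rewrite mem_iota add1n ltnS.
split; apply: dirichlet_homogeneous (Bi_dirichlet G hq) _.
  by rewrite mem_cat (map_f (fun mu => (m.*2 - mu, opBi G j q mu)%N) mi).
by rewrite mem_cat (map_f (fun mu => (m - mu, opBi' G j q mu)%N) mi) orbT.
Qed.

Lemma homog_T j q nu : (2 <= q <= nR g j)%N -> (1 <= nu <= m.*2)%N ->
  homogeneous nu.-1 (opT G j q nu).
Proof.
move=> hq hnu; apply: dirichlet_homogeneous (T_dirichlet G hq) _.
by apply: (map_f (fun nu => (nu.-1, opT G j q nu))); rewrite mem_iota add1n ltnS.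
Qed.

Lemma calB_face j sigma mu : (1 <= mu <= m)%N ->
  face_val m lambda' (ang_side g j sigma) (ordB pb j sigma mu) (calB pb j sigma mu u)
    (tilde_calB pb j sigma mu lambda U).
Proof.
move=> hmu; have [hB _ _ _] := homog_side j sigma hmu.
apply: face_valD.
  have [W [oW sW sU]] := hU j.
  apply: (face_val_local hlambda' bb oW) => //; first by apply: ang_itv; exact: side_range.
  by apply: sW; apply: ang_mem_U; exact: side_range.
apply: face_val_sum => k _; have [W [oW sW sU]] := hU k.
apply: face_val_sum => q; rewrite mem_index_iota ltnS => hq.
have hq' : (1 <= q <= (nR g k).+1)%N by case/andP: hq => /ltnW -> /leqW ->.
apply: face_val_sum => s; rewrite mem_index_iota ltnS => hs.
(* The rotation carries the outer face of index j to the inner ray b_kq, where U_k is smooth. *)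
have E : ang_side g j sigma + Defs.rot g j sigma k q = ang g k q by rewrite /Defs.rot addrC subrK.
apply: (face_val_opD hlambda' bb oW) => //.
- exact: chi_gt0.
- by rewrite E ang_itv.
- by rewrite E; apply: sW; exact: ang_mem_U.
- exact: opBnl_homog.
- by move=> r z r0; rewrite rotdil_cyl.
Qed.

(** All operators involved have order nu - 1, so the same power of r factors out of every term; the
    dilations leave the constants exp((i lambda' - (nu - 1)) ln chi'). *)
Lemma calT_cyl j q nu r z : (2 <= q <= nR g j)%N -> (1 <= nu <= m.*2)%N -> 0 < r ->
  calT pb (opT G) (opTnl G) j q nu v (cyl r (ang g j q) z) =
  weight' lambda' nu.-1 (ln r) * tilde_calT G j q nu lambda' V.
Proof.
move=> hq hnu r0; have hT := homog_T hq hnu; have /andP[q2 qR] := hq.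
have hp : 0 < ang g j q < 2 * pi by rewrite ang_itv // (ltnW q2) leqW.
have h1 : (1 <= q.-1 <= nR g j)%N by rewrite -ltnS prednK ?(ltnW q2) // q2 (leq_trans (leq_pred _)).
have h2 : (1 <= q <= nR g j)%N by rewrite (ltnW q2).
have [W1 [oO1 sO1 sV1]] := hV h1.
have [W2 [oO2 sO2 sV2]] := hV h2.
have m1 : W1 (ang g j q).
  by apply: sO1; rewrite /= in_itv /= prednK ?(ltnW q2) // lexx andbT ang_le // ?leq_pred ?andbT ?leqW //; case/andP: h1.
have m2 : W2 (ang g j q) by apply: sO2; rewrite /= in_itv /= lexx ltW // ang_lt.
rewrite /calT /tilde_calT (opD_unit_local lambda' oO1 z r0 hp m1 hT sV1).
rewrite (opD_unit_local lambda' oO2 z r0 hp m2 hT sV2) mulrDr mulrBr; congr (_ + _).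
rewrite mulr_sumr; apply: eq_bigr => k _; rewrite mulr_sumr; apply: eq_bigr => sigma _.
rewrite mulr_sumr; apply: eq_big_nat => s; rewrite ltnS => hs.
have [W [oW sW sV]] := hV (side_sector_range g k sigma).
have E : ang g j q + rot' g j q k sigma = ang_side g k sigma.
  by rewrite /rot' /Defs.rot opprB addrC subrK.
rewrite rotdil_cyl; apply: (opD_unit_cyl _ oW) => //.
- by rewrite invr_gt0 chi_gt0.
- by rewrite E ang_itv // side_range.
- by rewrite E; apply: sW; exact: ang_side_sector.
- exact: opTnl_homog.
Qed.

Lemma opD_v_side j sigma kappa (A : symbol R (2 + d)) r z : homogeneous kappa A -> 0 < r ->
  opD A (v j (side_sector g j sigma)) (cyl r (ang_side g j sigma) z) =
  weight' lambda' kappa (ln r) * tilde A lambda' (V j (side_sector g j sigma)) (ang_side g j sigma).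
Proof.
move=> hA r0; have [W [oW sW sV]] := hV (side_sector_range g j sigma).
apply: (opD_unit_local lambda' oW z r0 _ _ hA sV); first by rewrite ang_itv // side_range.
by apply: sW; exact: ang_side_sector.
Qed.

Lemma opD_u_face j q kappa (A : symbol R (2 + d)) : (1 <= q <= (nR g j).+1)%N ->
  homogeneous kappa A ->
  face_val m lambda' (ang g j q) kappa (opD A (u j)) (tilde A lambda (U j) (ang g j q)).
Proof.
move=> hq hA; have [W [oW sW sU]] := hU j.
by apply: (face_val_local hlambda' bb oW) => //; [exact: ang_itv | apply: sW; exact: ang_mem_U].
Qed.

Lemma wedge_integrals j t : (1 <= t <= nR g j)%N ->
  integral_wedge (ang g j t) (ang g j t.+1)
    (fun x : 'rV[R]_(2 + d) => opD (opP pb j) (u j) x * (v j t x)^*) =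
  integral_arc (ang g j t) (ang g j t.+1)
    (fun phi => tilde (opP pb j) lambda (U j) phi * (V j t phi)^*) /\
  integral_wedge (ang g j t) (ang g j t.+1)
    (fun x : 'rV[R]_(2 + d) => u j x * (opD (opQ pb j) (v j t) x)^*) =
  integral_arc (ang g j t) (ang g j t.+1)
    (fun phi => U j phi * (tilde (opQ pb j) lambda' (V j t) phi)^*).
Proof.
move=> ht; have /andP[t1 tR] := ht.
have [W1 [oO1 sO1 sU]] := hU j; have [W2 [oO2 sO2 sV]] := hV ht.
have [hP _ _] := opP_elliptic pb j.
have oW := openI oO1 oO2.
have sU' : csmooth (W1 `&` W2) (U j) by apply: csmooth_sub sU => x [].
have sV' : csmooth (W1 `&` W2) (V j t) by apply: csmooth_sub sV => x [].
have a0 : 0 < ang g j t by have /andP[] := ang_itv (g := g) (j := j) (q := t) (ltac:(by rewrite t1 leqW)).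
have b2 : ang g j t.+1 < 2 * pi by have /andP[] := ang_itv (g := g) (j := j) (q := t.+1) (ltac:(by rewrite ltnS)).
have ab : ang g j t <= ang g j t.+1 by exact/ltW/ang_lt.
have abO p : ang g j t <= p <= ang g j t.+1 -> (W1 `&` W2) p.
  move=> /andP[h1 h2]; split; last by apply: sO2; rewrite /= in_itv /= h1.
  apply: sO1; rewrite /= in_itv /= (le_trans _ h1) ?(le_trans h2) //; first by rewrite ang_le.
  by rewrite ang_le // ?t1 // leqW.
have [tb _ _] := bb.
split.
  have [sP [L [sL bL EL]]] := opD_represented lambda tb oW hP sU'.
  apply: (volume_integral hlambda' bb a0 ab b2 abO _ (addn0 _) sP sL bL EL).
    by move=> p /abO Op; apply: cdifferentiable_ccont; exact: (sV' [::] _ Op).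
  by move=> x _; exact: separated_unit.
have hQ := homogeneous_formal_adjoint hP.
have [sQ _] := opD_represented lambda' (@tower_unit R) oW hQ sV'.
(* The undifferentiated test function is its own leading term of order 0, with empty remainder. *)
apply: (volume_integral hlambda' bb a0 ab b2 abO _ (add0n _) sU' (L := [::])) => //.
- by move=> p /abO Op; apply: cdifferentiable_ccont; exact: (sQ [::] _ Op).
- by move=> x _; rewrite /eval_terms big_nil addr0.
- by move=> x Dx; exact: (opD_unit lambda' oW hQ sV' Dx).
Qed.

Lemma csmooth_test_U j : csmooth_upto (closed_wedge (ang g j 1) (ang g j (nR g j).+1)) (u j).
Proof.
have [tb _ _] := bb; have [W [oW sW sU]] := hU j; exists (polar_dom W); split.
- exact: open_polar_dom.
- move=> x; apply: closed_wedge_dom; [exact: ang_gt0 | by rewrite ang_le | exact: ang_lt2pi |].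
  by move=> p hp; apply: sW; rewrite /= in_itv.
- exact: csmooth_eval_term.
Qed.

Lemma csmooth_test_V j t : (1 <= t <= nR g j)%N ->
  csmooth_upto (closed_wedge (ang g j t) (ang g j t.+1)) (v j t).
Proof.
move=> ht; have [W [oW sW sV]] := hV ht; have /andP[t1 tR] := ht; exists (polar_dom W); split.
- exact: open_polar_dom.
- move=> x; apply: closed_wedge_dom.
  + by have /andP[] := ang_itv (g := g) (j := j) (q := t) (ltac:(by rewrite t1 leqW)).
  + exact/ltW/ang_lt.
  + by have /andP[] := ang_itv (g := g) (j := j) (q := t.+1) (ltac:(by rewrite ltnS)).
  + by move=> p hp; apply: sW; rewrite /= in_itv.
- by apply: (csmooth_eval_term lambda' (@tower_unit R) oW).
Qed.

End GreenFormulaWithParameter.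

Theorem theorem4p3 (R : realType) (N d m : nat) (hN : (1 <= N)%N) (hm : (1 <= m)%N)
  (g : geometry R N) (pb : nonlocal_problem g d m) (G : green_operators pb)
  (lambda lambda' : R[i]) (hlambda' : lambda' = lambda^* - 2 * 'i * (m%:R - 1))
  (U : 'I_N -> R -> R[i]) (V : 'I_N -> nat -> R -> R[i])
  (hU : forall j, csmooth_upto `[ang g j 1, ang g j (nR g j).+1]%classic (U j))
  (hV : forall j t, (1 <= t <= nR g j)%N ->
     csmooth_upto `[ang g j t, ang g j t.+1]%classic (V j t)) :
  \sum_(j < N) (
    \sum_(1 <= t < (nR g j).+1)
      integral_arc (ang g j t) (ang g j t.+1)
        (fun phi => tilde (opP pb j) lambda (U j) phi * (V j t phi)^*) +
    \sum_(sigma : bool) \sum_(1 <= mu < m.+1)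
      tilde_calB pb j sigma mu lambda U *
      (tilde (opF G j sigma mu) lambda' (V j (side_sector g j sigma))
         (ang_side g j sigma))^* +
    \sum_(2 <= q < (nR g j).+1) \sum_(1 <= mu < m.+1)
      tilde (opBi G j q mu) lambda (U j) (ang g j q) *
      (tilde_calT G j q mu lambda' V)^*)
  = \sum_(j < N) (
    \sum_(1 <= t < (nR g j).+1)
      integral_arc (ang g j t) (ang g j t.+1)
        (fun phi => U j phi * (tilde (opQ pb j) lambda' (V j t) phi)^*) +
    \sum_(sigma : bool) \sum_(1 <= mu < m.+1)
      tilde (opB' G j sigma mu) lambda (U j) (ang_side g j sigma) *
      (tilde (opC G j sigma mu) lambda' (V j (side_sector g j sigma))
         (ang_side g j sigma))^* +
    \sum_(2 <= q < (nR g j).+1) \sum_(1 <= mu < m.+1)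
      tilde (opBi' G j q mu) lambda (U j) (ang g j q) *
      (tilde_calT G j q (m + mu) lambda' V)^*).

Proof.
have [b bb] := exists_bump_tower R; have [_ [A bA] _] := bb.
have m2 : m.*2.-1.+1 = m.*2 by rewrite prednK // double_gt0.
(* Compact support is supplied by the U side; the functions built from V carry no cut-off. *)
have GF := green G (csmooth_test_U d lambda hU bb) (csmooth_test_V d lambda' hV)
  (or_introl (fun j => separated_support d lambda _ _ (U j) bA)).
etransitivity; [|etransitivity; [exact: GF|]].
  apply: eq_bigr => j _; congr (_ + _ + _).
  - by apply: eq_big_nat => t; rewrite ltnS => ht; have [-> _] := wedge_integrals pb hlambda' hU hV bb ht.
  - apply: eq_bigr => sigma _; apply: eq_big_nat => mu; rewrite ltnS => hmu.
    have [_ _ _ hF] := homog_side G j sigma hmu.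
    have E : (ordB pb j sigma mu + (m.*2.-1 - ordB pb j sigma mu) + 1 = m.*2)%N.
      by rewrite subnKC ?ordB_le // addn1 m2.
    apply: esym; apply: (face_integral E (calB_face G hlambda' hU bb hmu)) => r z r0; exact: opD_v_side.
  - apply: eq_big_nat => q; rewrite ltnS => hq; apply: eq_big_nat => mu; rewrite ltnS => hmu.
    have [hB _] := homog_inner G hq hmu; have /andP[mu1 mum] := hmu.
    have mu2 : (mu <= m.*2)%N by rewrite -addnn (leq_trans mum) // leq_addr.
    have hq' : (1 <= q <= (nR g j).+1)%N by case/andP: hq => /ltnW -> /leqW ->.
    (* B_jq,mu has order 2m - mu and T_jq,mu order mu - 1, which makes 2m - 1 in all. *)
    have E : (m.*2 - mu + mu.-1 + 1 = m.*2)%N by rewrite -addnA addn1 prednK // subnK.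
    apply: esym; apply: (face_integral E (opD_u_face hlambda' hU bb hq' hB)) => r z r0.
    by apply: calT_cyl; rewrite ?mu1.
apply: eq_bigr => j _; congr (_ + _ + _).
- by apply: eq_big_nat => t; rewrite ltnS => ht; have [_ ->] := wedge_integrals pb hlambda' hU hV bb ht.
- apply: eq_bigr => sigma _; apply: eq_big_nat => mu; rewrite ltnS => hmu.
  have [_ hB hC _] := homog_side G j sigma hmu.
  have E : (m.*2.-1 - ordC G j sigma mu + ordC G j sigma mu + 1 = m.*2)%N.
    by rewrite subnK ?ordC_le // addn1 m2.
  apply: (face_integral E (opD_u_face hlambda' hU bb (side_range g j sigma) hB)) => r z r0; exact: opD_v_side.
- apply: eq_big_nat => q; rewrite ltnS => hq; apply: eq_big_nat => mu; rewrite ltnS => hmu.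
  have [_ hB] := homog_inner G hq hmu; have /andP[mu1 mum] := hmu.
  have hq' : (1 <= q <= (nR g j).+1)%N by case/andP: hq => /ltnW -> /leqW ->.
  (* Here the orders are m - mu for B'_jq,mu and m + mu - 1 for T_jq,m+mu. *)
  have E : (m - mu + (m + mu).-1 + 1 = m.*2)%N.
    by rewrite -addnA addn1 prednK ?addn_gt0 ?mu1 ?orbT // addnCA subnK // addnn.
  apply: (face_integral E (opD_u_face hlambda' hU bb hq' hB)) => r z r0.
  by apply: calT_cyl; rewrite // -addnn leq_add2l mum addn_gt0 mu1 orbT.
Qed.
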